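(* For 4CP on $\{1,2\}$-weighted graphs, there is a polynomial-time $7/8$-approximation algorithm.
   Context: A $\{1,2\}$-weighted graph is an undirected complete graph $G=(V,E)$ on $n$ vertices in which every edge has weight $1$ or $2$; the weight of a set of edges is the sum of their weights. A $4$-cycle is a simple cycle on exactly $4$ distinct vertices. When $4$ divides $n$, a $4$-cycle packing is a set of $n/4$ vertex-disjoint $4$-cycles covering all vertices. 4CP: given such a graph with $n$ divisible by $4$, find a $4$-cycle packing of maximum total weight. A $\rho$-approximation algorithm outputs on every instance a feasible solution of weight at least $\rho$ times the optimum. *)

(* Defs.v *)
From HB Require Import structures.
From mathcomp Require Import all_boot all_order all_algebra.

Set Implicit Arguments.
Unset Strict Implicit.
Unset Printing Implicit Defensive.

Import Order.TTheory GRing.Theory Num.Theory.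

(** Random-access machines over unbounded natural numbers, with structured
    control flow.  There is deliberately no multiplication instruction: with
    addition and subtraction only, a value computed in [t] steps has at most
    [t] bits more than the largest input or program constant, so unit-cost
    time is polynomially related to Turing machine time. *)
Inductive cmd : Type :=
| Skip
| Const (x a : nat)      (* r_x := a *)
| Add (x y z : nat)      (* r_x := r_y + r_z *)
| Sub (x y z : nat)      (* r_x := r_y - r_z, truncated at 0 *)
| Read (x y : nat)       (* r_x := mem[r_y] *)
| Write (x y : nat)      (* mem[r_x] := r_y *)
| Emit (x : nat)         (* append r_x to the output *)
| Seq (c1 c2 : cmd)
| If (x : nat) (c1 c2 : cmd)  (* c1 if r_x <> 0, c2 otherwise *)
| While (x : nat) (c : cmd).  (* repeat c as long as r_x <> 0 *)

Record state : Type := State {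
  reg : nat -> nat;
  mem : nat -> nat;
  out : seq nat
}.

Definition upd (f : nat -> nat) (x a : nat) : nat -> nat :=
  fun z => if z == x then a else f z.

Definition set_reg (s : state) (x a : nat) : state :=
  State (upd (reg s) x a) (mem s) (out s).

(** [exec c s t s']: started in [s], the program [c] halts after exactly [t]
    steps in [s']; every instruction and every test counts for one step. *)
Inductive exec : cmd -> state -> nat -> state -> Prop :=
| exec_skip s : exec Skip s 1 s
| exec_const s x a : exec (Const x a) s 1 (set_reg s x a)
| exec_add s x y z : exec (Add x y z) s 1 (set_reg s x (reg s y + reg s z))
| exec_sub s x y z : exec (Sub x y z) s 1 (set_reg s x (reg s y - reg s z))
| exec_read s x y : exec (Read x y) s 1 (set_reg s x (mem s (reg s y)))
| exec_write s x y :
    exec (Write x y) s 1 (State (reg s) (upd (mem s) (reg s x) (reg s y)) (out s))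
| exec_emit s x :
    exec (Emit x) s 1 (State (reg s) (mem s) (rcons (out s) (reg s x)))
| exec_seq c1 c2 s1 s2 s3 t1 t2 :
    exec c1 s1 t1 s2 -> exec c2 s2 t2 s3 -> exec (Seq c1 c2) s1 (t1 + t2) s3
| exec_if_true x c1 c2 s s' t :
    reg s x != 0 -> exec c1 s t s' -> exec (If x c1 c2) s t.+1 s'
| exec_if_false x c1 c2 s s' t :
    reg s x = 0 -> exec c2 s t s' -> exec (If x c1 c2) s t.+1 s'
| exec_while_stop x c s : reg s x = 0 -> exec (While x c) s 1 s
| exec_while_step x c s1 s2 s3 t1 t2 :
    reg s1 x != 0 -> exec c s1 t1 s2 -> exec (While x c) s2 t2 s3 ->
    exec (While x c) s1 (t1 + t2).+1 s3.

Lemma exec_det c s t1 s1 : exec c s t1 s1 ->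
  forall t2 s2, exec c s t2 s2 -> t1 = t2 /\ s1 = s2.
Proof.
elim=> {c s t1 s1}.
1-7: by move=> *; match goal with H : exec _ _ _ _ |- _ => inversion H end.
all: intros; match goal with H : exec _ _ ?t _ |- _ = ?t /\ _ => inversion H; subst end.
all: try match goal with H : is_true (reg ?s ?x != 0), E : reg ?s ?x = 0 |- _ =>
  by rewrite E in H end.
all: repeat match goal with
  IH : forall t s, exec ?c ?s1 t s -> _, H : exec ?c ?s1 _ _ |- _ =>
    have [? ?] := IH _ _ H; clear IH; subst end.
all: by [].
Qed.

(** The input word is stored in [mem] from address 0 on. *)
Definition init (x : seq nat) : state :=
  State (fun _ => 0) (nth 0 x) [::].

Definition runs (c : cmd) (x : seq nat) (t : nat) (y : seq nat) : Prop :=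
  exists2 s, exec c (init x) t s & out s = y.

(** Binary length of a word of numbers, at least one bit per entry. *)
Definition bitsize (x : seq nat) : nat :=
  \sum_(a <- x) (trunc_log 2 a).+1.

Definition polynomial_time (c : cmd) (inputs : seq nat -> Prop) : Prop :=
  exists p : {poly nat}, forall x, inputs x ->
    exists t y, runs c x t y /\ t <= p.[bitsize x]%R.

(** A {1,2}-weighted complete graph on the vertex set ['I_n]; its edges are the
    2-element sets of vertices, and the values of [weight] on other sets are
    irrelevant. *)
Record graph12 (n : nat) : Type := Graph12 {
  weight :> {set 'I_n} -> nat;
  weight12 : forall e : {set 'I_n}, #|e| = 2 -> weight e = 1 \/ weight e = 2
}.

(** Cycles are represented by their edge sets; [cover C] is then the set of
    vertices of [C]. *)
Definition cycle4 (n : nat) (a b c d : 'I_n) : {set {set 'I_n}} :=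
  [set [set a; b]; [set b; c]; [set c; d]; [set d; a]].

Definition is_cycle4 (n : nat) (C : {set {set 'I_n}}) : bool :=
  [exists a, exists b, exists c, exists d,
     uniq [:: a; b; c; d] && (C == cycle4 a b c d)].

Definition packing4 (n : nat) (P : {set {set {set 'I_n}}}) : bool :=
  [&& #|P| == n %/ 4,
      [forall C in P, is_cycle4 C],
      [forall C in P, forall D in P, (C != D) ==> [disjoint cover C & cover D]]
    & \bigcup_(C in P) cover C == [set: 'I_n]].

Definition edges_weight (n : nat) (G : graph12 n) (C : {set {set 'I_n}}) : nat := \sum_(e in C) G e.

Definition packing_weight (n : nat) (G : graph12 n) (P : {set {set {set 'I_n}}}) : nat := \sum_(C in P) edges_weight G C.

Definition opt4CP (n : nat) (G : graph12 n) : nat := \max_(P | packing4 P) packing_weight G P.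

(** An instance is written as [n] followed by the rows of its weight matrix,
    with zeros on the diagonal. *)
Definition encode (n : nat) (G : graph12 n) : seq nat :=
  n :: [seq (if i == j then 0 else G [set i; j]) | i <- enum 'I_n, j <- enum 'I_n].

(** A solution is written by listing the vertices of its cycles in cyclic
    order, one cycle after the other. *)
Fixpoint cycles_of (n : nat) (s : seq 'I_n) : {set {set {set 'I_n}}} :=
  if s is a :: b :: c :: d :: s' then cycle4 a b c d |: cycles_of s' else set0.

Definition instance_4CP (x : seq nat) : Prop :=
  exists (n : nat) (G : graph12 n), 4 %| n /\ x = encode G.

Definition approximation_algorithm_4CP (rho : rat) (c : cmd) : Prop :=
  forall (n : nat) (G : graph12 n), 4 %| n ->
    exists (t : nat) (vs : n.-tuple 'I_n),
      [/\ runs c (encode G) t [seq val v | v <- vs],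
          packing4 (cycles_of vs)
        & (rho * (opt4CP G)%:R <= (packing_weight G (cycles_of vs))%:R)%R].

(* Main.v *)
Require Import Defs.
From HB Require Import structures.
From mathcomp Require Import all_boot all_order all_algebra zify.
Set Implicit Arguments.
Unset Strict Implicit.
Unset Printing Implicit Defensive.

(** Call an edge good when it has weight 2.  Take a maximum matching [M0] of the good
    edges and complete it to a perfect matching [m]; contract the pairs of [m], two pairs
    being adjacent when some good edge joins them; take a maximum matching [M1] of the
    contracted graph and complete it as well.  Two paired pairs [{m x, x}], [{y, m y}] are
    closed into the cycle [m x, x, y, m y], where [x y] is good whenever possible.
    If [F0] vertices and [f] pairs are left unmatched, then the weight of this packing is
    at least [n + (n - F0) / 2 + (n / 2 - f) / 2], which is [output_weight].  Conversely any
    packing [Q] satisfies [7 * weight Q + 4 * F0 + 4 * f <= 14 * n]: the blocks of a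
    Tutte-Berge witness for [M1] are odd, hence cover 2 modulo 4 vertices of the graph, so
    the cycles of [Q] cannot all be fully good without crossing the block borders, and
    summing a bound over the cycles, in which the good edges of the cycles also compete with
    [M0], gives the claim.  Eliminating [n], [F0] and [f] yields the ratio 7/8.

    The maximum matchings are found without shrinking: every reachable vertex [x] carries a
    matching of the same size as the current one that misses [x].  An edge between two
    reachable vertices is scanned by rotating along it, which yields further such matchings
    or a larger matching; blossoms occur only in the invariant [search], from which the
    Tutte-Berge witness is read off once nothing changes any more. *)

(** * A loop language compiled to the machine *)

(** The two bounds fit together because both charge [F0] and [f] in the same proportion to [n]. The
    coefficients of the upper bound come from a single cycle, where the estimate leaves no slack in
    two cases: four good edges, and exactly two good edges that are consecutive. The main obstacle
    is to obtain maximum matchings on a bare machine with a verified running time. All programs are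
    built from loops of exactly [n] iterations, so termination and a polynomial time bound follow
    from the syntax alone; flags let such a loop idle once its work is done. Storing a whole
    matching for every reachable vertex takes [n * n] cells, but spares the program parent pointers,
    blossom bases and the expansion of blossoms. The price is paid in the invariant: how the stored
    matchings behave on a blossom is recovered by parity and counting. The contracted graph is kept
    on the original vertex set, so that one matching program serves for both graphs. *)

Inductive exp : Type :=
| EVar (x : nat)
| ECst (a : nat)
| ENum
| EAdd (a b : exp)
| ESub (a b : exp)
| ELd (k : nat) (a b : exp).

Inductive stm : Type :=
| SSkip
| SAsg (x : nat) (e : exp)
| SSt (k : nat) (a b e : exp)
| SEmit (e : exp)
| SSeq (s1 s2 : stm)
| SIf (e : exp) (s1 s2 : stm)
| SFor (x : nat) (s : stm).

Record ust : Type := Ust {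
  env : nat -> nat;
  arr : nat -> nat -> nat -> nat;
  uout : seq nat
}.

Definition setv (u : ust) (x a : nat) : ust :=
  Ust (upd (env u) x a) (arr u) (uout u).

Definition setc (u : ust) (k r c a : nat) : ust :=
  Ust (env u)
    (fun k' r' c' => if [&& k' == k, r' == r & c' == c] then a else arr u k' r' c')
    (uout u).

Fixpoint ev (n : nat) (e : exp) (u : ust) : nat :=
  match e with
  | EVar x => env u x
  | ECst a => a
  | ENum => n
  | EAdd a b => ev n a u + ev n b u
  | ESub a b => ev n a u - ev n b u
  | ELd k a b => if (ev n a u < n) && (ev n b u < n)
                 then arr u k (ev n a u) (ev n b u) else 0
  end.

(** Stores outside the [n] by [n] range are dropped and loads there give 0, because cell addresses
    are injective only inside the range. A loop counts independently of its variable, so it makes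
    exactly [n] iterations whatever the body assigns. *)
Fixpoint eval (n : nat) (s : stm) (u : ust) : ust :=
  match s with
  | SSkip => u
  | SAsg x e => setv u x (ev n e u)
  | SSt k a b e => if (ev n a u < n) && (ev n b u < n)
                   then setc u k (ev n a u) (ev n b u) (ev n e u) else u
  | SEmit e => Ust (env u) (arr u) (rcons (uout u) (ev n e u))
  | SSeq s1 s2 => eval n s2 (eval n s1 u)
  | SIf e s1 s2 => if ev n e u != 0 then eval n s1 u else eval n s2 u
  | SFor x s => foldl (fun u' i => eval n s (setv u' x i)) u (iota 0 n)
  end.

(** Cell 0 of the memory holds [n], and the offset 1 makes array 0 coincide with the weight matrix
    of the encoded input, which therefore is used in place. *)
Definition addr (n k r c : nat) : nat := (k * n + r) * n + c + 1.

Lemma addr_inj n k r c k' r' c' : r < n -> c < n -> r' < n -> c' < n ->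
  addr n k r c = addr n k' r' c' -> [/\ k = k', r = r' & c = c'].
Proof.
rewrite /addr => rn cn rn' cn' /eqP; rewrite eqn_add2r => /eqP E.
have n0 : 0 < n by lia.
have := congr1 (fun m => m %% n) E; rewrite !modnMDl !modn_small // => Ec.
have := congr1 (fun m => m %/ n) E.
rewrite !divnMDl // !divn_small // !addn0 => {}E.
have := congr1 (fun m => m %% n) E; rewrite !modnMDl !modn_small // => Er.
have := congr1 (fun m => m %/ n) E.
by rewrite !divnMDl // !divn_small // !addn0 => Ek.
Qed.

(** User variables live in the even registers and scratch values in the odd
    ones; [hr 0] permanently holds the size of the instance. *)
Definition ur (x : nat) : nat := 2 * x.
Definition hr (d : nat) : nat := 2 * d + 1.

(** * Total correctness with a time bound *)

Definition wp (c : cmd) (T : nat) (Q : state -> Prop) (s : state) : Prop :=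
  exists t s', [/\ exec c s t s', t <= T & Q s'].

Lemma wp_conseq c T T' (Q Q' : state -> Prop) s :
  wp c T Q s -> T <= T' -> (forall s', Q s' -> Q' s') -> wp c T' Q' s.
Proof.
move=> [t [s' [H1 H2 H3]]] TT QQ; exists t, s'; split=> //; last exact: QQ.
exact: leq_trans TT.
Qed.

Lemma wp_seq c1 c2 T1 T2 T Q s :
  wp c1 T1 (wp c2 T2 Q) s -> T1 + T2 <= T -> wp (Seq c1 c2) T Q s.
Proof.
move=> [t1 [s1 [E1 L1 [t2 [s2 [E2 L2 HQ]]]]]] LT.
exists (t1 + t2), s2; split=> //; first exact: exec_seq E2.
by apply: leq_trans LT; rewrite leq_add.
Qed.

Lemma wp_skip (Q : state -> Prop) s T : 0 < T -> Q s -> wp Skip T Q s.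
Proof. by move=> T0 HQ; exists 1, s; split=> //; constructor. Qed.

Lemma wp_const x a T (Q : state -> Prop) s : 0 < T -> Q (set_reg s x a) ->
  wp (Const x a) T Q s.
Proof. by move=> T0 HQ; exists 1, (set_reg s x a); split=> //; constructor. Qed.

Lemma wp_add x y z T (Q : state -> Prop) s : 0 < T ->
  Q (set_reg s x (reg s y + reg s z)) -> wp (Add x y z) T Q s.
Proof. by move=> T0 HQ; eexists 1, _; split; [constructor| |exact: HQ]. Qed.

Lemma wp_sub x y z T (Q : state -> Prop) s : 0 < T ->
  Q (set_reg s x (reg s y - reg s z)) -> wp (Defs.Sub x y z) T Q s.
Proof. by move=> T0 HQ; eexists 1, _; split; [constructor| |exact: HQ]. Qed.

Lemma wp_read x y T (Q : state -> Prop) s : 0 < T ->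
  Q (set_reg s x (Defs.mem s (reg s y))) -> wp (Read x y) T Q s.
Proof. by move=> T0 HQ; eexists 1, _; split; [constructor| |exact: HQ]. Qed.

Lemma wp_write x y T (Q : state -> Prop) s : 0 < T ->
  Q (State (reg s) (upd (Defs.mem s) (reg s x) (reg s y)) (out s)) ->
  wp (Write x y) T Q s.
Proof. by move=> T0 HQ; eexists 1, _; split; [constructor| |exact: HQ]. Qed.

Lemma wp_emit x T (Q : state -> Prop) s : 0 < T ->
  Q (State (reg s) (Defs.mem s) (rcons (out s) (reg s x))) -> wp (Emit x) T Q s.
Proof. by move=> T0 HQ; eexists 1, _; split; [constructor| |exact: HQ]. Qed.

Lemma wp_if x c1 c2 T1 T2 T Q s :
  (reg s x != 0 -> wp c1 T1 Q s) -> (reg s x = 0 -> wp c2 T2 Q s) ->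
  T1 + T2 < T -> wp (If x c1 c2) T Q s.
Proof.
move=> H1 H2 LT; case: (eqVneq (reg s x) 0) => [E|E].
  have [t [s' [He Ht HQ]]] := H2 E.
  by exists t.+1, s'; split=> //; [exact: exec_if_false|lia].
have [t [s' [He Ht HQ]]] := H1 E.
by exists t.+1, s'; split=> //; [exact: exec_if_true|lia].
Qed.

(** The invariant is indexed by the number of iterations still to run. *)
Lemma wp_while x c T T0 (I : nat -> state -> Prop) :
  (forall m s, I m.+1 s -> reg s x != 0 /\ wp c T0 (I m) s) ->
  (forall s, I 0 s -> reg s x = 0) ->
  forall m s, I m s -> m * T0.+1 + 1 <= T -> wp (While x c) T (I 0) s.
Proof.
move=> HS H0 m; elim: m T => [|m IH] T s Is LT.
  by exists 1, s; split=> //; apply: exec_while_stop; apply: H0.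
have [nz [t1 [s1 [E1 L1 I1]]]] := HS _ _ Is.
have [t2 [s2 [E2 L2 I2]]] := IH (m * T0.+1 + 1) s1 I1 (leqnn _).
exists (t1 + t2).+1, s2; split=> //; last by move: LT; rewrite mulSn; lia.
exact: exec_while_step E2.
Qed.

(** The frame condition of code working at scratch depth [d]: only scratch registers from [hr d]
    upwards may be disturbed. A nested evaluation at depth [d.+1] thus preserves the intermediate
    result in [hr d]. *)
Definition keep (d : nat) (s s' : state) : Prop :=
  [/\ Defs.mem s' = Defs.mem s, out s' = out s,
      forall x, reg s' (ur x) = reg s (ur x) &
      forall h, h < d -> reg s' (hr h) = reg s (hr h)].

Lemma keep_refl d s : keep d s s. Proof. by []. Qed.

Lemma keep_trans d s1 s2 s3 : keep d s1 s2 -> keep d s2 s3 -> keep d s1 s3.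
Proof.
move=> [a1 b1 c1 d1] [a2 b2 c2 d2]; split.
- by rewrite a2.
- by rewrite b2.
- by move=> x; rewrite c2.
- by move=> h hd; rewrite d2 // d1.
Qed.

Lemma keepW d d' s s' : d <= d' -> keep d' s s' -> keep d s s'.
Proof.
by move=> dd [a b c e]; split=> // h hd; apply: e; apply: leq_trans dd.
Qed.

Lemma set_regE s x a y : reg (set_reg s x a) y = if y == x then a else reg s y.
Proof. by []. Qed.

Lemma hr_eq d d' : (hr d == hr d') = (d == d').
Proof. rewrite /hr; lia. Qed.

Lemma ur_eq d d' : (ur d == ur d') = (d == d').
Proof. rewrite /ur; lia. Qed.

Lemma ur_hr x d : (ur x == hr d) = false.
Proof. rewrite /hr /ur; lia. Qed.

Lemma hr_ur x d : (hr d == ur x) = false.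
Proof. rewrite /hr /ur; lia. Qed.

Lemma keep_set d d' s s' a : keep d s s' -> d <= d' -> keep d s (set_reg s' (hr d') a).
Proof.
move=> [k1 k2 k3 k4] dd; split=> // [x|h hd]; rewrite set_regE ?ur_hr ?hr_eq //.
by rewrite ltn_eqF ?k4 //; apply: leq_trans dd.
Qed.

Lemma updE f x a y : upd f x a y = if y == x then a else f y.
Proof. by []. Qed.

Ltac regs := rewrite ?set_regE ?updE ?hr_eq ?ur_eq ?ur_hr ?hr_ur ?eqxx /=;
  repeat match goal with
  | |- context [eq_op ?a ?b] =>
    first [ have -> : (a == b) = false by lia | have -> : (a == b) = true by lia ]
  end.

Fixpoint addk (k d : nat) : cmd :=
  if k is k'.+1 then Seq (Add (hr d) (hr d) (hr 0)) (addk k' d) else Skip.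

Lemma wp_addk k d s T (Q : state -> Prop) : 0 < d ->
  (forall s', keep d s s' -> (forall h, d < h -> reg s' (hr h) = reg s (hr h)) ->
     reg s' (hr d) = reg s (hr d) + k * reg s (hr 0) -> Q s') ->
  k < T -> wp (addk k d) T Q s.
Proof.
move=> d0; elim: k s T => [|k IH] s T HQ LT /=.
  by apply: wp_skip => //; apply: HQ; rewrite ?addn0.
apply: (@wp_seq _ _ 1 k.+1); last by lia.
apply: wp_add => //; apply: IH => // s' K H E; apply: HQ.
- exact: keep_trans (keep_set _ (keep_refl _ _) (leqnn _)) K.
- by move=> h dh; rewrite H //; regs.
- by rewrite E; regs; lia.
Qed.

(** The machine cannot multiply, so the product with [n] is computed by [n] additions, counted down
    in [hr e.+1] with the unit in [hr e.+2]. Clearing a register and adding to it replaces a copy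
    instruction. *)
Definition mulN (d e : nat) : cmd :=
  Seq (Const (hr e) 0)
  (Seq (Const (hr e.+1) 0)
  (Seq (Add (hr e.+1) (hr e.+1) (hr 0))
  (Seq (Const (hr e.+2) 1)
  (Seq (While (hr e.+1)
         (Seq (Add (hr e) (hr e) (hr d)) (Defs.Sub (hr e.+1) (hr e.+1) (hr e.+2))))
  (Seq (Const (hr d) 0) (Add (hr d) (hr d) (hr e))))))).

Lemma wp_mulN d e s (Q : state -> Prop) : 0 < d -> d < e ->
  (forall s', keep d s s' ->
     (forall h, d < h < e -> reg s' (hr h) = reg s (hr h)) ->
     reg s' (hr d) = reg s (hr d) * reg s (hr 0) -> Q s') ->
  wp (mulN d e) (3 * reg s (hr 0) + 7) Q s.
Proof.
move=> d0 de HQ; set n := reg s (hr 0).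
apply: (@wp_seq _ _ 1 (3 * n + 6)); last by lia.
apply: wp_const => //.
apply: (@wp_seq _ _ 1 (3 * n + 5)); last by lia.
apply: wp_const => //.
apply: (@wp_seq _ _ 1 (3 * n + 4)); last by lia.
apply: wp_add => //.
apply: (@wp_seq _ _ 1 (3 * n + 3)); last by lia.
apply: wp_const => //.
pose I m s' := [/\ keep e s s', reg s' (hr e) = (n - m) * reg s (hr d),
   reg s' (hr e.+1) = m, reg s' (hr e.+2) = 1 & m <= n].
apply: (@wp_seq _ _ (3 * n + 1) 2); last by lia.
apply: (@wp_conseq _ (3 * n + 1) _ (I 0)) => //; last first.
  move=> s' [K He _ _ _].
  apply: (@wp_seq _ _ 1 1) => //; apply: wp_const => //; apply: wp_add => //.
  apply: HQ.
  - do 2 (apply: keep_set => //; try lia); exact: keepW (ltnW de) K.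
  - by move=> h /andP[h1 h2]; regs; case: K => _ _ _ ->.
  - regs; rewrite He; lia.
apply: (@wp_while _ _ _ 2 I _ _ n) => //=; last by lia.
- move=> m s' [K He He1 He2 mn]; split; first by rewrite He1.
  apply: (@wp_seq _ _ 1 1) => //; apply: wp_add => //; apply: wp_sub => //.
  split; last by lia.
  + by do 2 (apply: keep_set => //; try lia).
  + regs; have -> : reg s' (hr d) = reg s (hr d) by case: K => _ _ _ ->.
    rewrite He; nia.
  + regs; rewrite He1 He2; lia.
  + by regs.
- by move=> s' [].
split => //.
- by do 4 (apply: keep_set => //; try lia).
- by regs; rewrite subnn.
- by regs.
- by regs.
Qed.

(** A Horner scheme for [addr], with the row in [hr d] and the column in [hr d.+1]; adding [n] to
    the row [k] times avoids a second product. *)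
Definition caddr (k d e : nat) : cmd :=
  Seq (addk k d) (Seq (mulN d e) (Seq (Add (hr d) (hr d) (hr d.+1))
  (Seq (Const (hr e) 1) (Add (hr d) (hr d) (hr e))))).

Lemma wp_caddr k d e s (Q : state -> Prop) : 0 < d -> d.+1 < e ->
  (forall s', keep d s s' ->
     (forall h, d < h < e -> reg s' (hr h) = reg s (hr h)) ->
     reg s' (hr d) = addr (reg s (hr 0)) k (reg s (hr d)) (reg s (hr d.+1)) -> Q s') ->
  wp (caddr k d e) (3 * reg s (hr 0) + k + 12) Q s.
Proof.
move=> d0 de HQ; set n := reg s (hr 0).
apply: (@wp_seq _ _ (k.+1) (3 * n + 10)); last by lia.
apply: wp_addk => // s1 K1 F1 E1.
have n1 : reg s1 (hr 0) = n by case: K1 => _ _ _ ->.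
apply: (@wp_seq _ _ (3 * n + 7) 3); last by lia.
rewrite -n1; apply: wp_mulN => // [|s2 K2 F2 E2]; first by lia.
apply: (@wp_seq _ _ 1 2) => //; apply: wp_add => //.
apply: (@wp_seq _ _ 1 1) => //; apply: wp_const => //; apply: wp_add => //.
apply: HQ.
- do 3 (apply: keep_set => //; try lia).
  exact: keep_trans K1 K2.
- by move=> h /andP[h1 h2]; regs; rewrite F2 ?h1 // F1.
- regs; rewrite E2 E1 n1 F2 ?(F1 d.+1) //; last by lia.
  by rewrite /addr -/n; lia.
Qed.

(** * Compilation of expressions and statements *)

Fixpoint cexp (e : exp) (d : nat) : cmd :=
  match e with
  | EVar x => Seq (Const (hr d) 0) (Add (hr d) (hr d) (ur x))
  | ECst a => Const (hr d) a
  | ENum => Seq (Const (hr d) 0) (Add (hr d) (hr d) (hr 0))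
  | EAdd a b => Seq (cexp a d) (Seq (cexp b d.+1) (Add (hr d) (hr d) (hr d.+1)))
  | ESub a b => Seq (cexp a d) (Seq (cexp b d.+1) (Defs.Sub (hr d) (hr d) (hr d.+1)))
  | ELd k a b => Seq (cexp a d) (Seq (cexp b d.+1)
      (Seq (Defs.Sub (hr d.+2) (hr 0) (hr d))
      (If (hr d.+2)
        (Seq (Defs.Sub (hr d.+2) (hr 0) (hr d.+1))
         (If (hr d.+2) (Seq (caddr k d d.+2) (Read (hr d) (hr d))) (Const (hr d) 0)))
        (Const (hr d) 0))))
  end.

Fixpoint texp (n : nat) (e : exp) : nat :=
  match e with
  | EVar _ | ENum => 2
  | ECst _ => 1
  | EAdd a b | ESub a b => texp n a + texp n b + 1
  | ELd k a b => texp n a + texp n b + (3 * n + k + 20)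
  end.

Definition simulates (n : nat) (s : state) (u : ust) : Prop :=
  [/\ reg s (hr 0) = n, forall x, reg s (ur x) = env u x,
      forall k r c, r < n -> c < n -> Defs.mem s (addr n k r c) = arr u k r c &
      out s = uout u].

Lemma simulates_keep n d s s' u : 0 < d -> keep d s s' -> simulates n s u -> simulates n s' u.
Proof.
move=> d0 [k1 k2 k3 k4] [r1 r2 r3 r4]; split=> [|x|k r c rn cn|].
- by rewrite k4.
- by rewrite k3.
- by rewrite k1 r3.
- by rewrite k2.
Qed.

Lemma keepE d s s' h : keep d s s' -> h < d -> reg s' (hr h) = reg s (hr h).
Proof. by case=> _ _ _; apply. Qed.

Lemma wp_cexp n e : forall d s u (Q : state -> Prop), 0 < d -> simulates n s u ->
  (forall s', keep d s s' -> reg s' (hr d) = ev n e u -> Q s') ->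
  wp (cexp e d) (texp n e) Q s.
Proof.
elim: e => [x|a||a IHa b IHb|a IHa b IHb|k a IHa b IHb] d s u Q d0 R HQ /=.
- apply: (@wp_seq _ _ 1 1) => //; apply: wp_const => //; apply: wp_add => //.
  apply: HQ; first by do 2 (apply: keep_set => //).
  by regs; case: R => _ -> _ _.
- apply: wp_const => //; apply: HQ; first by apply: keep_set.
  by regs.
- apply: (@wp_seq _ _ 1 1) => //; apply: wp_const => //; apply: wp_add => //.
  apply: HQ; first by do 2 (apply: keep_set => //).
  by regs; case: R => ->.
- apply: (@wp_seq _ _ (texp n a) (texp n b + 1)); last by lia.
  apply: (IHa _ _ u) => // s1 K1 E1.
  apply: (@wp_seq _ _ (texp n b) 1); last by lia.
  apply: (IHb _ _ u) => // [|s2 K2 E2]; first exact: (simulates_keep d0 K1 R).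
  apply: wp_add => //; apply: HQ.
    by apply: keep_set => //; apply: keep_trans K1 (keepW _ K2).
  by regs; rewrite E2 (keepE K2) // E1.
- apply: (@wp_seq _ _ (texp n a) (texp n b + 1)); last by lia.
  apply: (IHa _ _ u) => // s1 K1 E1.
  apply: (@wp_seq _ _ (texp n b) 1); last by lia.
  apply: (IHb _ _ u) => // [|s2 K2 E2]; first exact: (simulates_keep d0 K1 R).
  apply: wp_sub => //; apply: HQ.
    by apply: keep_set => //; apply: keep_trans K1 (keepW _ K2).
  by regs; rewrite E2 (keepE K2) // E1.
apply: (@wp_seq _ _ (texp n a) (texp n b + (3 * n + k + 20))); last by lia.
apply: (IHa _ _ u) => // s1 K1 E1.
apply: (@wp_seq _ _ (texp n b) (3 * n + k + 20)); last by lia.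
apply: (IHb _ _ u) => // [|s2 K2 E2]; first exact: (simulates_keep d0 K1 R).
have K12 : keep d s s2 by apply: keep_trans K1 (keepW _ K2).
have {}E1 : reg s2 (hr d) = ev n a u by rewrite (keepE K2).
have n2 : reg s2 (hr 0) = n by rewrite (keepE K12) //; case: R.
apply: (@wp_seq _ _ 1 (3 * n + k + 18)); last by lia.
apply: wp_sub => //; rewrite n2 E1.
set s3 := set_reg _ _ _.
have K3 : keep d s2 s3 by apply: keep_set => //; lia.
have R3 : simulates n s3 u by apply: (simulates_keep d0 (keep_trans K12 K3) R).
have E13 : reg s3 (hr d) = ev n a u by rewrite /s3; regs.
have E23 : reg s3 (hr d.+1) = ev n b u by rewrite /s3; regs.
apply: (@wp_if _ _ _ (3 * n + k + 16) 1); last by lia.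
  rewrite {1}/s3; regs => rn.
  apply: (@wp_seq _ _ 1 (3 * n + k + 15)); last by lia.
  apply: wp_sub => //; rewrite E23.
  have -> : reg s3 (hr 0) = n by case: R3.
  set s4 := set_reg _ _ _.
  have K4 : keep d s3 s4 by apply: keep_set => //; lia.
  have [n4 R4 A4 _] : simulates n s4 u by apply: (simulates_keep d0 (keep_trans K12 (keep_trans K3 K4)) R).
  apply: (@wp_if _ _ _ (3 * n + k + 13) 1); last by lia.
    rewrite {1}/s4; regs => cn.
    apply: (@wp_seq _ _ (3 * n + k + 12) 1); last by lia.
    rewrite -{1}n4; apply: wp_caddr => // s5 K5 F5 E5.
    apply: wp_read => //; apply: HQ.
      apply: keep_set => //.
      exact: keep_trans K12 (keep_trans K3 (keep_trans K4 K5)).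
    rewrite [RHS]/=.
    have -> : ev n a u < n by lia.
    have -> : ev n b u < n by lia.
    rewrite -A4; try lia.
    case: K5 => -> _ _ _; rewrite E5 n4 /s4; regs; rewrite E1 E2.
    by [].
  rewrite {1}/s4; regs => cn; apply: wp_const => //; apply: HQ.
    by apply: keep_set => //; apply: keep_trans K12 (keep_trans K3 K4).
  by regs; rewrite andbC; case: ltnP => //; lia.
rewrite {1}/s3; regs => rn; apply: wp_const => //; apply: HQ.
  by apply: keep_set => //; apply: keep_trans K12 K3.
by regs; case: ltnP => //; lia.
Qed.

(** In a loop [hr d] counts and [hr d.+1] is the number of iterations left. The body is compiled at
    depth [d.+1] and may destroy the latter, which is recomputed from [n] and [hr d] after each
    iteration. *)
Fixpoint cstm (s : stm) (d : nat) : cmd :=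
  match s with
  | SSkip => Skip
  | SAsg x e => Seq (cexp e d) (Seq (Const (ur x) 0) (Add (ur x) (ur x) (hr d)))
  | SSt k a b e => Seq (cexp a d) (Seq (cexp b d.+1) (Seq (cexp e d.+2)
      (Seq (Defs.Sub (hr d.+3) (hr 0) (hr d))
      (If (hr d.+3)
        (Seq (Defs.Sub (hr d.+3) (hr 0) (hr d.+1))
         (If (hr d.+3) (Seq (caddr k d d.+3) (Write (hr d) (hr d.+2))) Skip))
        Skip))))
  | SEmit e => Seq (cexp e d) (Emit (hr d))
  | SSeq s1 s2 => Seq (cstm s1 d) (cstm s2 d)
  | SIf e s1 s2 => Seq (cexp e d) (If (hr d) (cstm s1 d) (cstm s2 d))
  | SFor x s => Seq (Const (hr d) 0) (Seq (Defs.Sub (hr d.+1) (hr 0) (hr d))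
      (While (hr d.+1)
        (Seq (Const (ur x) 0) (Seq (Add (ur x) (ur x) (hr d))
        (Seq (cstm s d.+1)
        (Seq (Const (hr d.+1) 1) (Seq (Add (hr d) (hr d) (hr d.+1))
           (Defs.Sub (hr d.+1) (hr 0) (hr d)))))))))
  end.

(** A conditional is charged for both branches: a sum in place of a maximum keeps the bound a
    polynomial in [n] with natural coefficients. *)
Fixpoint tstm (n : nat) (s : stm) : nat :=
  match s with
  | SSkip => 1
  | SAsg _ e => texp n e + 2
  | SSt k a b e => texp n a + texp n b + texp n e + (3 * n + k + 20)
  | SEmit e => texp n e + 1
  | SSeq s1 s2 => tstm n s1 + tstm n s2
  | SIf e s1 s2 => texp n e + (tstm n s1 + tstm n s2 + 1)
  | SFor x s => n * (tstm n s + 6) + 3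
  end.

Lemma wp_cstm n s : forall d st u, 0 < d -> simulates n st u ->
  wp (cstm s d) (tstm n s)
    (fun st' => simulates n st' (eval n s u) /\
       forall h, h < d -> reg st' (hr h) = reg st (hr h)) st.
Proof.
elim: s => [|x e|k a b e|e|s1 IH1 s2 IH2|e s1 IH1 s2 IH2|x s IH] d st u d0 R /=.
- exact: wp_skip.
- apply: (@wp_seq _ _ (texp n e) 2); last by lia.
  apply: (wp_cexp d0 R) => s1 K1 E1.
  apply: (@wp_seq _ _ 1 1) => //; apply: wp_const => //; apply: wp_add => //.
  have [r1 r2 r3 r4] := simulates_keep d0 K1 R; split.
    split=> [|y|//|//]; first by regs.
    by rewrite /= updE; regs; case: (eqVneq y x) => // _; rewrite E1.
  by move=> h hd; regs; rewrite (keepE K1).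
- apply: (@wp_seq _ _ (texp n a) (texp n b + texp n e + (3 * n + k + 20))); last by lia.
  apply: (wp_cexp d0 R) => s1 K1 E1.
  have R1 := simulates_keep d0 K1 R.
  apply: (@wp_seq _ _ (texp n b) (texp n e + (3 * n + k + 20))); last by lia.
  apply: (wp_cexp _ R1) => // s2 K2 E2.
  have E12 : reg s2 (hr d) = ev n a u by rewrite (keepE K2).
  have {}K2 := keepW (leqnSn _) K2; have R2 := simulates_keep d0 K2 R1.
  apply: (@wp_seq _ _ (texp n e) (3 * n + k + 20)); last by lia.
  apply: (wp_cexp _ R2) => // s3 K3 E3.
  have E23 : reg s3 (hr d.+1) = ev n b u by rewrite (keepE K3).
  have E13 : reg s3 (hr d) = ev n a u by rewrite (keepE K3) //; lia.
  have {}K3 : keep d s2 s3 by apply: keepW K3; lia.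
  have {}K3 : keep d st s3 by apply: keep_trans K1 (keep_trans K2 K3).
  have R3 := simulates_keep d0 K3 R; have n3 : reg s3 (hr 0) = n by case: R3.
  apply: (@wp_seq _ _ 1 (3 * n + k + 19)); last by lia.
  apply: wp_sub => //; rewrite n3 E13.
  set s4 := set_reg _ _ _.
  have K4 : keep d st s4 by apply: keep_set => //; lia.
  have R4 := simulates_keep d0 K4 R; have n4 : reg s4 (hr 0) = n by case: R4.
  have skip s' : keep d st s' -> ~~ ((ev n a u < n) && (ev n b u < n)) ->
      wp Skip 1 (fun st' => simulates n st'
        (if (ev n a u < n) && (ev n b u < n)
         then setc u k (ev n a u) (ev n b u) (ev n e u) else u) /\
        forall h, h < d -> reg st' (hr h) = reg st (hr h)) s'.
    move=> K /negbTE ->; apply: wp_skip => //; split; first exact: simulates_keep d0 K R.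
    by move=> h hd; exact: (keepE K hd).
  apply: (@wp_if _ _ _ (3 * n + k + 16) 1); last by lia.
    rewrite {1}/s4; regs => rn.
    apply: (@wp_seq _ _ 1 (3 * n + k + 15)); last by lia.
    apply: wp_sub => //; rewrite n4.
    have -> : reg s4 (hr d.+1) = ev n b u by rewrite /s4; regs.
    set s5 := set_reg _ _ _.
    have K5 : keep d st s5 by apply: keep_set => //; lia.
    have R5 := simulates_keep d0 K5 R; have n5 : reg s5 (hr 0) = n by case: R5.
    apply: (@wp_if _ _ _ (3 * n + k + 13) 1); last by lia.
      rewrite {1}/s5; regs => cn.
      apply: (@wp_seq _ _ (3 * n + k + 12) 1); last by lia.
      rewrite -{1}n5; apply: wp_caddr => // s6 K6 F6 E6.
      have {}K6 := keep_trans K5 K6.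
      have [r1 r2 r3 r4] := simulates_keep d0 K6 R.
      apply: wp_write => //.
      have -> : ev n a u < n by lia.
      have -> : ev n b u < n by lia.
      split; last by move=> h hd; exact: (keepE K6 hd).
      split=> // k' r c rn' cn' /=.
      have -> : reg s6 (hr d) = addr n k (ev n a u) (ev n b u).
        by rewrite E6 n5 /s5; regs; rewrite E13 E23.
      have -> : reg s6 (hr d.+2) = ev n e u.
        by rewrite F6 ?leqnSn ?ltnSn // /s5; regs.
      rewrite updE r3 //; case: eqP => [/addr_inj[]|ne] //; try lia.
        by move=> -> -> ->; rewrite !eqxx.
      case: and3P => // -[/eqP a1 /eqP a2 /eqP a3].
      by rewrite a1 a2 a3 in ne.
    by rewrite {1}/s5; regs => cn; apply: skip => //; rewrite andbC; case: ltnP => //; lia.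
  by rewrite {1}/s4; regs => cn; apply: skip => //; case: ltnP => //; lia.
- apply: (@wp_seq _ _ (texp n e) 1); last by lia.
  apply: (wp_cexp d0 R) => s1 K1 E1; apply: wp_emit => //.
  have [r1 r2 r3 r4] := simulates_keep d0 K1 R; split; last by move=> h hd; exact: (keepE K1 hd).
  by split=> //=; rewrite r4 E1.
- apply: (@wp_seq _ _ (tstm n s1) (tstm n s2)) => //.
  apply: (wp_conseq (IH1 _ _ _ d0 R)) => // st1 [R1 F1].
  apply: (wp_conseq (IH2 _ _ _ d0 R1)) => // st2 [R2 F2].
  by split=> // h hd; rewrite F2 // F1.
- apply: (@wp_seq _ _ (texp n e) (tstm n s1 + tstm n s2 + 1)); last by lia.
  apply: (wp_cexp d0 R) => st1 K1 E1; have R1 := simulates_keep d0 K1 R.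
  apply: (@wp_if _ _ _ (tstm n s1) (tstm n s2)); last by lia.
    rewrite E1 => ->.
    apply: (wp_conseq (IH1 _ _ _ d0 R1)) => // st2 [R2 F2].
    by split=> // h hd; rewrite F2 // (keepE K1).
  rewrite E1 => ->.
  apply: (wp_conseq (IH2 _ _ _ d0 R1)) => // st2 [R2 F2].
  by split=> // h hd; rewrite F2 // (keepE K1).
set T := tstm n s.
apply: (@wp_seq _ _ 1 (n * (T + 6) + 2)); last by lia.
apply: wp_const => //.
apply: (@wp_seq _ _ 1 (n * (T + 6) + 1)); last by lia.
apply: wp_sub => //.
(* With [m] iterations left, the first [n - m] iterations of the source loop have been simulated. *)
pose I m st' := [/\ simulates n st' (foldl (fun u' i => eval n s (setv u' x i)) u (iota 0 (n - m))),
   reg st' (hr d) = n - m, reg st' (hr d.+1) = m, m <= n &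
   forall h, h < d -> reg st' (hr h) = reg st (hr h)].
have [n0 _ _ _] := R.
apply: (@wp_conseq _ (n * (T + 6) + 1) _ (I 0)) => //; last first.
  by move=> st' [R' _ _ _ F']; rewrite subn0 in R'.
apply: (@wp_while _ _ _ (T + 5) I _ _ n); last by lia.
- move=> m st1 [R1 E1 F1 mn K1]; split; first by rewrite F1.
  apply: (@wp_seq _ _ 1 (T + 4)); last by lia.
  apply: wp_const => //.
  apply: (@wp_seq _ _ 1 (T + 3)); last by lia.
  apply: wp_add => //.
  apply: (@wp_seq _ _ T 3); last by lia.
  set st2 := set_reg _ _ _.
  set u1 := foldl _ _ _ in R1.
  have R2 : simulates n st2 (setv u1 x (n - m.+1)).
    case: R1 => r1 r2 r3 r4; split=> // [|y]; first by rewrite /st2; regs.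
    rewrite /st2 /=; regs; case: (eqVneq y x) => // _; by rewrite E1.
  apply: (wp_conseq (IH d.+1 _ _ _ R2)) => // st3 [R3 F3].
  apply: (@wp_seq _ _ 1 2) => //; apply: wp_const => //.
  apply: (@wp_seq _ _ 1 1) => //; apply: wp_add => //; apply: wp_sub => //.
  have E3 : reg st3 (hr d) = n - m.+1 by rewrite F3 // /st2; regs.
  have n3 : reg st3 (hr 0) = n by case: R3.
  split; try lia.
  + have -> : iota 0 (n - m) = iota 0 (n - m.+1) ++ [:: n - m.+1].
      have -> : n - m = (n - m.+1) + 1 by lia.
      by rewrite iotaD.
    rewrite foldl_cat /= -/u1.
    case: R3 => r1 r2 r3 r4; split=> // [|y]; first by regs.
    by regs.
  + regs; rewrite E3; lia.
  + regs; rewrite E3 n3; lia.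
  + move=> h hd; regs; rewrite F3; last by lia.
    by rewrite /st2; regs; apply: K1.
- by move=> st1 [].
split=> //; rewrite ?subnn //.
- by case: R => r1 r2 r3 r4; split=> // [|y]; regs.
- by regs.
- by regs; rewrite n0 subn0.
- by move=> h hd; regs.
Qed.

Definition compile (s : stm) : cmd := Seq (Read (hr 0) (hr 0)) (cstm s 1).

(** For an encoded graph, array 0 is the weight matrix and all other arrays lie beyond the end of
    the input, where the default of [nth] makes them 0. *)
Definition ust0 (x : seq nat) : ust :=
  Ust (fun=> 0) (fun k r c => nth 0 x (addr (nth 0 x 0) k r c)) [::].

Lemma compile_runs s x (n := nth 0 x 0) :
  exists2 t, t <= tstm n s + 1 & runs (compile s) x t (uout (eval n s (ust0 x))).
Proof.
have [t [st [Ht Lt [[_ _ _ O] _]]]] :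
    wp (compile s) (tstm n s + 1) (fun st' => simulates n st' (eval n s (ust0 x)) /\
       forall h, h < 1 -> reg st' (hr h) = n) (init x).
  apply: (@wp_seq _ _ 1 (tstm n s)); last by rewrite addnC.
  apply: wp_read => //.
  set st := set_reg _ _ _.
  have R : simulates n st (ust0 x) by split=> // y; rewrite /st; regs.
  apply: (wp_conseq (wp_cstm s (ltnSn 0) R)) => // st' [R' _]; split=> //.
  by case=> // _; case: R' => ->.
by exists t => //; exists st.
Qed.

(** * Polynomial time bounds *)

Lemma texp_mono m n e : m <= n -> texp m e <= texp n e.
Proof. by move=> mn; elim: e => //= *; lia. Qed.

Lemma tstm_mono m n s : m <= n -> tstm m s <= tstm n s.
Proof.
move=> mn; elim: s => //= [x e|k a b e|e|s1 IH1 s2 IH2|e s1 IH1 s2 IH2|x s IH].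
- by have := texp_mono e mn; lia.
- have He := texp_mono e mn; have Ha := texp_mono a mn.
  by have Hb := texp_mono b mn; lia.
- by have := texp_mono e mn; lia.
- lia.
- by have := texp_mono e mn; lia.
- by rewrite leq_add2r leq_mul // leq_add2r.
Qed.

Lemma affine_poly a c : exists p : {poly nat}, forall n, a * n + c = p.[n]%R.
Proof. by exists (a%:P * 'X + c%:P)%R => n; rewrite hornerD hornerMX !hornerC. Qed.

Lemma texp_poly e : exists p : {poly nat}, forall n, texp n e = p.[n]%R.
Proof.
elim: e => [x|a||a [p IHa] b [q IHb]|a [p IHa] b [q IHb]|k a [p IHa] b [q IHb]] /=.
- by exists (2%:P)%R => n; rewrite hornerC.
- by exists (1%:P)%R => n; rewrite hornerC.
- by exists (2%:P)%R => n; rewrite hornerC.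
- by exists (p + q + 1%:P)%R => n; rewrite !hornerD hornerC IHa IHb.
- by exists (p + q + 1%:P)%R => n; rewrite !hornerD hornerC IHa IHb.
have [r Hr] := affine_poly 3 (k + 20).
by exists (p + q + r)%R => n; rewrite !hornerD -IHa -IHb -Hr; lia.
Qed.

Lemma tstm_poly s : exists p : {poly nat}, forall n, tstm n s = p.[n]%R.
Proof.
elim: s => [|x e|k a b e|e|s1 [p IHa] s2 [q IHb]|e s1 [p IHa] s2 [q IHb]|x s [p IH]] /=.
- by exists (1%:P)%R => n; rewrite hornerC.
- by have [p Hp] := texp_poly e; exists (p + 2%:P)%R => n; rewrite hornerD hornerC Hp.
- have [p Hp] := texp_poly a; have [q Hq] := texp_poly b; have [r Hr] := texp_poly e.
  have [z Hz] := affine_poly 3 (k + 20).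
  exists (p + q + r + z)%R => n.
  by rewrite !hornerD -Hp -Hq -Hr -Hz; lia.
- by have [p Hp] := texp_poly e; exists (p + 1%:P)%R => n; rewrite hornerD hornerC Hp.
- by exists (p + q)%R => n; rewrite !hornerD IHa IHb.
- have [r Hr] := texp_poly e.
  by exists (r + (p + q + 1%:P))%R => n; rewrite !hornerD hornerC Hr IHa IHb.
have [z Hz] := affine_poly 6 3.
exists (p * 'X + z)%R => n.
by rewrite !hornerD hornerMX -IH -Hz; lia.
Qed.

(** The time bound depends on the input only through its first entry and is monotone in it, so it is
    enough to compare that entry with the bit size. *)
Lemma compile_polynomial_time s (inputs : seq nat -> Prop) :
  (forall x, inputs x -> nth 0 x 0 <= bitsize x) ->
  polynomial_time (compile s) inputs.
Proof.
move=> small; have [p Hp] := tstm_poly s.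
exists (p + 1%:P)%R => x /small nx.
have [t Lt Rt] := compile_runs s x; exists t; eexists; split; first exact: Rt.
apply: leq_trans Lt _; rewrite hornerD hornerC -Hp.
exact: (leq_add (tstm_mono s nx) (leqnn 1)).
Qed.

(** * Loop invariants and frame rules *)

Fixpoint vars_written (s : stm) : seq nat :=
  match s with
  | SAsg x _ => [:: x]
  | SSeq s1 s2 | SIf _ s1 s2 => vars_written s1 ++ vars_written s2
  | SFor x s => x :: vars_written s
  | _ => [::]
  end.

Fixpoint arrs_written (s : stm) : seq nat :=
  match s with
  | SSt k _ _ _ => [:: k]
  | SSeq s1 s2 | SIf _ s1 s2 => arrs_written s1 ++ arrs_written s2
  | SFor _ s => arrs_written s
  | _ => [::]
  end.

Fixpoint emits (s : stm) : bool :=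
  match s with
  | SEmit _ => true
  | SSeq s1 s2 | SIf _ s1 s2 => emits s1 || emits s2
  | SFor _ s => emits s
  | _ => false
  end.

Lemma for_ind n x s u (P : nat -> ust -> Prop) :
  P 0 u -> (forall i u', i < n -> P i u' -> P i.+1 (eval n s (setv u' x i))) ->
  P n (eval n (SFor x s) u).
Proof.
move=> P0 PS /=.
suff: forall m, m <= n -> P m (foldl (fun u' i => eval n s (setv u' x i)) u (iota 0 m)).
  by apply.
elim=> [//|m IH] mn; rewrite -addn1 iotaD foldl_cat /= add0n addn1.
by apply: PS => //; apply: IH; apply: ltnW.
Qed.

Lemma eval_frame_env n s y u : y \notin vars_written s -> env (eval n s u) y = env u y.
Proof.
elim: s u => [|x e|k a b e|e|s1 IH1 s2 IH2|e s1 IH1 s2 IH2|x s IH] u //=.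
- by rewrite inE updE => /negbTE ->.
- by case: ifP.
- by rewrite mem_cat negb_or => /andP[h1 h2]; rewrite IH2 // IH1.
- by rewrite mem_cat negb_or => /andP[h1 h2]; case: ifP => _; rewrite ?IH2 ?IH1.
rewrite inE negb_or => /andP[h1 h2].
elim: (iota 0 n) u => //= i l IHl u; rewrite IHl IH //= updE; by rewrite (negbTE h1).
Qed.

Lemma eval_frame_arr n s k u : k \notin arrs_written s -> arr (eval n s u) k = arr u k.
Proof.
elim: s u => [|x e|k' a b e|e|s1 IH1 s2 IH2|e s1 IH1 s2 IH2|x s IH] u //=.
- by rewrite inE => /negbTE kk; case: ifP => //= _; rewrite kk.
- by rewrite mem_cat negb_or => /andP[h1 h2]; rewrite IH2 // IH1.
- by rewrite mem_cat negb_or => /andP[h1 h2]; case: ifP => _; rewrite ?IH2 ?IH1.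
by move=> kk; elim: (iota 0 n) u => //= i l IHl u; rewrite IHl IH.
Qed.

Lemma eval_frame_out n s u : ~~ emits s -> uout (eval n s u) = uout u.
Proof.
elim: s u => [|x e|k' a b e|e|s1 IH1 s2 IH2|e s1 IH1 s2 IH2|x s IH] u //=.
- by case: ifP.
- by rewrite negb_or => /andP[h1 h2]; rewrite IH2 // IH1.
- by rewrite negb_or => /andP[h1 h2]; case: ifP => _; rewrite ?IH2 ?IH1.
by move=> kk; elim: (iota 0 n) u => //= i l IHl u; rewrite IHl IH.
Qed.

(** * Matchings as involutions *)

(** Exposed vertices are the fixed points, so a maximum matching is one with the fewest fixed
    points, and a matching can be stored as one row of vertex numbers. *)
Definition matching (T : finType) (e : rel T) (m : T -> T) : Prop :=
  involutive m /\ forall x, m x != x -> e x (m x).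

Definition fixs (T : finType) (m : T -> T) : {set T} := [set x | m x == x].

(** For [m v = v] this adds the edge [v w] and frees the former partner of [w]. *)
Definition rot (T : finType) (m : T -> T) (v w : T) : T -> T :=
  fun u => if u == v then w else if u == w then v
           else if u == m w then m w else m u.

(** The points of [S] that are moved fall into pairs [{x, f x}]; removing such a pair leaves [S]
    stable and its fixed points unchanged. *)
Lemma odd_card_fixs (T : finType) (f : T -> T) (S : {set T}) :
  involutive f -> (forall x, x \in S -> f x \in S) ->
  odd #|S| = odd #|S :&: fixs f|.
Proof.
move=> fK; elim: {S}_.+1 {-2}S (ltnSn #|S|) => // k IH S Sk fS.
have [/setIidPl -> //|/subsetPn[x xS]] := boolP (S \subset fixs f).
rewrite inE => fx.
have xfx : f x \in S :\ x by rewrite !inE fx fS.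
have cS := cardsD1 x S; have cS' := cardsD1 (f x) (S :\ x).
rewrite xS xfx in cS cS'.
have {1}-> : #|S| = #|S :\ x :\ f x| + 2 by lia.
rewrite oddD addbF IH.
- congr (odd #|pred_of_set _|); apply/setP=> y; rewrite !inE.
  case: (eqVneq y x) => [->|_]; first by rewrite andbF /= (negbTE fx) andbF.
  case: (eqVneq y (f x)) => [->|_] //=; rewrite fK.
  by rewrite eq_sym (negbTE fx) andbF.
- by lia.
move=> y; rewrite !inE => /and3P[y1 y2 y3]; rewrite fS // andbT.
apply/andP; split; first by rewrite (inj_eq (inv_inj fK)).
by apply: contraNneq y1 => <-; rewrite fK.
Qed.

(** * Rotating a matching along an edge *)

Section Rotation.
Variables (T : finType) (e : rel T).
Hypotheses (e_sym : symmetric e) (e_irr : irreflexive e).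
Implicit Types (m : T -> T) (v w : T).

Lemma edge_neq v w : e v w -> (v == w) = false.
Proof. by apply: contraTF => /eqP ->; rewrite e_irr. Qed.

Lemma rot_matching m v w : matching e m -> m v = v -> e v w ->
  matching e (rot m v w).
Proof.
move=> [mK me] mv evw; have vw := edge_neq evw; have wv : (w == v) = false by rewrite eq_sym.
have mwv : (m w == v) = false.
  by apply: contraFF wv => /eqP E; rewrite -[w]mK E mv.
split=> u; rewrite /rot.
  case: (eqVneq u v) => [->|uv]; first by rewrite wv eqxx.
  case: (eqVneq u w) => [->|uw]; first by rewrite eqxx.
  case: (eqVneq u (m w)) => [umw|umw].
    by rewrite mwv -umw (negbTE uw) eqxx.
  have -> : (m u == v) = false.
    by apply: contraNF uv => /eqP E; rewrite -[u]mK E mv.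
  have -> : (m u == w) = false.
    by apply: contraNF umw => /eqP <-; rewrite mK.
  by rewrite (inj_eq (inv_inj mK)) (negbTE uw) mK.
case: (eqVneq u v) => [->//|uv]; case: (eqVneq u w) => [->|uw]; first by rewrite e_sym.
by case: (eqVneq u (m w)) => [->|umw]; [rewrite eqxx|apply: me].
Qed.

Lemma rot_fixs m v w : matching e m -> m v = v -> e v w ->
  fixs (rot m v w) = if m w == w then fixs m :\ v :\ w else m w |: (fixs m :\ v).
Proof.
move=> [mK me] mv evw; have vw := edge_neq evw; have wv : (w == v) = false by rewrite eq_sym.
have mwv : (m w == v) = false.
  by apply: contraFF wv => /eqP E; rewrite -[w]mK E mv.
apply/setP=> u; rewrite inE /rot.
case: (eqVneq (m w) w) => mw; rewrite !inE.
  case: (eqVneq u v) => [->|uv]; first by rewrite wv andbF.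
  case: (eqVneq u w) => [->|uw]; first by rewrite vw.
  by rewrite mw (negbTE uw).
case: (eqVneq u v) => [->|uv]; first by rewrite wv eq_sym mwv.
case: (eqVneq u w) => [->|uw].
  by rewrite vw [w == m w]eq_sym (negbTE mw).
by case: (eqVneq u (m w)) => [->|umw]; rewrite ?eqxx.
Qed.

Lemma rot_card m v w : matching e m -> m v = v -> e v w -> m w != w ->
  #|fixs (rot m v w)| = #|fixs m|.
Proof.
move=> Hm mv evw mw; rewrite rot_fixs // (negbTE mw) cardsU1 [in RHS](cardsD1 v).
rewrite !inE mv eqxx; case: Hm => mK _.
by rewrite (inj_eq (inv_inj mK)) eq_sym (negbTE mw) andbF.
Qed.

Lemma rot_card_lt m v w : matching e m -> m v = v -> e v w -> m w = w ->
  #|fixs (rot m v w)| < #|fixs m|.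
Proof.
move=> Hm mv evw mw; rewrite rot_fixs // mw eqxx.
by rewrite [X in _ < X](cardsD1 v) [in X in _ < X](cardsD1 w) !inE mv mw !eqxx eq_sym edge_neq //=; lia.
Qed.

End Rotation.

(** * The invariant of the search *)

Section Blossom.
Variables (T : finType) (e : rel T).
Hypotheses (e_sym : symmetric e) (e_irr : irreflexive e).

(** [D] is the set of vertices known to be missed by some matching [rp x] of the size of [M],
    and is partitioned into blossoms with representatives [blk]; [O] contains the odd vertices of
    the alternating forest and [tau] identifies its trees.  By [s_exit] every blossom has
    exactly one exit in each [rp x]: the vertex that is exposed or matched into [O]. *)
Record search (M : T -> T) (D : {set T}) (rp : T -> T -> T)
    (O : {set T}) (blk tau : T -> T) : Prop := Search {
  s_fix : forall x, M x = x -> x \in D;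
  s_dis : forall x, x \in D -> x \in O -> False;
  s_blk : forall x, x \in D -> blk x \in D;
  s_mat : forall x, x \in D -> matching e (rp x);
  s_miss : forall x, x \in D -> rp x x = x;
  s_card : forall x, x \in D -> #|fixs (rp x)| = #|fixs M|;
  s_in : forall x u, x \in D -> u \in D :|: O -> rp x u \in D :|: O;
  s_tau : forall x u, x \in D -> u \in D :|: O -> tau (rp x u) = tau u;
  s_one : forall x u, x \in D -> u \in D :|: O -> tau u = tau x -> rp x u = u -> u = x;
  s_off : forall x u, x \in D -> u \notin D :|: O -> rp x u = M u;
  s_exit : forall x p, x \in D -> p \in D -> exists u,
    [/\ u \in D, blk u = blk p, rp x u = u \/ rp x u \in O &
        forall u', u' \in D -> blk u' = blk p -> u' != u ->
          [/\ rp x u' \in D, blk (rp x u') = blk p & rp x u' <> u']];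
  s_O : forall x w, x \in D -> w \in O -> rp x w \in D;
  s_two : forall w, w \in O -> exists p q, [/\ p \in D, q \in D &
    forall x, x \in D -> blk (rp x w) = blk p \/ blk (rp x w) = blk q]
}.

(** The search starts with every exposed vertex as a tree and a blossom of its own, all of them
    sharing the matching [M]. *)
Lemma search0 (M : T -> T) : matching e M ->
  search M (fixs M) (fun=> M) set0 id id.
Proof.
move=> HM; split=> //.
- by move=> x; rewrite inE => ->.
- by move=> x _; rewrite inE.
- by move=> x; rewrite inE => /eqP.
- by move=> x u _; rewrite setU0 inE => /eqP Mu; rewrite Mu inE Mu.
- by move=> x u _; rewrite setU0 inE => /eqP.
- move=> x p _; rewrite inE => /eqP Mp; exists p; split=> //; first by rewrite inE Mp.
    by left.
  by move=> u _ -> /eqP.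
- by move=> x w _; rewrite inE.
- by move=> w; rewrite inE.
Qed.

Section State.
Variables (M : T -> T) (D : {set T}) (rp : T -> T -> T)
  (O : {set T}) (blk tau : T -> T).
Hypothesis S : search M D rp O blk tau.

Definition is_exit (x u : T) : Prop := rp x u = u \/ rp x u \in O.

(** A vertex other than the one provided by [s_exit] is matched inside [D], so it is neither exposed
    nor matched into [O]. The counting arguments below rest on this uniqueness. *)
Lemma exit_uniq x u u' : x \in D -> u \in D -> u' \in D -> blk u = blk u' ->
  is_exit x u -> is_exit x u' -> u = u'.
Proof.
move=> xD uD u'D E1 X X'; have [t [tD bt Xt nt]] := s_exit S xD uD.
have aux y : y \in D -> blk y = blk u -> is_exit x y -> y = t.
  move=> yD by_ Xy; case: (eqVneq y t) => // yt.
  by have [ryD _ ryy] := nt _ yD by_ yt; case: Xy => // /(s_dis S ryD).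
by rewrite (aux u) // (aux u').
Qed.

Lemma stay x u : x \in D -> u \in D -> ~ is_exit x u ->
  [/\ rp x u \in D, blk (rp x u) = blk u & rp x u <> u].
Proof.
move=> xD uD nX; have [t [tD bt Xt nt]] := s_exit S xD uD.
by apply: nt => //; apply/eqP => E; apply: nX; rewrite E.
Qed.

Lemma rpK x : x \in D -> involutive (rp x).
Proof. by case/(s_mat S). Qed.

Lemma DO u : u \in D -> (u \in O) = false.
Proof. by move=> uD; apply/negP => /(s_dis S uD). Qed.

(** * Merging the blossoms along an alternating path *)

Section Merge.
Variables (v w : T).
Hypotheses (vD : v \in D) (wD : w \in D) (evw : e v w).
Let Q := rp v.
Let N := rp w.
(** [C] stands for an alternating path between [w] and [v] in the union of [Q] and [N], reduced to
    what the counting uses: it is stable under both, connected in the sense of [Ccon], contained in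
    one tree, has [v] as its only vertex exposed by [Q], and contains the [N]-exit of every blossom
    it meets. *)
Variable C : {set T}.
Hypotheses
  (CL : C \subset D :|: O)
  (CQ : forall u, u \in C -> Q u \in C)
  (CN : forall u, u \in C -> N u \in C)
  (vC : v \in C) (wC : w \in C)
  (Cone : forall u, u \in C -> Q u = u -> u = v)
  (Ctau : forall u, u \in C -> tau u = tau v)
  (CexN : forall u, u \in C -> u \in D -> exists t,
     [/\ t \in C, t \in D, blk t = blk u & is_exit w t])
  (Ccon : forall Z : {set T}, (forall u, u \in Z -> Q u \in Z) ->
     (forall u, u \in Z -> N u \in Z) -> (exists2 c, c \in C & c \in Z) ->
     C \subset Z).

(** The odd vertices [W] on [C] become reachable; together with all blossoms met by [C] they form
    the new blossom [B]. *)
Let W := C :&: O.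
Let bB := blk @: (C :&: D).
Let B := C :|: [set u in D | blk u \in bB].

Lemma bBP u : u \in C -> u \in D -> blk u \in bB.
Proof. by move=> uC uD; apply: imset_f; rewrite inE uC. Qed.

(** Parity on the part [K] of the blossom that lies on [C]: if the [Q]-exit were off [C], then [Q]
    would pair up all of [K], whereas [N] pairs up [K] without its [N]-exit, which is in [K] by
    [CexN]. *)
Lemma exit_in_C u t : u \in C -> u \in D -> t \in D -> blk t = blk u ->
  is_exit v t -> t \in C.
Proof.
move=> uC uD tD btu Xt; case: (boolP (t \in C)) => // tC.
pose K := [set s in C | (s \in D) && (blk s == blk u)].
have QK s : s \in K -> Q s \in K /\ Q s != s.
  rewrite !inE => /and3P[sC sD /eqP bs].
  have [|q1 q2 q3] := stay vD sD.
    by move=> Xs; move: tC; rewrite (exit_uniq vD tD sD _ Xt Xs) ?sC // bs.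
  by rewrite CQ // q1 q2 bs eqxx; split=> //; apply/eqP.
have oK : odd #|K| = false.
  rewrite (@odd_card_fixs _ Q) //; first last.
  - by move=> s /QK[].
  - exact: rpK.
  rewrite (_ : _ :&: _ = set0) ?cards0 //; apply/setP=> s; rewrite !inE.
  by apply/negP => /andP[sK]; rewrite (negbTE (proj2 (QK s _))) // !inE.
have [n [nC nD bn Xn]] := CexN uC uD.
have nK : n \in K by rewrite !inE nC nD bn eqxx.
have : odd #|K :\ n| = false.
  have NK s : s \in K :\ n -> N s \in K :\ n /\ N s != s.
    rewrite !inE => /and4P[sn sC sD /eqP bs].
    have [|q1 q2 q3] := stay wD sD.
      by move=> Xs; rewrite (exit_uniq wD sD nD _ Xs Xn) ?eqxx // bs bn in sn.
    rewrite CN // q1 q2 bs eqxx; split=> //; last by apply/eqP.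
    rewrite !andbT; apply/eqP => E; case: Xn => [Nn|].
      by apply: q3; rewrite -/N E -Nn -E rpK.
    by rewrite -E rpK // => /(s_dis S sD).
  rewrite (@odd_card_fixs _ N) //; first last.
  - by move=> s /NK[].
  - exact: rpK.
  rewrite (_ : _ :&: _ = set0) ?cards0 //; apply/setP=> s; rewrite !inE.
  apply/negP => /andP[sK]; rewrite (negbTE (proj2 (NK s _))) //.
  by rewrite !inE.
by move: oK; rewrite (cardsD1 n) nK /= => oK oK'; rewrite oK' in oK.
Qed.

(** By [s_two] the partner of an odd vertex lies in one of only two blossoms. Once the blossoms of
    [Q w1] and [N w1] are known to differ, they are these two, and [C] meets both. *)
Lemma W_blk x w1 : x \in D -> w1 \in W -> blk (rp x w1) \in bB.
Proof.
move=> xD; rewrite inE => /andP[w1C w1O].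
have Q1D : Q w1 \in D by apply: (s_O S).
have N1D : N w1 \in D by apply: (s_O S).
have Qb := bBP (CQ w1C) Q1D; have Nb := bBP (CN w1C) N1D.
have QX : is_exit v (Q w1) by right; rewrite rpK.
have NX : is_exit w (N w1) by right; rewrite rpK.
(* If they agreed, [w1] together with this blossom would be stable under [Q] and [N] and so contain
   all of [C]. Then [v], being the [Q]-exit of its blossom, would equal [Q w1], although [Q] exposes
   it. *)
have dif : blk (Q w1) <> blk (N w1).
  move=> bE; pose Z := w1 |: [set s in D | blk s == blk (Q w1)].
  have : C \subset Z.
    apply: Ccon.
    - move=> s; rewrite !inE => /orP[/eqP ->|/andP[sD /eqP bs]].
        by rewrite Q1D eqxx orbT.
      case: (eqVneq s (Q w1)) => [->|sQ]; first by rewrite /Q rpK ?eqxx.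
      have [|q1 q2 _] := stay vD sD.
        by move=> Xs; rewrite (exit_uniq vD sD Q1D bs Xs QX) eqxx in sQ.
      by rewrite q1 q2 bs eqxx orbT.
    - move=> s; rewrite !inE => /orP[/eqP ->|/andP[sD /eqP bs]].
        by rewrite N1D -bE eqxx orbT.
      case: (eqVneq s (N w1)) => [->|sQ]; first by rewrite /N rpK ?eqxx.
      have [|q1 q2 _] := stay wD sD.
        by move=> Xs; rewrite (exit_uniq wD sD N1D _ Xs NX) ?eqxx ?bs in sQ.
      by rewrite q1 q2 bs eqxx orbT.
    by exists w1; rewrite // !inE eqxx.
  move/subsetP/(_ v vC); rewrite !inE => /orP[/eqP E|/andP[_ /eqP bv]].
    by rewrite -E (DO vD) in w1O.
  have vQ : v = Q w1 by apply: (exit_uniq vD) => //; left; apply: (s_miss S).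
  have : Q v = w1 by rewrite vQ; apply: (rpK vD).
  rewrite /Q (s_miss S vD) => E; by rewrite -E (DO vD) in w1O.
have [p [q [pD qD pq]]] := s_two S w1O.
have := pq _ vD; have := pq _ wD; have := pq _ xD; rewrite -/Q -/N.
by move: Qb Nb dif => Qb Nb dif [->|->] [] E1 [] E2; rewrite ?E1 ?E2 // in Qb Nb dif *.
Qed.

Lemma W_inj x : x \in D -> {in W &, injective (fun w1 => blk (rp x w1))}.
Proof.
move=> xD w1 w2; rewrite !inE => /andP[_ w1O] /andP[_ w2O] E.
apply: (inv_inj (rpK xD)); apply: (exit_uniq xD) => //.
- exact: (s_O S).
- exact: (s_O S).
- by right; rewrite rpK.
- by right; rewrite rpK.
Qed.

(** Every blossom met by [C] has its [Q]-exit on [C]. In one of them this exit is the exposed vertex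
    [v]; the exits of the others correspond one to one to [W] under [Q]. *)
Lemma card_bB : #|bB| = #|W|.+1.
Proof.
have bv : blk v \in bB by apply: bBP.
rewrite (cardsD1 (blk v)) bv add1n; congr _.+1.
rewrite -(card_in_imset (W_inj vD)); apply: eq_card => b; apply/idP/imsetP.
  rewrite !inE => /andP[bne /imsetP[u]]; rewrite inE => /andP[uC uD] bu.
  have [t [tD bt Xt _]] := s_exit S vD uD.
  have tC := exit_in_C uC uD tD bt Xt.
  case: Xt => [Qt|QO]; first by rewrite bu -bt (Cone tC Qt) eqxx in bne.
  by exists (Q t); rewrite ?inE ?CQ // rpK ?bt.
case=> w1 w1W ->; rewrite !inE W_blk // andbT; apply/eqP => E.
have w1O : w1 \in O by move: w1W; rewrite inE => /andP[].
have : v = Q w1.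
  apply: (exit_uniq vD) => //; first exact: (s_O S).
    by left; apply: (s_miss S).
  by right; rewrite rpK.
move=> /(congr1 Q); rewrite {2}/Q rpK // /Q (s_miss S vD) => E2.
by rewrite -E2 (DO vD) in w1O.
Qed.

Lemma BP u : reflect (u \in W \/ (u \in D /\ blk u \in bB)) (u \in B).
Proof.
apply: (iffP idP); rewrite !inE.
  case/orP => [uC|/andP[]]; last by right.
  have := subsetP CL _ uC; rewrite inE => /orP[uD|uO]; last by left; rewrite uC.
  by right; split=> //; apply: bBP.
by case=> [/andP[-> _]|[-> ->]] //; rewrite orbT.
Qed.

Lemma B_exit x : x \in D -> exists t,
  [/\ t \in D, blk t \in bB, rp x t = t \/ rp x t \in O :\: W &
      forall s, s \in B -> s != t -> rp x s \in B /\ rp x s <> s].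
Proof.
move=> xD; pose h w1 := blk (rp x w1).
have hsub : h @: W \subset bB by apply/subsetP=> b /imsetP[w1 w1W ->]; apply: W_blk.
have ch : #|h @: W| = #|W| by apply: card_in_imset; apply: W_inj.
have : #|bB :\: h @: W| = 1 by rewrite cardsDS // card_bB ch; lia.
move/eqP/cards1P => [b0 hb0].
have : b0 \in bB :\: h @: W by rewrite hb0 inE.
rewrite inE => /andP[b0h b0B].
have [u + b0u] := imsetP b0B; rewrite inE => /andP[uC uD].
have [t [tD bt Xt nt]] := s_exit S xD uD.
exists t; rewrite tD bt -b0u b0B; split=> //.
  case: Xt => [|tO]; [by left|right]; rewrite inE tO andbT.
  apply: contra b0h => tW; apply/imsetP; exists (rp x t) => //.
  by rewrite /h rpK // bt.
move=> s /BP[sW|[sD bs]] st.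
  have sO : s \in O by move: sW; rewrite inE => /andP[].
  have sD : rp x s \in D by apply: (s_O S).
  split; first by apply/BP; right; split=> //; apply: W_blk.
  by move=> E; rewrite E in sD; rewrite (DO sD) in sO.
have Xdec : is_exit x s \/ ~ is_exit x s.
  rewrite /is_exit; case: (eqVneq (rp x s) s); first by left; left.
  case: (boolP (rp x s \in O)); first by left; right.
  by move=> /negP a /eqP b; right=> -[].
case: Xdec => [Xs|nXs]; last first.
  have [q1 q2 q3] := stay xD sD nXs; split=> //.
  by apply/BP; right; rewrite q1 q2.
have bsh : blk s \in h @: W.
  case: (boolP (blk s \in h @: W)) => // bsh.
  have : blk s \in bB :\: h @: W by rewrite inE bsh.
  rewrite hb0 inE => /eqP E; rewrite (exit_uniq xD sD tD _ Xs Xt) ?eqxx // in st.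
  by rewrite E bt.
have [w1 w1W bw1] := imsetP bsh.
have w1O : w1 \in O by move: w1W; rewrite inE => /andP[].
have -> : s = rp x w1.
  apply: (exit_uniq xD) => //; first exact: (s_O S).
  by right; rewrite rpK.
rewrite rpK //; split; first by apply/BP; left.
by move=> E; have := s_O S xD w1O; rewrite -E => /DO; rewrite w1O.
Qed.

(** The matching of a new vertex agrees with [Q] off [C] and, on [C], exposes that vertex alone. *)
Variable rp' : T -> T -> T.
Hypotheses
  (rpD : forall x, x \in D -> rp' x = rp x)
  (Wmat : forall x, x \in W -> matching e (rp' x))
  (Wmiss : forall x, x \in W -> rp' x x = x)
  (Wcard : forall x, x \in W -> #|fixs (rp' x)| = #|fixs M|)
  (WC : forall x u, x \in W -> u \in C -> rp' x u \in C)
  (WQ : forall x u, x \in W -> u \notin C -> rp' x u = Q u)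
  (Wone : forall x u, x \in W -> u \in C -> rp' x u = u -> u = x).

Let blk' u := if u \in B then blk v else blk u.

Lemma B_blk u p : u \in D -> p \in D -> blk u = blk p -> (u \in B) = (p \in B).
Proof.
have aux a b : a \in D -> b \in D -> blk a = blk b -> a \in B -> b \in B.
  move=> aD bD E /BP[aW|[_ h]]; last by apply/BP; right; rewrite bD -E.
  by move: aW; rewrite inE (DO aD) andbF.
by move=> uD pD E; apply/idP/idP; apply: aux.
Qed.

Lemma blk'_congr u p : u \in D -> p \in D -> blk u = blk p -> blk' u = blk' p.
Proof. by move=> uD pD E; rewrite /blk' (B_blk uD pD E) E. Qed.

Lemma LW u : (u \in (D :|: W) :|: (O :\: W)) = (u \in D :|: O).
Proof. by rewrite !inE; case: (u \in C); case: (u \in O); case: (u \in D). Qed.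

Lemma notB p : p \in D :|: W -> p \notin B -> p \in D.
Proof. by rewrite inE => /orP[//|pW] /negP[]; apply/BP; left. Qed.

Lemma BDW p : p \in B -> p \in D :|: W.
Proof. by move=> /BP h; rewrite inE; case: h => [->|[->]]; rewrite ?orbT. Qed.

Lemma exit_notW x t : x \in D -> t \in D -> t \notin B -> rp x t \in O ->
  rp x t \in O :\: W.
Proof.
move=> xD tD tB tO; rewrite inE tO andbT; apply: contra tB => tW.
by have := W_blk xD tW; rewrite rpK // => bt; apply/BP; right.
Qed.

(** For an old [x] the exit of [B] comes from [B_exit]. For a new [x] it is [x] itself: the rest of
    [C] is matched within [C], and since merged blossoms have their [Q]-exits on [C] by [exit_in_C],
    their vertices off [C] are matched inside them. Blossoms that are not merged keep the exit they
    have in [rp x] or in [Q]. *)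
Lemma merge_search : search M (D :|: W) rp' (O :\: W) blk' tau.
Proof.
have vB : v \in B by rewrite inE vC.
have inD' x : x \in D :|: W -> x \in D \/ x \in W by rewrite inE => /orP.
have WL x : x \in W -> x \in D :|: O by rewrite !inE => /andP[_ ->]; rewrite orbT.
have CLu u : u \in C -> u \in D :|: O by apply: (subsetP CL).
have WCin x : x \in W -> x \in C by rewrite inE => /andP[].
split.
- by move=> x /(s_fix S); rewrite inE => ->.
- move=> x; rewrite !inE => /orP[xD|/andP[xC xO]]; first by rewrite (DO xD) andbF.
  by rewrite xC xO.
- move=> x xD'; rewrite inE /blk'; case: (boolP (x \in B)) => xB; first by rewrite (s_blk S).
  by rewrite (s_blk S) // (notB xD').
- by move=> x /inD'[xD|/Wmat//]; rewrite rpD //; apply: (s_mat S).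
- by move=> x /inD'[xD|/Wmiss//]; rewrite rpD //; apply: (s_miss S).
- by move=> x /inD'[xD|/Wcard//]; rewrite rpD //; apply: (s_card S).
- move=> x u /inD'[xD|xW]; rewrite !LW; first by rewrite rpD //; apply: (s_in S).
  case: (boolP (u \in C)) => uC uL; first by apply: CLu; apply: WC.
  by rewrite WQ //; apply: (s_in S).
- move=> x u /inD'[xD|xW]; rewrite !LW; first by rewrite rpD //; apply: (s_tau S).
  case: (boolP (u \in C)) => uC uL; first by rewrite !Ctau // WC.
  by rewrite WQ //; apply: (s_tau S).
- move=> x u /inD'[xD|xW]; rewrite !LW; first by rewrite rpD //; apply: (s_one S).
  case: (boolP (u \in C)) => uC uL tu; first by apply: Wone.
  rewrite WQ // => Qu; have := s_one S vD uL; rewrite tu Ctau; last exact: WCin.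
  by move=> /(_ (erefl _) Qu) E; rewrite E vC in uC.
- move=> x u /inD'[xD|xW]; rewrite !LW; first by rewrite rpD //; apply: (s_off S).
  move=> uL; rewrite WQ //; first exact: (s_off S).
  by apply: contra uL; apply: CLu.
- move=> x p /inD'[xD|xW] pD'.
    rewrite rpD //; case: (boolP (p \in B)) => pB.
      have [t [tD bt Xt nt]] := B_exit xD.
      have tB : t \in B by apply/BP; right.
      exists t; rewrite /blk' tB pB inE tD; split=> // u' u'D'.
      case: (boolP (u' \in B)) => [u'B _ ut|u'B E].
        by have [r1 r2] := nt _ u'B ut; rewrite r1 BDW.
      have u'D := notB u'D' u'B.
      by rewrite (B_blk u'D vD E) vB in u'B.
    have pD := notB pD' pB.
    have [t [tD bt Xt nt]] := s_exit S xD pD.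
    have tB : t \notin B by rewrite (B_blk tD pD bt).
    exists t; rewrite inE tD; split=> //; first exact: blk'_congr.
      by case: Xt => [|tO]; [left|right; apply: exit_notW].
    move=> u' u'D' b' ut.
    have u'B : u' \notin B.
      apply/negP => u'B; move: b'; rewrite /blk' u'B (negbTE pB) => E.
      by rewrite -(B_blk vD pD E) vB in pB.
    have u'D := notB u'D' u'B.
    move: b'; rewrite /blk' (negbTE u'B) (negbTE pB) => b'.
    have [r1 r2 r3] := nt _ u'D b' ut; rewrite inE r1.
    by rewrite (B_blk r1 pD r2) (negbTE pB).
  case: (boolP (p \in B)) => pB.
    have xB : x \in B by apply/BP; left.
    exists x; rewrite /blk' xB pB inE xW orbT; split=> //; first by left; apply: Wmiss.
    move=> u' u'D'; case: (boolP (u' \in B)) => [u'B _ ux|u'B E]; last first.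
      have u'D := notB u'D' u'B.
      by rewrite (B_blk u'D vD E) vB in u'B.
    suff [rB ru] : rp' x u' \in B /\ rp' x u' <> u' by rewrite rB BDW.
    case: (boolP (u' \in C)) => u'C.
      split; first by rewrite inE WC.
      by move=> /(Wone xW u'C) E; rewrite E eqxx in ux.
    rewrite WQ //; have [bu u'D] : blk u' \in bB /\ u' \in D.
      by move: u'B => /BP[/WCin|[]//]; rewrite (negbTE u'C).
    have [|q1 q2 q3] := stay vD u'D.
      move=> X'; move: bu => /imsetP[y]; rewrite inE => /andP[yC yD] E.
      by rewrite (exit_in_C yC yD u'D E X') in u'C.
    by split=> //; apply/BP; right; rewrite q1 q2.
  have pD := notB pD' pB.
  have [t [tD bt Xt nt]] := s_exit S vD pD.
  have tB : t \notin B by rewrite (B_blk tD pD bt).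
  have nC u : u \notin B -> u \notin C by apply: contra => uC; rewrite inE uC.
  exists t; rewrite inE tD WQ ?nC //; split=> //; first exact: blk'_congr.
    by case: Xt => [|tO]; [left|right; apply: exit_notW].
  move=> u' u'D' b' ut.
  have u'B : u' \notin B.
    apply/negP => u'B; move: b'; rewrite /blk' u'B (negbTE pB) => E.
    by rewrite -(B_blk vD pD E) vB in pB.
  have u'D := notB u'D' u'B.
  move: b'; rewrite /blk' (negbTE u'B) (negbTE pB) => b'.
  have [r1 r2 r3] := nt _ u'D b' ut; rewrite WQ ?nC // inE r1.
  by rewrite (B_blk r1 pD r2) (negbTE pB).
- move=> x w1 /inD'[xD|xW]; rewrite !inE => /andP[w1W w1O].
    by rewrite rpD // (s_O S).
  rewrite WQ //; first by rewrite (s_O S).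
  by move: w1W; rewrite w1O andbT.
move=> w1; rewrite !inE => /andP[w1W w1O].
have [p [q [pD qD pq]]] := s_two S w1O.
exists p, q; rewrite !inE pD qD; split=> // x xD'.
have [x' x'D ->] : exists2 x', x' \in D & rp' x w1 = rp x' w1.
  case: (inD' _ xD') => [xD|xW]; first by exists x; rewrite ?rpD.
  by exists v; rewrite // WQ //; move: w1W; rewrite w1O andbT.
have rD := s_O S x'D w1O.
by case: (pq _ x'D) => /blk'_congr E; [left|right]; apply: E.
Qed.

End Merge.

(** * Growing the alternating forest by a matched edge *)

Section Grow.
Variables (v w : T).
Hypotheses (vD : v \in D) (wD : w \notin D) (evw : e v w).
Let x := rp v w.
Hypothesis xD : x \notin D.
Variable rp' : T -> T -> T.
Hypotheses (rpD : forall y, y \in D -> rp' y = rp y) (rpx : rp' x = rot (rp v) v w).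

Lemma grow_notin : [/\ w \notin O, x \notin O, x = M w & x != w].
Proof.
have wO : w \notin O by apply: contra xD; apply: (s_O S).
have xE : x = M w by apply: (s_off S) => //; rewrite inE negb_or wD.
split=> //.
  by apply: contra wD => xO; rewrite -(rpK vD w); apply: (s_O S).
by apply: contra wD => /eqP E; apply: (s_fix S); rewrite -xE.
Qed.

(** The vertex [w] becomes odd and [x], its partner in all matchings so far, a blossom of its own in
    the tree of [v]. For [s_two], the partner of [w] is [x] in the old matchings and [v] in the new
    one. *)
Lemma grow_search : search M (x |: D) rp' (w |: O)
  (fun u => if u == x then x else blk u)
  (fun u => if (u == x) || (u == w) then tau v else tau u).
Proof.
have [wO xO xM xw] := grow_notin.
have neD u y : u \in D -> y \notin D -> (u == y) = false.
  by move=> uD; apply: contraNF => /eqP <-.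
have neO u y : u \in O -> y \notin O -> (u == y) = false.
  by move=> uD; apply: contraNF => /eqP <-.
have vK := rpK vD; have vv := s_miss S vD.
have vw := edge_neq e_irr evw; have wv : (w == v) = false by rewrite eq_sym.
have vx : (v == x) = false by apply: neD.
have Ex u : u != v -> u != w -> u != x -> rot (rp v) v w u = rp v u.
  by rewrite /rot -/x => /negbTE -> /negbTE -> /negbTE ->.
have rxx : rot (rp v) v w x = x.
  by rewrite /rot -/x eqxx [x == v]eq_sym vx (negbTE xw).
have rxv : rot (rp v) v w v = w by rewrite /rot eqxx.
have rxw : rot (rp v) v w w = v by rewrite /rot eqxx wv.
have yw y : y \in D -> rp y w = x.
  by move=> yD; rewrite xM; apply: (s_off S) => //; rewrite inE negb_or wD.
have yx y : y \in D -> rp y x = w by move=> yD; rewrite -(yw y yD) rpK.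
have L u : (u \in (x |: D) :|: (w |: O)) = [|| u == x, u == w | u \in D :|: O].
  by rewrite !inE; case: (u == x); case: (u == w); case: (u \in D).
have LD u : u \in D -> u \in D :|: O by rewrite inE => ->.
have LO u : u \in O -> u \in D :|: O by rewrite inE => ->; rewrite orbT.
have wL : w \notin D :|: O by rewrite inE negb_or wD.
have xL : x \notin D :|: O by rewrite inE negb_or xD.
have neL u y : u \in D :|: O -> y \notin D :|: O -> (u == y) = false.
  by move=> uD; apply: contraNF => /eqP <-.
split.
- by move=> y /(s_fix S) yD; rewrite inE yD orbT.
- move=> y; rewrite !inE => /orP[/eqP ->|yD].
    by rewrite (negbTE xw) (negbTE xO).
  by rewrite (neD _ _ yD wD) (DO yD).
- move=> y; rewrite !inE; case: (eqVneq y x) => [_ _|_ /= /(s_blk S) ->]; by rewrite ?eqxx ?orbT.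
- move=> y; rewrite !inE => /orP[/eqP ->|yD]; last by rewrite rpD //; apply: (s_mat S).
  by rewrite rpx; apply: rot_matching => //; apply: (s_mat S).
- move=> y; rewrite !inE => /orP[/eqP ->|yD]; last by rewrite rpD //; apply: (s_miss S).
  by rewrite rpx.
- move=> y; rewrite !inE => /orP[/eqP ->|yD]; last by rewrite rpD //; apply: (s_card S).
  by rewrite rpx (rot_card e_irr) ?(s_card S) //; apply: (s_mat S).
- move=> y u; rewrite inE => /orP[/set1P ->|yD]; rewrite !L.
    rewrite rpx; case: (eqVneq u v) => [->|uv]; first by rewrite rxv eqxx orbT.
    case: (eqVneq u w) => [->|uw]; first by rewrite rxw (LD v) // !orbT.
    case: (eqVneq u x) => [->|ux]; first by rewrite rxx eqxx.
    by rewrite Ex //= => uL; rewrite (s_in S) // !orbT.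
  rewrite rpD // => /or3P[/eqP->|/eqP->|uL]; first by rewrite yx // eqxx orbT.
    by rewrite yw // eqxx.
  by rewrite (s_in S) // !orbT.
- move=> y u; rewrite inE => /orP[/set1P ->|yD]; rewrite !L.
    rewrite rpx; case: (eqVneq u v) => [->|uv].
      by rewrite rxv eqxx vx vw orbT.
    case: (eqVneq u w) => [->|uw]; first by rewrite rxw vx vw orbT.
    case: (eqVneq u x) => [->|ux]; first by rewrite rxx eqxx.
    rewrite Ex //= => uL; have ruL := s_in S vD uL.
    by rewrite !(neL _ _ ruL) // (s_tau S).
  rewrite rpD // => /or3P[/eqP->|/eqP->|uL]; first by rewrite yx // !eqxx orbT.
    by rewrite yw // !eqxx orbT.
  have ruL := s_in S yD uL.
  by rewrite !(neL _ _ ruL) // !(neL _ _ uL) // (s_tau S).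
- move=> y u; rewrite inE => /orP[/set1P ->|yD]; rewrite !L.
    rewrite rpx eqxx; case: (eqVneq u v) => [->|uv].
      by rewrite rxv => _ _ E; rewrite E eqxx in vw.
    case: (eqVneq u w) => [->|uw]; first by rewrite rxw => _ _ E; rewrite E eqxx in vw.
    case: (eqVneq u x) => [->//|ux].
    rewrite Ex //= => uL tu ru; have := s_one S vD uL tu ru => E.
    by rewrite E eqxx in uv.
  rewrite rpD // !(neD _ _ yD) //=.
  move=> /or3P[/eqP->|/eqP->|uL]; first by rewrite yx // => _ E; rewrite E eqxx in xw.
    by rewrite yw // => _ E; rewrite E eqxx in xw.
  by rewrite !(neL _ _ uL) //=; apply: (s_one S).
- move=> y u; rewrite inE => /orP[/set1P ->|yD]; rewrite L !negb_or => /and3P[ux uw uL].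
    rewrite rpx Ex //; first by apply: (s_off S).
    by apply: contraNneq uL => ->; apply: LD.
  by rewrite rpD //; apply: (s_off S).
- move=> y p; rewrite !inE => /orP[/eqP->|yD] /orP[/eqP->|pD].
  + exists x; rewrite !inE eqxx rpx; split=> //; first by left.
    move=> u'; rewrite !inE; case: (eqVneq u' x) => //= _ uD b' _.
    by move: xD; rewrite -b' (s_blk S).
  + have [t [tD bt Xt nt]] := s_exit S vD pD.
    rewrite (neD _ _ pD xD) rpx.
    have tv : blk p = blk v -> t = v.
      move=> E; apply: (exit_uniq vD) => //; first by rewrite bt.
      by left.
    exists t; rewrite !inE tD orbT (neD _ _ tD xD); split=> //.
      case: (eqVneq t v) => [->|tv']; first by rewrite rxv; right; rewrite eqxx.
      rewrite Ex ?(neD _ w tD) ?(neD _ x tD) //.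
      by case: Xt => [->|tO]; [left|right; rewrite tO orbT].
    move=> u'; rewrite !inE; case: (eqVneq u' x) => [_ _ E|u'x /= u'D b' ut].
      by move: xD; rewrite E (s_blk S).
    have u'v : u' != v.
      apply: contraNneq ut => E; rewrite E in b' *.
      by rewrite (tv (esym b')).
    rewrite Ex ?(neD _ w u'D) ?(neD _ x u'D) //.
    have [r1 r2 r3] := nt _ u'D b' ut.
    by rewrite r1 orbT (neD _ x r1).
  + exists x; rewrite !inE eqxx rpD //; split=> //; first by right; rewrite yx // eqxx.
    move=> u'; rewrite !inE; case: (eqVneq u' x) => //= _ uD b' _.
    by move: xD; rewrite -b' (s_blk S).
  + have [t [tD bt Xt nt]] := s_exit S yD pD.
    rewrite (neD _ _ pD xD) rpD //.
    exists t; rewrite !inE tD orbT (neD _ _ tD xD); split=> //.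
      by case: Xt => [->|tO]; [left|right; rewrite tO orbT].
    move=> u'; rewrite !inE; case: (eqVneq u' x) => [_ _ E|u'x /= u'D b' ut].
      by move: xD; rewrite E (s_blk S).
    have [r1 r2 r3] := nt _ u'D b' ut.
    by rewrite r1 orbT (neD _ x r1).
- move=> y w1; rewrite !inE => /orP[/eqP->|yD] /orP[/eqP->|w1O].
  + by rewrite rpx rxw vD orbT.
  + rewrite rpx Ex ?(neO _ _ w1O) //; first by rewrite (s_O S) // orbT.
    by rewrite (DO vD).
  + by rewrite rpD // yw // eqxx.
  + by rewrite rpD // (s_O S) // orbT.
move=> w1; rewrite !inE => /orP[/eqP->|w1O].
  exists v, x; rewrite !inE vD eqxx orbT; split=> // y; rewrite !inE => /orP[/eqP->|yD].
    by left; rewrite rpx rxw.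
  by right; rewrite rpD // yw // eqxx.
have [p [q [pD qD pq]]] := s_two S w1O.
exists p, q; rewrite !inE pD qD !orbT !(neD _ _ pD) // !(neD _ _ qD) //; split=> // y yD'.
have [y' y'D ->] : exists2 y', y' \in D & rp' y w1 = rp y' w1.
  move: yD'; rewrite !inE; case: (boolP (y \in D)) => yD H; first by exists y; rewrite ?rpD.
  exists v => //; move: H; rewrite orbF => /eqP ->; rewrite rpx Ex ?(neO _ _ w1O) //.
  by rewrite (DO vD).
by rewrite !(neD _ _ (s_O S y'D w1O)) //; apply: pq.
Qed.

End Grow.
End State.
End Blossom.

(** * Alternating walks along two stored matchings *)

Section WalkDef.
Variables (T : finType) (Q N : T -> T) (v w : T) (D : {set T}) (rp : T -> T -> T).

(** Starting from [w], follow [Q] and [N] alternately, keeping the matching [walkR] that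
    results from rotating along the walk, and record a matching for every new vertex that
    gets exposed. *)
Fixpoint walk (i : nat) : T :=
  if i is i'.+1 then (if odd i' then N else Q) (walk i') else w.

Fixpoint walkR (k : nat) : T -> T :=
  if k is k'.+1 then rot (walkR k') (walk k'.*2.+1) (walk k'.*2.+2) else rot Q v w.

Fixpoint walkD (k : nat) : {set T} :=
  if k is k'.+1 then walk k'.*2.+1 |: walkD k' else D.

Fixpoint walkP (k : nat) : T -> T -> T :=
  if k is k'.+1 then
    if walk k'.*2.+1 \in walkD k' then walkP k'
    else fun y => if y == walk k'.*2.+1 then walkR k' else walkP k' y
  else rp.

Lemma walk_even k : walk k.*2.+1 = Q (walk k.*2).
Proof. by rewrite /= odd_double. Qed.

Lemma walk_odd k : walk k.*2.+2 = N (walk k.*2.+1).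
Proof. by rewrite /= !odd_double. Qed.

Lemma walkDP k y : reflect (y \in D \/ exists2 i, i < k & y = walk i.*2.+1) (y \in walkD k).
Proof.
apply: (iffP idP).
  elim: k => [|k IH]; first by left.
  rewrite inE => /orP[/set1P->|/IH[|[i ik ->]]]; [by right; exists k|by left|].
  by right; exists i => //; apply: ltnW.
elim: k => [[//|[i //]]|k IH].
case=> [yD|[i ik E]]; first by rewrite inE IH ?orbT //; left.
rewrite !inE; move: ik; rewrite ltnS leq_eqVlt => /orP[/eqP ik|ik]; first by rewrite E ik eqxx.
by rewrite IH ?orbT //; right; exists i.
Qed.

Lemma walkPS k : walkP k.+1 = if walk k.*2.+1 \in walkD k then walkP k
  else fun y => if y == walk k.*2.+1 then walkR k else walkP k y.
Proof. by []. Qed.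

Lemma walkP_old k x : x \in D -> walkP k x = rp x.
Proof.
move=> xD; elim: k => // k IH; rewrite walkPS; case: ifP => // /negP n.
by case: eqP => // E; case: n; rewrite -E; apply/walkDP; left.
Qed.

Lemma walkP_new k x : x \in walkD k -> x \notin D ->
  exists2 i, i < k & x = walk i.*2.+1 /\ walkP k x = walkR i.
Proof.
elim: k => [/= -> //|k IH]; rewrite [x \in _]inE => /orP[/set1P E|xk] xD; last first.
  have [i ik [E1 E2]] := IH xk xD; exists i; first exact: ltnW.
  split=> //; rewrite walkPS; case: ifP => // /negP n; case: eqP => // E.
  by rewrite -E in n.
rewrite walkPS -E; case: ifP => xk; last by exists k => //; rewrite eqxx.
by have [i ik [E1 E2]] := IH xk xD; exists i; first exact: ltnW.
Qed.

End WalkDef.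

Section Walk.
Variables (T : finType) (e : rel T).
Hypotheses (e_sym : symmetric e) (e_irr : irreflexive e).
Variables (M : T -> T) (D : {set T}) (rp : T -> T -> T)
  (O : {set T}) (blk tau : T -> T).
Hypothesis S : search e M D rp O blk tau.
Variables (v w : T).
Hypotheses (vD : v \in D) (wD : w \in D) (evw : e v w).
Let Q := rp v.
Let N := rp w.
Hypothesis Qw : Q w <> w.

Notation c := (walk Q N w).
Notation R := (walkR Q N v w).

(** The walk goes on from the positions [2, ..., 2 * K]. It ends at an even position exposed by [Q]:
    at [v] it closes a blossom, elsewhere it gives an augmenting path. *)
Definition moving (K : nat) : Prop := forall k, k < K -> Q (c k.*2.+2) <> c k.*2.+2.

Let QK : involutive Q := rpK S vD.
Let NK : involutive N := rpK S wD.
Let Qv : Q v = v := s_miss S vD.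
Let Nw : N w = w := s_miss S wD.

Lemma walkL i : c i \in D :|: O /\ tau (c i) = tau w.
Proof.
elim: i => [|i [IH1 IH2]] /=; first by rewrite inE wD.
by case: ifP => _; rewrite (s_in S) // (s_tau S).
Qed.

Lemma walkN i : N (c i) = c i -> c i = w.
Proof. by have [h1 h2] := walkL i; apply: (s_one S). Qed.

(** The union of two matchings consists of paths and cycles, and the walk starts at the end of a
    path, the vertex [w] exposed by [N]. A repetition is pulled back along the matching that led to
    its later position, which yields an earlier repetition. *)
Lemma walk_neq K : moving K -> forall j i, i < j -> j <= K.*2.+2 -> c i <> c j.
Proof.
move=> mv; elim=> [//|j IH] i; rewrite ltnS leq_eqVlt => /orP[/eqP->|ij] jK.
  rewrite /=; case: (boolP (odd j)) => oj E.
    have := walkN (esym E); case: j {E} IH oj jK => // j IH _ jK E.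
    by apply: (IH 0) => //; apply: ltnW.
  case: j E oj jK {IH} => [E _ _|j E oj jK]; first exact: (Qw (esym E)).
  have jE : j.+1 = (j./2).*2.+2 by rewrite -addn1; have := odd_double_half j; lia.
  by rewrite jE in E; apply: (mv j./2 _ (esym E)); lia.
move=> E.
have {}E : c j = (if odd j then N else Q) (c i).
  by rewrite E /=; case: ifP => _; rewrite ?NK ?QK.
have jK' : j <= K.*2.+2 by apply: ltnW.
case: (eqVneq (odd i) (odd j)) => oij.
  have ij' : i.+1 < j.
    by rewrite ltn_neqAle ij andbT; apply/eqP => E1; move: oij; rewrite -E1 /=; case: odd.
  by apply: (IH i.+1) => //; rewrite E /= oij.
case: i ij E oij => [|i] ij E oij.
  have oj : odd j by move: oij; case: (odd j).
  by apply: (IH 0) => //; rewrite E oj /= Nw.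
apply: (IH i) => //; first exact: ltnW.
rewrite E /=; move: oij; rewrite /=.
by case: (odd i); case: (odd j) => //= _; rewrite ?QK ?NK.
Qed.

Lemma walk_uniq K i j : moving K -> i <= K.*2.+2 -> j <= K.*2.+2 -> c i = c j -> i = j.
Proof.
move=> mv iK jK E; case: (ltngtP i j) => // ij.
  by case: (walk_neq mv ij jK).
by case: (walk_neq mv ij iK).
Qed.

Lemma walk_v K i : moving K -> i <= K.*2.+1 -> c i <> v.
Proof.
move=> mv iK E; case: (boolP (odd i)) => oi.
  have : c i.-1 = v.
    case: i oi {iK} E => // i /=; case: odd => //= _ E.
    by rewrite -[LHS]QK E Qv.
  by rewrite -E; apply: (walk_neq mv); lia.
case: i E oi iK => [E _ _|i E oi iK].
  by move: evw; rewrite -E /= e_irr.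
have iE : i.+1 = (i./2).*2.+2 by rewrite -addn1; have := odd_double_half i; lia.
by apply: (mv i./2); first lia; rewrite -iE E.
Qed.

(** A rotation adds the [N]-edge between positions [2 * k + 1] and [2 * k + 2] and drops the
    [Q]-edge leaving the latter. The exposed vertex moves on by two positions, and off the walk and
    [v] nothing changes. *)
Lemma walkR_spec K : moving K -> forall k, k <= K ->
  [/\ matching e (R k), R k (c k.*2.+1) = c k.*2.+1,
      fixs (R k) = c k.*2.+1 |: (fixs Q :\ v) &
      forall u, u <> v -> (forall i, i <= k.*2.+1 -> u <> c i) -> R k u = Q u].
Proof.
move=> mv; have mQ : matching e Q := s_mat S vD.
elim=> [_|k IH kK].
  have Qwv : Q w <> v by move=> E; apply: (@walk_v K 1 mv).
  split; first exact: rot_matching.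
  - by rewrite /= /rot (introF eqP Qwv) (introF eqP Qw) eqxx.
  - by rewrite /= (rot_fixs e_irr) // (introF eqP Qw).
  - move=> u uv uc; rewrite /= /rot (introF eqP uv).
    by rewrite (introF eqP (uc 0 isT)) (introF eqP (uc 1 isT)).
have [m1 m2 m3 m4] := IH (ltnW kK).
set x := c k.*2.+1 in m2 *; set y := c k.*2.+2.
have yN : y = N x by rewrite /y walk_odd.
have xy : N x <> x by rewrite -yN => E; apply: (@walk_neq K mv k.*2.+2 k.*2.+1) => //; lia.
have exy : e x y by rewrite yN; have [_ h] := s_mat S wD; apply: h; apply/eqP.
have Qy : Q y <> y by apply: mv.
have Ry : R k y = Q y.
  apply: m4; first by apply: (walk_v mv); lia.
  by move=> i ik E; apply: (@walk_neq K mv k.*2.+2 i) => //; lia.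
have zE : c k.+1.*2.+1 = Q y by rewrite walk_even doubleS.
have Qyx : Q y <> x.
  by move=> E; apply: xy; rewrite -yN; apply: (inv_inj (proj1 m1)); rewrite m2 Ry E.
have Rk : R k.+1 = rot (R k) x y by [].
have Ryy : R k y != y by rewrite Ry; apply/eqP.
rewrite Rk zE; split; first exact: rot_matching.
- rewrite /rot (introF eqP Qyx) (introF eqP Qy); by rewrite Ry eqxx.
- rewrite (rot_fixs e_irr) // (negbTE Ryy) Ry m3; congr (_ |: _).
  apply/setP => u; rewrite !inE; case: (eqVneq u x) => //= ->.
  rewrite -/Q; apply/esym/negP => /andP[_ /eqP Qx].
  have E : c k.*2 = c k.*2.+1 by rewrite -[RHS]Qx /x walk_even QK.
  by apply: (walk_neq mv _ _ E); lia.
move=> u uv uc; rewrite /rot.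
have u1 : u <> x by apply: uc; lia.
have u2 : u <> y by apply: uc; lia.
have u3 : u <> Q y by rewrite -zE; apply: uc; lia.
rewrite Ry (introF eqP u1) (introF eqP u2) (introF eqP u3).
by apply: m4 => // i ik; apply: uc; lia.
Qed.

Lemma walkR_card K k : moving K -> k <= K -> #|fixs (R k)| = #|fixs M|.
Proof.
move=> mv kK; have [_ _ -> _] := walkR_spec mv kK.
rewrite cardsU1 -(s_card S vD) [in RHS](cardsD1 v) !inE (s_miss S vD) eqxx.
suff -> : (Q (c k.*2.+1) == c k.*2.+1) = false by rewrite andbF.
apply/eqP; rewrite {1}walk_even QK => E.
by apply: (walk_neq mv _ _ E); lia.
Qed.

Lemma walkR_next K k : moving K -> k <= K -> c k.*2.+2 <> v ->
  R k (c k.*2.+2) = c k.*2.+3.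
Proof.
move=> mv kK cv; have [_ _ _ h] := walkR_spec mv kK.
rewrite h //; last by move=> i ik E; apply: (@walk_neq K mv k.*2.+2 i) => //; lia.
by rewrite -doubleS walk_even.
Qed.

(** While the walk is moving its positions are distinct, which cannot last for more than [#|T|]
    vertices. *)
Lemma walk_stops : exists k, [/\ k < #|T|, moving k & Q (c k.*2.+2) = c k.*2.+2].
Proof.
have [|nst] := boolP [exists k : 'I_#|T|, Q (c k.*2.+2) == c k.*2.+2].
  move/existsP => [k0 h0].
  have ex : exists k, Q (c k.*2.+2) == c k.*2.+2 by exists k0.
  case: (ex_minnP ex) => k /eqP hk mk; exists k; split=> //.
    exact: leq_ltn_trans (mk _ h0) (ltn_ord _).
  by move=> i ik /eqP /mk; rewrite leqNgt ik.
have mv : moving #|T|.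
  move=> k kT E; case/existsP: nst; exists (Ordinal kT); exact/eqP.
have : uniq (map c (iota 0 #|T|.+1)).
  rewrite map_inj_in_uniq ?iota_uniq // => i j; rewrite !mem_iota !add0n => iT jT.
  by apply: (walk_uniq mv); lia.
by move/card_uniqP => E; have := max_card (mem (map c (iota 0 #|T|.+1)));
  rewrite E size_map size_iota ltnn.
Qed.

(** A blossom is entered by an [N]-edge from [O], hence at its [N]-exit; for the initial blossom
    this exit is [w]. A [Q]-step inside the blossom cannot return to that exit, so the next [N]-step
    stays inside as well. Therefore the [N]-exits of all blossoms met lie on the walk. *)
Lemma walk_struct K j : moving K -> j <= K.+1 -> c j.*2 \in D /\
  exists i, [/\ i <= j, c i.*2 \in D, blk (c i.*2) = blk (c j.*2) & is_exit rp O w (c i.*2)].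
Proof.
move=> mv; elim: j => [_|j IH jK].
  by split=> //; exists 0; split=> //; left.
have [cD [i [ij iD bi Xi]]] := IH (ltnW jK).
have [QO|QO] := boolP (c j.*2.+1 \in O).
  have cD' : c j.+1.*2 \in D by rewrite doubleS walk_odd; apply: (s_O S).
  split=> //; exists j.+1; split=> //.
  by right; rewrite doubleS walk_odd [rp w _]NK.
have Qc : Q (c j.*2) <> c j.*2.
  case: j jK {IH cD ij bi QO} => // j jK; rewrite doubleS; exact: mv.
have [|q1 q2 q3] := stay S vD cD.
  by case=> // h; move: QO; rewrite walk_even h.
have [|r1 r2 r3] := stay S wD q1.
  move=> X; have E := exit_uniq S wD q1 iD (etrans q2 (esym bi)) X Xi.
  by apply: (@walk_neq K mv j.*2.+1 i.*2); rewrite ?walk_even //; lia.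
have E : c j.+1.*2 = rp w (rp v (c j.*2)) by rewrite doubleS walk_odd walk_even.
rewrite E; split=> //; exists i; split=> //; first exact: leqW.
by rewrite r2 q2.
Qed.

Lemma walk_same_blk K j : moving K -> j <= K -> c j.*2.+1 \in D ->
  blk (c j.*2.+1) = blk (c j.*2) /\ blk (c j.*2.+2) = blk (c j.*2).
Proof.
move=> mv jK cD; have [eD [i [ij iD bi Xi]]] := walk_struct mv (leqW jK).
have [|q1 q2 q3] := stay S vD eD.
  case=> [Qc|]; last by rewrite -/Q -walk_even => /(s_dis S cD).
  case: j jK Qc {cD eD ij bi} => [_ /Qw//|j jK]; rewrite doubleS; exact: mv.
have [|r1 r2 r3] := stay S wD q1.
  move=> X; have E := exit_uniq S wD q1 iD (etrans q2 (esym bi)) X Xi.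
  by apply: (@walk_neq K mv j.*2.+1 i.*2); rewrite ?walk_even //; lia.
by rewrite walk_odd walk_even r2 q2.
Qed.

Lemma search_ext rp' : (forall x, x \in D -> rp' x = rp x) ->
  search e M D rp' O blk tau.
Proof.
move=> E; split.
- exact: s_fix S.
- exact: s_dis S.
- exact: s_blk S.
- by move=> x xD; rewrite E //; apply: (s_mat S).
- by move=> x xD; rewrite E //; apply: (s_miss S).
- by move=> x xD; rewrite E //; apply: (s_card S).
- by move=> x u xD; rewrite E //; apply: (s_in S).
- by move=> x u xD; rewrite E //; apply: (s_tau S).
- by move=> x u xD; rewrite E //; apply: (s_one S).
- by move=> x u xD; rewrite E //; apply: (s_off S).
- by move=> x p xD pD; have [u] := s_exit S xD pD; exists u; rewrite E.
- by move=> x u xD; rewrite E //; apply: (s_O S).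
move=> z zO; have [p [q [pD qD h]]] := s_two S zO; exists p, q; split=> // x xD.
by rewrite E //; apply: h.
Qed.

(** If no vertex was added, all odd positions were in [D] already and the walk never left the
    blossom of [w]. In either case the vertices of the walk satisfy what the merging step asks of
    [C]. *)
Lemma walk_blossom K : moving K -> c K.*2.+2 = v ->
  (walkD Q N w D K.+1 = D -> blk v = blk w) /\
  exists O' blk', search e M (walkD Q N w D K.+1) (walkP Q N v w D rp K.+1) O' blk' tau.
Proof.
move=> mv cv.
split=> [E|].
  have bl j : j <= K.+1 -> blk (c j.*2) = blk w.
    elim: j => // j IH jK; have [|_ b2] := @walk_same_blk K j mv jK.
      by rewrite -E; apply/walkDP; right; exists j.
    by rewrite doubleS b2 IH // ltnW.
  by rewrite -cv -doubleS bl.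
pose C : {set T} := [set c i | i : 'I_(K.*2.+3)].
have CP u : reflect (exists2 i, i <= K.*2.+2 & u = c i) (u \in C).
  apply: (iffP imsetP) => [[i _ ->]|[i iK ->]]; first by exists i => //; rewrite -ltnS.
  by exists (Ordinal (iK : i < K.*2.+3)).
have vC : v \in C by apply/CP; exists K.*2.+2.
have wC : w \in C by apply/CP; exists 0.
have Ci i : i <= K.*2.+2 -> c i \in C by move=> iK; apply/CP; exists i.
have cS i : c i.+1 = (if odd i then N else Q) (c i) by [].
have cQ i : Q (c i) = if odd i then c i.-1 else c i.+1.
  by case: i => [//|i]; rewrite [i.+1.-1]/= [odd i.+1]/= (cS i.+1) cS [odd i.+1]/=;
    case: (odd i) => //=; rewrite QK.
have cN i : N (c i) = if odd i then c i.+1 else c i.-1.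
  by case: i => [//|i]; rewrite [i.+1.-1]/= [odd i.+1]/= (cS i.+1) cS [odd i.+1]/=;
    case: (odd i) => //=; rewrite NK.
have CQ u : u \in C -> Q u \in C.
  case/CP => i iK ->; rewrite cQ; case: ifP => oi; first by apply: Ci; lia.
  case: (eqVneq i K.*2.+2) => [->|ne]; last by apply: Ci; lia.
  by have := cQ K.*2.+2; rewrite cv Qv /= negbK odd_double /= => <-.
have CN u : u \in C -> N u \in C.
  case/CP => i iK ->; rewrite cN; case: ifP => oi; last by apply: Ci; lia.
  apply: Ci; rewrite ltn_neqAle iK andbT; apply/eqP => E.
  by move: oi; rewrite E /= negbK odd_double.
have Dodd i : i <= K.*2.+2 -> c i \in D \/ exists2 k, k <= K & i = k.*2.+1.
  move=> iK; have := odd_double_half i; case: (odd i) => /= E.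
    by right; exists i./2; lia.
  left; rewrite -E add0n; apply: (proj1 (walk_struct mv _)); lia.
have WE : walkD Q N w D K.+1 = D :|: (C :&: O).
  apply/setP => u; apply/walkDP/idP => [[uD|[i iK ->]]|].
  - by rewrite inE uD.
  - have [h _] := walkL i.*2.+1; move: h; rewrite !inE => /orP[->//|->].
    by rewrite Ci ?orbT //; lia.
  rewrite !inE => /orP[uD|/andP[/CP[i iK ->] cO]]; first by left.
  have [cD|[k kK E]] := Dodd i iK; first by left.
  by right; exists k; rewrite ?E.
have Wnew x : x \in C :&: O -> exists2 k, k <= K &
    x = c k.*2.+1 /\ walkP Q N v w D rp K.+1 x = R k.
  rewrite inE => /andP[/CP[i iK ->] cO].
  have cD : c i \notin D by apply/negP => /(s_dis S); apply.
  have [|k kK [E1 E2]] := @walkP_new _ Q N v w D rp K.+1 (c i) _ cD.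
    by rewrite WE !inE cO Ci // orbT.
  by exists k; rewrite // E1.
exists (O :\: (C :&: O)), (fun u => if u \in C :|: [set u in D | blk u \in
  blk @: (C :&: D)] then blk v else blk u); rewrite WE.
have RC k u : k <= K -> u \in C -> R k u \in C.
  elim: k u => [|k IH] u kK uC /=.
    rewrite /rot; case: ifP => _ //; case: ifP => _ //; case: ifP => _; exact: CQ.
  have x1 : c k.*2.+1 \in C by apply: Ci; lia.
  have x2 : c k.*2.+2 \in C by apply: Ci; lia.
  rewrite /rot; case: ifP => _ //; case: ifP => _ //; case: ifP => _; apply: IH => //; lia.
have Cone u : u \in C -> Q u = u -> u = v.
  case/CP => i iK -> E; apply/eqP; case: (eqVneq (c i) v) => // ne.
  case: (ltnP i K.*2.+2) => iK'; last by rewrite (_ : i = K.*2.+2) ?cv ?eqxx // in ne; lia.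
  move: E; rewrite cQ; case: ifP => oi E.
    by case: (@walk_neq K mv i i.-1) => //; lia.
  by case: (@walk_neq K mv i.+1 i) => //; lia.
have tvw : tau v = tau w by rewrite -cv; case: (walkL K.*2.+2).
apply: (merge_search S vD wD evw (C := C)) => //.
- by apply/subsetP => u /CP[i _ ->]; case: (walkL i).
- by move=> u /CP[i _ ->]; rewrite tvw; case: (walkL i).
- move=> u /CP[i iK ->] cD; have := odd_double_half i.
  have h k : k <= K.+1 -> exists t, [/\ t \in C, t \in D, blk t = blk (c k.*2) & is_exit rp O w t].
    move=> kK; have [_ [j [jk jD bj Xj]]] := walk_struct mv kK.
    by exists (c j.*2); split=> //; apply: Ci; lia.
  case: (boolP (odd i)) => /= oi E; rewrite -E ?add0n; last by apply: h; lia.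
  have cD' : c i./2.*2.+1 \in D by rewrite -add1n E.
  have iK' : i./2 <= K by lia.
  have [b1 _] := walk_same_blk mv iK' cD'.
  by rewrite add1n b1; apply: h; lia.
- move=> Z ZQ ZN [u /CP[i iK ->] iZ].
  have ZS j : (c j.+1 \in Z) = (c j \in Z).
    rewrite /=; case: ifP => _; apply/idP/idP.
    + by move/ZN; rewrite [rp w _]NK.
    + exact: ZN.
    + by move/ZQ; rewrite [rp v _]QK.
    + exact: ZQ.
  have Z0 j : (c j \in Z) = (c 0 \in Z) by elim: j => // j IH; rewrite ZS.
  by apply/subsetP => y /CP[j _ ->]; rewrite Z0 -(Z0 i).
- by move=> x xD; apply: walkP_old.
- by move=> x /Wnew[k kK [_ ->]]; case: (walkR_spec mv kK).
- by move=> x /Wnew[k kK [-> ->]]; case: (walkR_spec mv kK).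
- move=> x /Wnew[k kK [_ ->]]; have [m1 m2 m3 _] := walkR_spec mv kK.
  exact: walkR_card mv kK.
- by move=> x u /Wnew[k kK [_ ->]]; apply: RC.
- move=> x u /Wnew[k kK [_ ->]] uC; have [_ _ _ h] := walkR_spec mv kK.
  apply: h => [uv|i ik E]; first by rewrite uv vC in uC.
  by rewrite E Ci // in uC; lia.
move=> x u /Wnew[k kK [-> ->]] uC Ru.
have [_ _ h _] := walkR_spec mv kK.
have : u \in fixs (R k) by rewrite inE Ru.
by rewrite h !inE => /orP[/eqP//|/andP[uv /eqP /(Cone _ uC) E]]; rewrite E eqxx in uv.
Qed.
(** The last vertex of the walk is exposed by [walkR K] too, so the final rotation joins two exposed
    vertices and gains an edge. *)
Lemma walk_augment K : moving K -> Q (c K.*2.+2) = c K.*2.+2 -> c K.*2.+2 <> v ->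
  matching e (R K.+1) /\ #|fixs (R K.+1)| < #|fixs M|.
Proof.
move=> mv Qc cv; have [m1 m2 m3 m4] := walkR_spec mv (leqnn K).
have Ry : R K (c K.*2.+2) = c K.*2.+2.
  by rewrite (walkR_next mv) // -doubleS walk_even.
have exy : e (c K.*2.+1) (c K.*2.+2).
  rewrite walk_odd; have [_ h] := s_mat S wD; apply: h; apply/eqP.
  by rewrite -/N -walk_odd => E; apply: (walk_neq mv _ _ (esym E)); lia.
split; first exact: rot_matching.
by rewrite -(walkR_card mv (leqnn K)); apply: rot_card_lt.
Qed.

End Walk.

(** A Tutte-Berge witness: odd sets [B] whose outer neighbours all lie in [O]. *)
Definition certificate (T : finType) (e : rel T) (M : T -> T) : Prop :=
  exists (O : {set T}) (P : {set {set T}}),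
    [/\ trivIset P, forall B, B \in P -> odd #|B|,
        forall B, B \in P -> [disjoint B & O],
        forall B u v, B \in P -> u \in B -> e u v -> v \notin B -> v \in O &
        #|O| + #|fixs M| <= #|P|].

(** * Witnesses and the optimality of a matching *)

Section Certificate.
Variables (T : finType) (e : rel T).

(** By parity an odd block cannot be matched within itself, so [N] exposes one of its vertices or
    matches it into [O]. The images of these vertices under [N] are distinct, whence
    [#|P| <= #|O| + #|fixs N|]. *)
Lemma certificate_max M N : certificate e M -> matching e N ->
  #|fixs M| <= #|fixs N|.
Proof.
move=> [O [P [tP oP dP nP cP]]] [NK Ne].
have ex B : B \in P -> exists2 u, u \in B & N u \in fixs N :|: O.
  move=> BP; case: (boolP [exists u in B, N u \in fixs N :|: O]).
    by move/existsP => [u /andP[uB uN]]; exists u.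
  rewrite negb_exists => /forallP no; have no' u : u \in B -> N u \in B /\ N u != u.
    move=> uB; move: (no u); rewrite uB !inE NK negb_or eq_sym => /andP[uN uO].
    split=> //; apply: contraR uO => uB'.
    by apply: (nP B u) => //; apply: Ne.
  have := oP _ BP; rewrite (odd_card_fixs NK); last by move=> u /no'[].
  rewrite (_ : _ :&: _ = set0) ?cards0 //; apply/setP => u; rewrite !inE.
  by apply/negP => /andP[/no'[_ /negbTE ->]].
pose g (B : {set T}) := omap N [pick u in B | N u \in fixs N :|: O].
have gP B : B \in P -> exists u, [/\ g B = Some (N u), u \in B & N u \in fixs N :|: O].
  move=> BP; rewrite /g; case: pickP => [u /andP[uB uN]|no]; first by exists u.
  by have [u uB uN] := ex _ BP; move: (no u); rewrite uB uN.
have ginj : {in P &, injective g}.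
  move=> B B' BP BP' E; have [u [Eu uB _]] := gP _ BP; have [u' [Eu' uB' _]] := gP _ BP'.
  move: E; rewrite Eu Eu' => -[/(inv_inj NK) E]; rewrite -E in uB'.
  apply/eqP/negPn/negP => BB'; have := trivIsetP tP _ _ BP BP' BB'.
  by move/pred0P/(_ u); rewrite /= uB uB'.
have gsub : g @: P \subset Some @: (fixs N :|: O).
  by apply/subsetP => o /imsetP[B BP ->]; have [u [-> _ uN]] := gP _ BP; apply: imset_f.
have := subset_leq_card gsub; rewrite (card_in_imset ginj) card_imset; last by move=> ? ? [].
have := cardsU (fixs N) O; lia.
Qed.

(** The blossoms are the blocks. A blossom containing [p] is odd because [rp p] pairs up all of it
    but [p]. In any [rp x], the exposed vertices and the partners of [O] are exits, hence lie in
    pairwise distinct blossoms. *)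
Lemma closed_certificate M D rp O blk tau : search e M D rp O blk tau ->
  (forall v w, v \in D -> e v w -> w \in O \/ (w \in D /\ blk v = blk w)) ->
  certificate e M.
Proof.
move=> S cl; case: (set_0Vmem D) => [D0|[x xD]].
  exists set0, set0; split; rewrite ?cards0 //.
  - by apply/trivIsetP => B B'; rewrite inE.
  - by move=> B; rewrite inE.
  - by move=> B; rewrite inE.
  - by move=> B u v; rewrite inE.
  rewrite add0n leqn0 cards_eq0; apply/eqP/setP => y; rewrite !inE.
  by apply/eqP => /(s_fix S); rewrite D0 inE.
pose cls b : {set T} := [set u in D | blk u == b].
have PP B : B \in cls @: (blk @: D) -> exists2 p, p \in D & B = cls (blk p).
  by case/imsetP => b /imsetP[p pD ->] ->; exists p.
exists O, (cls @: (blk @: D)); split.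
- apply/trivIsetP => B B' /imsetP[b _ ->] /imsetP[b' _ ->] ne.
  apply/pred0P => u /=; apply/negP => /andP[]; rewrite !inE.
  by move=> /andP[_ /eqP b1] /andP[_ /eqP b2]; rewrite -b1 -b2 eqxx in ne.
- move=> B /PP[p pD ->].
  have ex u : u \in cls (blk p) -> u != p -> rp p u \in cls (blk p) /\ rp p u <> u.
    rewrite !inE => /andP[uD /eqP bu] up; have [|q1 q2 q3] := stay S pD uD.
      move=> X; have E := exit_uniq S pD uD pD bu X (or_introl (s_miss S pD)).
      by rewrite E eqxx in up.
    by rewrite q1 q2 bu eqxx.
  rewrite (odd_card_fixs (rpK S pD)); last first.
    move=> u uB; case: (eqVneq u p) => [->|up]; last by case: (ex u uB up).
    by rewrite (s_miss S pD) !inE pD eqxx.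
  suff -> : cls (blk p) :&: fixs (rp p) = [set p] by rewrite cards1.
  apply/setP => u; rewrite in_setI in_set1; case: (eqVneq u p) => [->|up].
    by rewrite !inE pD (s_miss S pD) !eqxx.
  by apply/negP => /andP[uB]; rewrite inE => /eqP; case: (ex u uB up).
- move=> B /PP[p pD ->]; apply/pred0P => u /=; rewrite inE.
  by apply/negP => /andP[/andP[uD _]]; apply: (s_dis S).
- move=> B u v /PP[p pD ->]; rewrite !inE => /andP[uD /eqP bu] euv.
  by case: (cl _ _ uD euv) => // -[vD bv]; rewrite vD -bv bu eqxx.
have cinj : {in blk @: D &, injective cls}.
  move=> b b' /imsetP[p pD ->] _ E; have : p \in cls (blk p) by rewrite inE pD eqxx.
  by rewrite E inE => /andP[_ /eqP].
rewrite (card_in_imset cinj) -(s_card S xD).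
have fD u : u \in fixs (rp x) -> u \in D.
  rewrite inE => /eqP ru; case: (boolP (u \in D)) => // uD.
  case: (boolP (u \in O)) => uO; first by move: (s_O S xD uO); rewrite ru (negbTE uD).
  by rewrite -(negbTE uD); apply: (s_fix S); rewrite -(s_off S xD) // inE negb_or uD.
have h u : u \in O :|: fixs (rp x) -> rp x u \in D /\ is_exit rp O x (rp x u).
  rewrite inE => /orP[uO|uF]; first by rewrite (s_O S) //; split=> //; right; rewrite (rpK S xD).
  have := fD _ uF; move: uF; rewrite inE => /eqP ru uD; rewrite !ru; split=> //.
  by left.
rewrite -cardsUI (_ : O :&: _ = set0); last first.
  apply/setP => u; rewrite in_setI in_set0; apply/negP => /andP[uO /fD uD].
  exact: (s_dis S uD uO).
rewrite cards0 addn0 -(@card_in_imset _ _ (fun u => blk (rp x u))).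
  by apply: subset_leq_card; apply/subsetP => b /imsetP[u /h[rD _] ->]; apply: imset_f.
move=> u u' /h[r1 X1] /h[r2 X2] E; apply: (inv_inj (rpK S xD)).
exact: (exit_uniq S xD r1 r2 E X1 X2).
Qed.
End Certificate.

(** * The matching program *)

Declare Scope stm_scope.
Delimit Scope stm_scope with S.
Notation "s1 ;; s2" := (SSeq s1 s2) (at level 90, right associativity) : stm_scope.
Notation "x <- e" := (SAsg x e) (at level 85) : stm_scope.

(** By truncation the inner sum is the distance of the two values, and the result is a truth value 0
    or 1. *)
Definition EEq (a b : exp) : exp := ESub (ECst 1) (EAdd (ESub a b) (ESub b a)).
Definition ELd1 (k : nat) (b : exp) : exp := ELd k (ECst 0) b.
Definition SSt1 (k : nat) (b e : exp) : stm := SSt k (ECst 0) b e.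

Definition vI := 0.
Definition vV := 1.
Definition vW := 2.
Definition vX := 3.
Definition vY := 4.
Definition vZ := 5.
Definition vGo := 6.
Definition vFound := 7.
Definition vK := 8.
Definition vIn := 9.
Definition vPhase := 10.
Definition vRound := 11.

(** [aG] holds the input and [aE] the relation to be matched; row [x] of [aRep] is [rp x] for
    the [x] flagged in [aD]; single rows hold the current matching ([aM]), the matching
    rotated along the walk ([aR]) and the first perfect matching ([aMate]). *)
Definition aG := 0.
Definition aE := 1.
Definition aRep := 2.
Definition aM := 3.
Definition aD := 4.
Definition aR := 5.
Definition aMate := 6.

Definition copy_row (k2 : nat) (a2 : exp) (k1 : nat) (a1 : exp) : stm :=
  SFor vI (SSt k2 a2 (EVar vI) (ELd k1 a1 (EVar vI))).

Definition add_rep : stm :=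
  SIf (ELd1 aD (EVar vX)) SSkip
    (SSt1 aD (EVar vX) (ECst 1) ;; copy_row aRep (EVar vX) aR (ECst 0))%S.

(** One double step of the walk. If [vIn] is 0, that is, if [w] is not reachable, the vertex [vX] is
    recorded and the loop stops: this is the growing step. Meeting [v] closes a blossom, and an
    exposed [vY] ends an augmenting path. *)
Definition walk_step : stm :=
  (add_rep ;;
   SIf (EVar vIn)
     (vY <- ELd aRep (EVar vW) (EVar vX) ;;
      SIf (EEq (EVar vY) (EVar vV)) (vGo <- ECst 0)
        (vZ <- ELd1 aR (EVar vY) ;;
         SSt1 aR (EVar vX) (EVar vY) ;; SSt1 aR (EVar vY) (EVar vX) ;;
         SIf (EEq (EVar vZ) (EVar vY)) (vGo <- ECst 0 ;; vFound <- ECst 1)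
           (SSt1 aR (EVar vZ) (EVar vZ) ;; vX <- EVar vZ)))
     (vGo <- ECst 0))%S.

Definition scan_edge : stm :=
  (copy_row aR (ECst 0) aRep (EVar vV) ;;
   vX <- ELd1 aR (EVar vW) ;;
   SSt1 aR (EVar vV) (EVar vW) ;; SSt1 aR (EVar vW) (EVar vV) ;;
   SIf (EEq (EVar vX) (EVar vW)) (vFound <- ECst 1)
     (SSt1 aR (EVar vX) (EVar vX) ;; vGo <- ECst 1 ;; vIn <- ELd1 aD (EVar vW) ;;
      SFor vK (SIf (EVar vGo) walk_step SSkip)) ;;
   SIf (EVar vFound) (copy_row aM (ECst 0) aR (ECst 0)) SSkip)%S.

(** Every round enlarges [D], finds a larger matching or shows that the search is closed, so [n]
    rounds suffice. Once [vFound] is set the remaining iterations are idle, and the next phase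
    starts a new search. *)
Definition match_phase : stm :=
  (vFound <- ECst 0 ;;
   SFor vI (SSt1 aD (EVar vI) (EEq (ELd1 aM (EVar vI)) (EVar vI))) ;;
   SFor vV (copy_row aRep (EVar vV) aM (ECst 0)) ;;
   SFor vRound (SFor vV (SFor vW
     (SIf (EVar vFound) SSkip
       (SIf (ELd1 aD (EVar vV)) (SIf (ELd aE (EVar vV) (EVar vW)) scan_edge SSkip) SSkip)))))%S.

Definition max_matching : stm :=
  (SFor vI (SSt1 aM (EVar vI) (EVar vI)) ;; SFor vPhase match_phase)%S.

(** * Evaluation rules for the programs *)

Section Semantics.
Variable n : nat.
Implicit Types (u : ust) (i j : 'I_n).

Lemma ord_pos i : 0 < n.
Proof. by case: i => m; case: n. Qed.

Lemma eval_seq s1 s2 u : eval n (SSeq s1 s2) u = eval n s2 (eval n s1 u).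
Proof. by []. Qed.

Lemma eval_if a s1 s2 u :
  eval n (SIf a s1 s2) u = if ev n a u != 0 then eval n s1 u else eval n s2 u.
Proof. by []. Qed.

Lemma eval_ifT a s1 s2 u : ev n a u != 0 -> eval n (SIf a s1 s2) u = eval n s1 u.
Proof. by rewrite eval_if => ->. Qed.

Lemma eval_ifF a s1 s2 u : ev n a u = 0 -> eval n (SIf a s1 s2) u = eval n s2 u.
Proof. by rewrite eval_if => ->. Qed.

Lemma eval_asg x a u : eval n (SAsg x a) u = setv u x (ev n a u).
Proof. by []. Qed.

Lemma ev_eq a b u : (ev n (EEq a b) u != 0) = (ev n a u == ev n b u).
Proof. by rewrite /=; lia. Qed.

Lemma ev_neq a b u : ev n a u != ev n b u -> ev n (EEq a b) u = 0.
Proof. by rewrite -ev_eq; case: eqP. Qed.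

Lemma ev_ld1 k b u i : ev n b u = i -> ev n (ELd1 k b) u = arr u k 0 i.
Proof. by move=> /= ->; rewrite (ord_pos i) ltn_ord. Qed.

Lemma ev_ld k a b u i j : ev n a u = i -> ev n b u = j ->
  ev n (ELd k a b) u = arr u k i j.
Proof. by move=> /= -> ->; rewrite !ltn_ord. Qed.

Lemma eval_st1 k b e u i : ev n b u = i ->
  eval n (SSt1 k b e) u = setc u k 0 i (ev n e u).
Proof. by move=> /= ->; rewrite (ord_pos i) ltn_ord. Qed.

Lemma copy_row_spec k2 a2 k1 a1 u (r2 r1 : nat) : k1 != k2 -> r2 < n -> r1 < n ->
  (forall u', (forall y, y != vI -> env u' y = env u y) -> ev n a2 u' = r2) ->
  (forall u', (forall y, y != vI -> env u' y = env u y) -> ev n a1 u' = r1) ->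
  let u' := eval n (copy_row k2 a2 k1 a1) u in
  [/\ forall i, arr u' k2 r2 i = arr u k1 r1 i,
      forall k r c, (k != k2) || (r != r2) -> arr u' k r c = arr u k r c,
      forall y, y != vI -> env u' y = env u y &
      uout u' = uout u].
Proof.
move=> k12 r2n r1n h2 h1 u'.
pose P m w := [/\ forall i, i < m -> arr w k2 r2 i = arr u k1 r1 i,
      forall k r c, (k != k2) || (r != r2) -> arr w k r c = arr u k r c,
      forall y, y != vI -> env w y = env u y &
      uout w = uout u].
suff [p1 p2 p3 p4] : P n u' by split=> // i; apply: p1.
apply: for_ind => // i w iN [p1 p2 p3 p4].
have e' y : y != vI -> env (setv w vI i) y = env u y.
  by move=> yI; rewrite /= /upd (negbTE yI) p3.
rewrite [eval _ _ _]/= (h2 _ e') (h1 _ e') /upd eqxx r2n r1n iN /=.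
split=> //.
- move=> c; rewrite /= !eqxx /= ltnS leq_eqVlt; case: eqVneq => [->|_] //= ci; last exact: p1.
  by rewrite p2 // k12.
- move=> k r c kr /=; case: and3P => [[/eqP k' /eqP r' _]|_]; last exact: p2.
  by rewrite k' r' !eqxx in kr.
Qed.

End Semantics.

(** * Correctness of scanning one edge *)

Section MatchingProgram.
Variable n : nat.
Notation T := 'I_n.
Implicit Types (u : ust) (i j v w x y z : T) (R M : T -> T) (D : {set T}) (rp : T -> T -> T).

Definition holds_row u (k : nat) R : Prop := forall i, arr u k 0 i = R i.
Definition holds_set u D : Prop := forall i, arr u aD 0 i = (i \in D).
Definition holds_reps u D rp : Prop := forall x i, x \in D -> arr u aRep x i = rp x i.
Definition holds_rel u (e : rel T) : Prop := forall i j, arr u aE i j = e i j.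

Lemma ord_eqE i j : ((i : nat) == j) = (i == j).
Proof. by []. Qed.

Lemma bool_neq0 (b : bool) : (nat_of_bool b != 0) = b.
Proof. by case: b. Qed.

Lemma add_rep_spec u x D rp R :
  holds_set u D -> holds_reps u D rp -> holds_row u aR R -> env u vX = x ->
  let u' := eval n add_rep u in
  [/\ holds_set u' (x |: D),
      holds_reps u' (x |: D)
        (if x \in D then rp else fun y => if y == x then R else rp y),
      holds_row u' aR R &
      forall y : nat, y != vI -> env u' y = env u y].
Proof.
move=> hD hP hR hX u'; rewrite {}/u' /add_rep eval_if (ev_ld1 _ (i := x)) // hD bool_neq0.
case: (boolP (x \in D)) => xD.
  split=> //; first by move=> i; rewrite hD !inE; case: eqP => // ->; rewrite xD.
  by move=> y i; rewrite inE => /orP[/set1P->|]; apply: hP.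
rewrite eval_seq (eval_st1 _ _ (i := x)) // [ev _ _ _]/=.
set u1 := setc u aD 0 x 1.
have [|||||q1 q2 q3 q4] := @copy_row_spec n aRep (EVar vX) aR (ECst 0) u1 x 0 _ _ _ _ _.
- by [].
- exact: ltn_ord.
- exact: ord_pos x.
- by move=> u' /(_ vX isT) /= ->.
- by [].
split=> //.
- move=> i; rewrite q2 //= ord_eqE !inE; case: (i == x) => //=; exact: hD.
- move=> y i yD; case: (eqVneq y x) => [->|yx]; first by rewrite q1 /= hR.
  rewrite q2 ?ord_eqE ?yx //=; apply: hP.
  by move: yD; rewrite inE => /orP[/set1P E|//]; rewrite E eqxx in yx.
- by move=> i; rewrite q2 //= hR.
Qed.

Lemma store_rot u R x y : x != y -> R y != x ->
  holds_row u aR R ->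
  let u1 := setc (setc u aR 0 x y) aR 0 y x in
  holds_row (if R y == y then u1 else setc u1 aR 0 (R y) (R y)) aR (rot R x y).
Proof.
move=> xy Ryx hR u1 i; rewrite /rot.
case: (eqVneq (R y) y) => Ry; rewrite /= !ord_eqE /=.
  case: (eqVneq i y) => [->|iy]; first by rewrite eq_sym (negbTE xy).
  by case: (i == x) => //; rewrite Ry (negbTE iy).
case: (eqVneq i (R y)) => [->|ir]; first by rewrite (negbTE Ryx) (negbTE Ry).
case: (eqVneq i y) => [->|iy]; first by rewrite eq_sym (negbTE xy).
by case: (i == x).
Qed.

Lemma walk_step_spec u v w x y D rp R (D' := x |: D)
    (rp' := if x \in D then rp else fun z => if z == x then R else rp z) u' :
  holds_set u D -> holds_reps u D rp -> holds_row u aR R ->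
  env u vX = x -> env u vV = v -> env u vW = w -> w \in D ->
  env u vIn = 1 -> env u vGo = 1 -> env u vFound = 0 ->
  y = rp w x -> x != y -> R y != x -> u' = eval n walk_step u ->
  if y == v then
    [/\ env u' vGo = 0, env u' vFound = 0, holds_set u' D' & holds_reps u' D' rp']
  else if R y == y then
    [/\ env u' vGo = 0, env u' vFound = 1 & holds_row u' aR (rot R x y)]
  else
    [/\ env u' vGo = 1, env u' vFound = 0, env u' vX = R y &
     [/\ holds_set u' D', holds_reps u' D' rp' & holds_row u' aR (rot R x y)]].
Proof.
move=> hD hP hR hX hV hW wD hIn hGo hFound Ey xy Ryx.
have [] := add_rep_spec hD hP hR hX.
rewrite /walk_step eval_seq -/D' -/rp'.
set u1 := eval n add_rep u => q1 q2 q3 q4.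
have Nw : rp' w = rp w.
  by rewrite /rp'; case: ifP => // xD; case: eqP => // E; rewrite -E wD in xD.
have yE : ev n (ELd aRep (EVar vW) (EVar vX)) u1 = y.
  rewrite (ev_ld _ (i := w) (j := x)) /= ?q4 // q2 ?inE ?wD ?orbT //.
  by rewrite Ey Nw.
rewrite eval_ifT; last by rewrite /= q4 ?hIn.
rewrite eval_seq eval_asg yE => ->.
set u2 := setv u1 vY y.
have u2V : ev n (EVar vV) u2 = v by rewrite /= /upd /= q4.
have u2Y : ev n (EVar vY) u2 = y by [].
case: (eqVneq y v) => yv.
  rewrite eval_ifT ?eval_asg; last by rewrite ev_eq u2V u2Y yv.
  split=> //.
  by rewrite /= /upd /= q4.
rewrite eval_ifF; last by apply: ev_neq; rewrite u2V u2Y.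
rewrite eval_seq eval_asg (ev_ld1 _ (i := y)) //.
have -> : arr u2 aR 0 y = R y by rewrite q3.
set u3 := setv u2 vZ (R y).
have u3X : ev n (EVar vX) u3 = x by rewrite /= /upd /= q4.
rewrite 2!eval_seq (eval_st1 (b := EVar vX) _ _ (i := x)) // (eval_st1 _ _ (i := y)) //.
have -> : ev n (EVar vY) u3 = y by [].
have -> : ev n (EVar vX) (setc u3 aR 0 x y) = x := u3X.
set u4 := setc _ aR 0 y x.
have hrot : holds_row (if R y == y then u4 else setc u4 aR 0 (R y) (R y)) aR (rot R x y).
  exact: (store_rot xy Ryx (u := u3)).
have u4e z : env u4 z = env u3 z by [].
case: (eqVneq (R y) y) hrot => Ry hrot.
  rewrite eval_ifT ?eval_seq ?eval_asg; last by rewrite ev_eq /= /upd /= Ry.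
  by split.
rewrite eval_ifF; last by apply: ev_neq.
rewrite eval_seq (eval_st1 _ _ (i := R y)) // eval_asg.
split=> //; first by rewrite /= /upd /= q4.
  by rewrite /= /upd /= q4.
Qed.

Section ScanEdge.
Variables (e : rel T).
Hypotheses (e_sym : symmetric e) (e_irr : irreflexive e).

(** The walk halts in double step [k0], so the loop works for [k0.+1] iterations and then idles with
    [vGo] equal to 0. *)
Lemma walk_loop u M D rp O blk tau v w k0 (Q := rp v) (N := rp w) u' :
  search e M D rp O blk tau -> v \in D -> w \in D -> e v w -> Q w <> w ->
  k0 < n -> moving rp v w k0 -> Q (walk Q N w k0.*2.+2) = walk Q N w k0.*2.+2 ->
  env u vV = v -> env u vW = w -> env u vIn = 1 -> env u vGo = 1 -> env u vFound = 0 ->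
  env u vX = Q w ->
  holds_set u D -> holds_reps u D rp -> holds_row u aR (rot Q v w) ->
  u' = eval n (SFor vK (SIf (EVar vGo) walk_step SSkip)) u ->
  if walk Q N w k0.*2.+2 == v then
    [/\ env u' vFound = 0, holds_set u' (walkD Q N w D k0.+1) &
        holds_reps u' (walkD Q N w D k0.+1) (walkP Q N v w D rp k0.+1)]
  else env u' vFound = 1 /\ holds_row u' aR (walkR Q N v w k0.+1).
Proof.
move=> S vD wD evw Qw k0n mv stop hV hW hIn hGo hF hX hD hP hR ->.
pose c := walk Q N w.
pose P (i : nat) (u1 : ust) := [/\ env u1 vV = v, env u1 vW = w, env u1 vIn = 1 &
  if i <= k0 then [/\ env u1 vGo = 1, env u1 vFound = 0, env u1 vX = c i.*2.+1 &
    [/\ holds_set u1 (walkD Q N w D i),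
        holds_reps u1 (walkD Q N w D i) (walkP Q N v w D rp i) &
        holds_row u1 aR (walkR Q N v w i)]]
  else env u1 vGo = 0 /\ (if c k0.*2.+2 == v then
    [/\ env u1 vFound = 0, holds_set u1 (walkD Q N w D k0.+1) &
        holds_reps u1 (walkD Q N w D k0.+1) (walkP Q N v w D rp k0.+1)]
  else env u1 vFound = 1 /\ holds_row u1 aR (walkR Q N v w k0.+1))].
suff [_ _ _] : P n (eval n (SFor vK (SIf (EVar vGo) walk_step SSkip)) u).
  by rewrite leqNgt k0n => -[].
apply: for_ind; first by split.
move=> i u1 iN [p1 p2 p3 p4].
set u2 := setv u1 vK i.
have fr (y : nat) : y \notin vars_written (SIf (EVar vGo) walk_step SSkip) ->
    env (eval n (SIf (EVar vGo) walk_step SSkip) u2) y = env u2 y.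
  exact: eval_frame_env.
split; [by rewrite fr|by rewrite fr|by rewrite fr|].
case: (ltnP k0 i) => ik; last first.
  move: p4; rewrite ik => -[g1 g2 g3 [g4 g5 g6]].
  rewrite eval_ifT; last by rewrite /= /upd /= g1.
  have wDi : w \in walkD Q N w D i by apply/walkDP; left.
  have yE : c i.*2.+2 = walkP Q N v w D rp i w (c i.*2.+1).
    by rewrite /c walk_odd walkP_old.
  have [m1 m2 _ _] := walkR_spec e_sym e_irr S vD wD evw Qw mv ik.
  have xy : c i.*2.+1 != c i.*2.+2.
    by apply/eqP; apply: (walk_neq S vD wD evw Qw mv); lia.
  have Ryx : walkR Q N v w i (c i.*2.+2) != c i.*2.+1.
    apply: contra xy => /eqP E; apply/eqP.
    by apply: (inv_inj (proj1 m1)); rewrite E; exact: m2.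
  have := @walk_step_spec u2 v w (c i.*2.+1) (c i.*2.+2) _ _ _ _ g4 g5 g6 g3 p1 p2
    wDi p3 g1 g2 yE xy Ryx (erefl _).
  have RyQ : c i.*2.+2 <> v -> walkR Q N v w i (c i.*2.+2) = Q (c i.*2.+2).
    move=> yv; rewrite [LHS](walkR_next e_sym e_irr S vD wD evw Qw mv) //.
    exact: (walk_even Q N w i.+1).
  move: ik; rewrite leq_eqVlt => /orP[/eqP ik|ik].
    subst i; rewrite ltnn; case: eqVneq RyQ => yv RyQ.
      by case=> s1 s2 s3 s4.
    by rewrite (RyQ (elimN eqP yv)) (introT eqP stop) => -[s1 s2 s3].
  have yv : c i.*2.+2 <> v by apply: (walk_v e_irr S vD wD evw Qw mv); lia.
  rewrite ik (introF eqP yv) (RyQ yv) (introF eqP (mv i ik)).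
  case=> s1 s2 s3 [s4 s5 s6]; split=> //; rewrite s3; congr nat_of_ord.
  by rewrite [RHS](walk_even Q N w i.+1).
move: p4; rewrite leqNgt ik => -[g1 g2].
rewrite eval_ifF; last by rewrite /= /upd /= g1.
by rewrite leqNgt ltnS (ltnW ik).
Qed.

Lemma grow_loop u D rp R x u' :
  env u vIn = 0 -> env u vGo = 1 -> env u vFound = 0 -> env u vX = x ->
  holds_set u D -> holds_reps u D rp -> holds_row u aR R ->
  u' = eval n (SFor vK (SIf (EVar vGo) walk_step SSkip)) u ->
  [/\ env u' vFound = 0, holds_set u' (x |: D) & holds_reps u' (x |: D)
    (if x \in D then rp else fun z => if z == x then R else rp z)].
Proof.
move=> hIn hGo hF hX hD hP hR ->.
set rp' := if _ then _ else _.
pose P (i : nat) (u1 : ust) := if i == 0 then u1 = u else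
  [/\ env u1 vGo = 0, env u1 vFound = 0, holds_set u1 (x |: D) & holds_reps u1 (x |: D) rp'].
suff : P n (eval n (SFor vK (SIf (EVar vGo) walk_step SSkip)) u).
  by rewrite /P gtn_eqF ?(ord_pos x) // => -[].
apply: for_ind => // -[|i] u1 iN; last first.
  by case=> g1 g2 g3 g4; rewrite eval_ifF.
move=> ->; rewrite eval_ifT; last by rewrite /= /upd /= hGo.
rewrite eval_seq.
have [q1 q2 q3 q4] := @add_rep_spec (setv u vK 0) x D rp R hD hP hR hX.
rewrite eval_ifF; last by rewrite /= q4 //= /upd /= hIn.
by rewrite eval_asg; split=> //; rewrite /= /upd /= q4.
Qed.

(** The last clause is what eventually closes the search: an edge whose scan adds no vertex leads
    into [O] or stays in one blossom, and the invariant holds again with the same ghost data. *)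
Lemma scan_edge_spec u M D rp O blk tau v w u' :
  search e M D rp O blk tau -> v \in D -> e v w ->
  env u vV = v -> env u vW = w -> env u vFound = 0 ->
  holds_set u D -> holds_reps u D rp -> holds_row u aM M ->
  u' = eval n scan_edge u ->
  (env u' vFound = 1 /\ exists M', [/\ matching e M', #|fixs M'| < #|fixs M| &
     holds_row u' aM M']) \/
  (env u' vFound = 0 /\ holds_row u' aM M /\ exists D' rp',
     [/\ holds_set u' D', holds_reps u' D' rp', D \subset D',
         exists O' blk' tau', search e M D' rp' O' blk' tau' &
         D' = D -> search e M D rp' O blk tau /\
                   (w \in O \/ (w \in D /\ blk v = blk w))]).
Proof.
move=> S vD evw hV hW hF hD hP hM; rewrite /scan_edge eval_seq.
have vw : v != w by rewrite (edge_neq e_irr evw).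
set Q := rp v; have QK : involutive Q := rpK S vD.
have Qv : Q v = v := s_miss S vD.
have [|||||r1 r2 r3 _] := @copy_row_spec n aR (ECst 0) aRep (EVar vV) u 0 v.
- by [].
- exact: ord_pos v.
- exact: ltn_ord.
- by [].
- by move=> u1 /(_ vV isT) /= ->.
set u1 := eval n (copy_row _ _ _ _) u in r1 r2 r3 *.
have hR1 : holds_row u1 aR Q by move=> i; rewrite r1 hP.
rewrite eval_seq eval_asg (ev_ld1 _ (i := w)); last by rewrite /= r3.
rewrite hR1; set u2 := setv u1 vX (Q w).
have u2V : ev n (EVar vV) u2 = v by rewrite /= /upd /= r3.
have u2W : ev n (EVar vW) u2 = w by rewrite /= /upd /= r3.
rewrite eval_seq (eval_st1 _ _ u2V) u2W.
rewrite eval_seq (eval_st1 _ _ (u2W : ev n (EVar vW) (setc u2 aR 0 v w) = w)).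
have -> : ev n (EVar vV) (setc u2 aR 0 v w) = v := u2V.
have Qwv : Q w != v by apply: contraNneq vw => E; rewrite -Qv -E QK.
set u3 := setc (setc u2 _ _ _ _) _ _ _ _.
have hrot : holds_row (if Q w == w then u3 else setc u3 aR 0 (Q w) (Q w)) aR (rot Q v w).
  exact: (store_rot vw Qwv (u := u2)).
have u3X : ev n (EVar vX) u3 = Q w by [].
have u3W : ev n (EVar vW) u3 = w := u2W.
rewrite eval_seq.
have frM s (x : ust) : aM \notin arrs_written s -> arr (eval n s x) aM = arr x aM.
  exact: eval_frame_arr.
have M3 : holds_row u3 aM M by move=> i; rewrite /= r2.
have D3 : holds_set u3 D by move=> i; rewrite /= r2.
have P3 : holds_reps u3 D rp by move=> x i xD; rewrite /= r2 ?hP.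
have final u4 R : env u4 vFound = 1 -> holds_row u4 aR R ->
    env (eval n (SIf (EVar vFound) (copy_row aM (ECst 0) aR (ECst 0)) SSkip) u4) vFound = 1 /\
    holds_row (eval n (SIf (EVar vFound) (copy_row aM (ECst 0) aR (ECst 0)) SSkip) u4) aM R.
  move=> f4 R4; rewrite eval_ifT; last by rewrite /= f4.
  have [|||||z1 z2 z3 _] := @copy_row_spec n aM (ECst 0) aR (ECst 0) u4 0 0; try by [].
  - exact: ord_pos v.
  - exact: ord_pos v.
  by rewrite z3 // f4; split=> // i; rewrite z1 R4.
have [Qw|Qw] := eqVneq (Q w) w.
  rewrite Qw eqxx in hrot; rewrite (eval_ifT (a := EEq (EVar vX) (EVar vW)));
    last by rewrite ev_eq u3X u3W Qw.
  rewrite eval_asg => ->; left.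
  have [] := @final (setv u3 vFound (ev n (ECst 1) u3)) (rot Q v w) (erefl _) hrot.
  split=> //; exists (rot Q v w); split=> //.
    by apply: rot_matching => //; apply: (s_mat S).
  by rewrite -(s_card S vD); apply: rot_card_lt => //; apply: (s_mat S).
rewrite (negbTE Qw) in hrot; rewrite (eval_ifF (a := EEq (EVar vX) (EVar vW)));
  last by apply: ev_neq; rewrite u3X u3W.
rewrite eval_seq (eval_st1 _ _ u3X) u3X; set u4 := setc u3 aR 0 (Q w) (Q w) in hrot *.
rewrite eval_seq eval_asg [ev n (ECst 1) _]/=; set u5 := setv u4 vGo 1.
rewrite eval_seq eval_asg (ev_ld1 _ (i := w)) //.
have -> : arr u5 aD 0 w = (w \in D) by apply: D3.
set u6 := setv u5 vIn (w \in D).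
have R6 : holds_row u6 aR (rot Q v w) := hrot.
have V6 : env u6 vV = v := u2V.
have W6 : env u6 vW = w := u2W.
have F6 : env u6 vFound = 0 by rewrite /= /upd /= r3.
have D6 : holds_set u6 D by move=> i; apply: D3.
have P6 : holds_reps u6 D rp by move=> x i; apply: P3.
set loop := SFor vK _.
have M7 : holds_row (eval n loop u6) aM M by move=> i; rewrite frM //; apply: M3.
have [wD|wD] := boolP (w \in D).
  have Qw' : Q w <> w by apply/eqP.
  have [k0 [k0n mv stop]] := walk_stops S vD wD evw Qw'.
  rewrite card_ord in k0n.
  have := walk_loop S vD wD evw Qw' k0n mv stop V6 W6 _ (erefl _) F6 (erefl _) D6 P6 R6
    (erefl (eval n loop u6)).
  rewrite {1}/u6 wD => /(_ (erefl _)).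
  set u7 := eval n loop u6 in M7 *.
  case: eqVneq => [yv [g1 g2 g3]|yv [g1 g2]] ->.
    right; rewrite eval_ifF; last by rewrite /= g1.
    split=> //; split=> //.
    exists (walkD Q (rp w) w D k0.+1), (walkP Q (rp w) v w D rp k0.+1).
    have [b1 [O' [blk' b2]]] := walk_blossom e_sym e_irr S vD wD evw Qw' mv yv.
    split=> //.
    - by apply/subsetP => x xD; apply/walkDP; left.
    - by exists O', blk', tau.
    move=> E; split; last by right; split=> //; apply: b1.
    rewrite E in b2; by apply: (search_ext S) => x; apply: walkP_old.
  left; have [f1 f2] := final u7 _ g1 g2; split=> //.
  have [c1 c2] := walk_augment e_sym e_irr S vD wD evw Qw' mv stop (elimN eqP yv).
  by exists (walkR Q (rp w) v w k0.+1).
have In6 : env u6 vIn = 0 by rewrite /u6 (negbTE wD).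
have := grow_loop In6 (erefl : env u6 vGo = 1) F6 (erefl : env u6 vX = Q w) D6 P6 R6
  (erefl (eval n loop u6)).
set u7 := eval n loop u6 in M7 *; case=> g1 g2 g3 ->; right.
rewrite eval_ifF; last by rewrite /= g1.
split=> //; split=> //; exists (Q w |: D); eexists; split; [exact: g2|exact: g3| | |].
- by apply/subsetP => x xD; rewrite inE xD orbT.
- case: (boolP (Q w \in D)) => xD.
    by exists O, blk, tau; rewrite (setUidPr _) ?sub1set.
  have [rpD rpx] : (forall y, y \in D -> (fun z => if z == Q w then rot Q v w else rp z) y = rp y)
      /\ (fun z => if z == Q w then rot Q v w else rp z) (Q w) = rot Q v w.
    split=> [y yD|]; last by rewrite eqxx.
    by case: eqP => // E; rewrite -E yD in xD.
  by eexists _, _, _; apply: (grow_search e_sym e_irr S vD wD evw xD rpD rpx).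
(* If the partner [Q w] was reachable already, [w] belongs to the forest by [s_in]; not being in
   [D], it is in [O]. *)
move=> E; have xD : Q w \in D by rewrite -E setU11.
rewrite xD; split=> //; left.
have : w \in D :|: O by rewrite -(QK w); apply: (s_in S) => //; rewrite inE xD.
by rewrite inE (negbTE wD).
Qed.

End ScanEdge.
End MatchingProgram.

(** * Rounds, phases and the maximum matching *)

Section MatchingSpec.
Variable n : nat.
Notation T := 'I_n.
Variable e : rel T.
Hypotheses (e_sym : symmetric e) (e_irr : irreflexive e).

Section Phase.
Variable M : T -> T.
Hypothesis mM : matching e M.

Definition augmented (u : ust) : Prop := env u vFound = 1 /\
  exists M', [/\ matching e M', #|fixs M'| < #|fixs M| & holds_row u aM M'].

Definition running (u : ust) (D : {set T}) (rp : T -> T -> T) : Prop :=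
  [/\ env u vFound = 0, holds_set u D, holds_reps u D rp & holds_row u aM M].

Definition explored (D O : {set T}) (blk : T -> T) (v w : T) : Prop :=
  v \in D -> e v w -> w \in O \/ (w \in D /\ blk v = blk w).

Definition scan_if : stm :=
  SIf (EVar vFound) SSkip
   (SIf (ELd1 aD (EVar vV)) (SIf (ELd aE (EVar vV) (EVar vW)) scan_edge SSkip) SSkip).

(** The state in the middle of a round that started with [D0] and the ghost
    data [O0], [blk0], [tau0], the edges in [seen] having been scanned. *)
Definition mid_round (D0 O0 : {set T}) (blk0 tau0 : T -> T) (seen : nat -> nat -> Prop) (u : ust) : Prop :=
  augmented u \/ exists D rp, [/\ running u D rp, D0 \subset D,
    exists O blk tau, search e M D rp O blk tau &
    D = D0 -> search e M D rp O0 blk0 tau0 /\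
      forall v w : T, seen v w -> explored D0 O0 blk0 v w].

Lemma scan_if_spec (D0 O0 : {set T}) (blk0 tau0 : T -> T) (seen seen' : nat -> nat -> Prop) u (v w : T) :
  holds_rel u e -> env u vV = v -> env u vW = w ->
  (forall a b : T, seen' a b -> seen a b \/ (a = v /\ b = w)) ->
  mid_round D0 O0 blk0 tau0 seen u ->
  mid_round D0 O0 blk0 tau0 seen' (eval n scan_if u).
Proof.
move=> hE hV hW hs [[f aug]|[D [rp [[f hD hP hM] D0D gh st]]]].
  by left; rewrite /scan_if eval_ifT; [split|rewrite /= f].
rewrite /scan_if eval_ifF //.
have nop : explored D0 O0 blk0 v w \/ D <> D0 ->
    mid_round D0 O0 blk0 tau0 seen' u.
  move=> vw; right; exists D, rp; split=> // E; have [s1 s2] := st E; split=> // a b.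
  by case/hs => [|[-> ->]]; [exact: s2|case: vw].
have evD : ev n (ELd1 aD (EVar vV)) u = (v \in D) by rewrite (ev_ld1 _ (i := v)).
have [vD|vD] := boolP (v \in D); last first.
  rewrite eval_ifF ?evD ?(negbTE vD) //; apply: nop.
  have [E|/eqP ne] := eqVneq D D0; [left|by right].
  by rewrite /explored -E (negbTE vD).
rewrite eval_ifT ?evD ?vD //.
have evE : ev n (ELd aE (EVar vV) (EVar vW)) u = e v w.
  by rewrite (ev_ld _ (i := v) (j := w)).
have [evw|evw] := boolP (e v w); last first.
  rewrite eval_ifF ?evE ?(negbTE evw) //; apply: nop; left.
  by rewrite /explored (negbTE evw).
rewrite eval_ifT ?evE ?evw //.
have step O blk tau : search e M D rp O blk tau -> (D = D0 -> O = O0 /\ blk = blk0 /\ tau = tau0) ->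
    mid_round D0 O0 blk0 tau0 seen' (eval n scan_edge u).
  move=> S same.
  have [//|[f' [hM' [D' [rp' [hD' hP' DD' gh' st']]]]]] :=
    scan_edge_spec e_sym e_irr S vD evw hV hW f hD hP hM (erefl _); first by left.
  right; exists D', rp'; split=> //; first exact: subset_trans DD'.
  move=> E; have ED : D = D0 by apply/eqP; rewrite eqEsubset D0D -E DD'.
  have ED' : D' = D by rewrite E.
  have [EO [Eb Et]] := same ED; have [s1 s2] := st' ED'.
  rewrite EO Eb Et in s1 s2; split; first by rewrite E -ED.
  move=> a b /hs[ab|[-> ->]]; first by have [_] := st ED; apply.
  by move=> _ _; rewrite -ED.
have [E|/eqP ne] := eqVneq D D0.
  by have [S _] := st E; apply: step S _.
by have [O [blk [tau S]]] := gh; apply: step S _.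
Qed.

(** As long as [D] does not change, the ghost data remain those of the start of the round, so the
    explored pairs accumulate with respect to one and the same forest. Pairs are visited in
    lexicographic order. *)
Lemma round_spec D0 rp0 O0 blk0 tau0 u :
  holds_rel u e -> search e M D0 rp0 O0 blk0 tau0 -> running u D0 rp0 ->
  mid_round D0 O0 blk0 tau0 (fun _ _ => True)
    (eval n (SFor vV (SFor vW scan_if)) u).
Proof.
move=> hE S run.
pose done i k (a b : nat) := a < i \/ (a = i /\ b < k).
pose P i u1 := holds_rel u1 e /\ mid_round D0 O0 blk0 tau0 (done i 0) u1.
suff [_ [aug|[D [rp [r1 r2 r3 r4]]]]] : P n (eval n (SFor vV (SFor vW scan_if)) u).
- by left.
- right; exists D, rp; split=> // /r4[s1 s2]; split=> // v w _; apply: s2.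
  by left; apply: ltn_ord.
apply: for_ind.
  split=> //; right; exists D0, rp0; split=> //; first by exists O0, blk0, tau0.
  by move=> _; split=> // v w [|[]].
move=> i u1 iN [hE1 mid1].
pose P' k u2 := [/\ holds_rel u2 e, env u2 vV = i & mid_round D0 O0 blk0 tau0 (done i k) u2].
have [p1 p2 p3] : P' n (eval n (SFor vW scan_if) (setv u1 vV i)).
  apply: for_ind; first by split.
  move=> k u2 kN [hE2 i2 mid2].
  have hE3 : holds_rel (eval n scan_if (setv u2 vW k)) e.
    by move=> a b; rewrite eval_frame_arr //; apply: hE2.
  split=> //; first by rewrite eval_frame_env.
  apply: (@scan_if_spec _ _ _ _ (done i k) _ _ (Ordinal iN) (Ordinal kN)) => //.
  move=> a b [ai|[ai]]; first by left; left.
  rewrite ltnS leq_eqVlt => /orP[/eqP bk|bk]; last by left; right.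
  by right; split; apply: val_inj.
split=> //; case: p3 => [aug|[D [rp [r1 r2 r3 r4]]]]; first by left.
right; exists D, rp; split=> // /r4[s1 s2]; split=> // v w [vi|[]//]; apply: s2.
move: vi; rewrite ltnS leq_eqVlt => /orP[/eqP vi|vi]; last by left.
by right; rewrite vi.
Qed.

Lemma phase_init u : holds_row u aM M ->
  running (eval n (SFor vV (copy_row aRep (EVar vV) aM (ECst 0)))
    (eval n (SFor vI (SSt1 aD (EVar vI) (EEq (ELd1 aM (EVar vI)) (EVar vI))))
      (eval n (SAsg vFound (ECst 0)) u))) (fixs M) (fun=> M).
Proof.
move=> hM; set u1 := eval n (SAsg _ _) u.
set sD := SFor vI _; set u2 := eval n sD u1.
have hM2 : holds_row u2 aM M by move=> i; rewrite eval_frame_arr //; apply: hM.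
have hD2 : holds_set u2 (fixs M).
  pose P i (u' : ust) := holds_row u' aM M /\
    forall j : T, j < i -> arr u' aD 0 j = (j \in fixs M).
  suff [_ h] : P n u2 by move=> j; apply: h.
  apply: for_ind => // i u' iN [q1 q2]; set i' := Ordinal iN.
  rewrite (eval_st1 _ _ (i := i')) //; set a := ev n _ _; split=> // j.
  rewrite ltnS leq_eqVlt /= => /orP[/eqP ji|ji]; last first.
    by rewrite ltn_eqF //=; apply: q2.
  rewrite ji eqxx /a /= iN (ord_pos i') /=.
  have := q1 i'; rewrite /= => ->; have -> : j = i' by apply: val_inj.
  rewrite inE; have [->|/eqP ne] := eqVneq (M i') i'; first by rewrite /= !subnn.
  have ne' : nat_of_ord (M i') <> i by move=> E; apply: ne; apply: val_inj.
  by rewrite [RHS]/= /upd eqxx; lia.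
set u3 := eval n _ u2.
pose P i (u' : ust) := [/\ holds_row u' aM M, holds_set u' (fixs M), env u' vFound = 0 &
  forall (x j : T), x < i -> arr u' aRep x j = M j].
suff [q1 q2 q3 q4] : P n u3 by split=> // x j _; apply: q4.
apply: for_ind; first by split=> //; rewrite eval_frame_env.
move=> i u' iN [q1 q2 q3 q4].
have [|||||r1 r2 r3 _] := @copy_row_spec n aRep (EVar vV) aM (ECst 0) (setv u' vV i) i 0; try by [].
- exact: leq_ltn_trans iN.
- by move=> u'' /(_ vV isT) /= ->.
split.
- by move=> j; rewrite r2 //; apply: q1.
- by move=> j; rewrite r2 //; apply: q2.
- by rewrite r3.
move=> x j; rewrite ltnS leq_eqVlt => /orP[/eqP ->|xi]; first by rewrite r1; apply: q1.
by rewrite r2 ?(ltn_eqF xi) ?orbT //; apply: q4.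
Qed.

(** Without an augmentation, after [j] rounds either [D] has more than [j] elements or a certificate
    is at hand, from an empty start or from a round that left [D] unchanged. After [n] rounds only
    the certificate is possible. *)
Lemma phase_spec u u' : holds_rel u e -> holds_row u aM M ->
  u' = eval n match_phase u ->
  (exists M', [/\ matching e M', #|fixs M'| < #|fixs M| & holds_row u' aM M']) \/
  (holds_row u' aM M /\ certificate e M).
Proof.
move=> hE hM ->; rewrite /match_phase 3!eval_seq -/scan_if.
set u1 := eval n (SFor vV (copy_row _ _ _ _)) _.
have run : running u1 (fixs M) (fun=> M) := phase_init hM.
have hE1 : holds_rel u1 e by move=> i j; rewrite !eval_frame_arr //; apply: hE.
pose P j u2 := holds_rel u2 e /\ (augmented u2 \/ exists D rp O blk tau,
  [/\ running u2 D rp, search e M D rp O blk tau & certificate e M \/ j < #|D|]).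
have [_ ] : P n (eval n (SFor vRound (SFor vV (SFor vW scan_if))) u1); last first.
  case=> [[_ aug]|[D [rp [O [blk [tau [[_ _ _ r] S [c|]]]]]]]].
  - by left.
  - by right.
  by rewrite ltnNge (leq_trans (max_card _)) ?card_ord.
apply: for_ind.
  split=> //; right; exists (fixs M), (fun=> M), set0, id, id.
  have S := search0 mM; split=> //.
  case: (set_0Vmem (fixs M)) => [F0|[x xF]]; [left|right; by apply/card_gt0P; exists x].
  by apply: (closed_certificate S) => v w; rewrite F0 inE.
move=> j u2 jN [hE2 H].
split; first by move=> a b; rewrite eval_frame_arr //; apply: hE2.
case: H => [[f aug]|[D [rp [O [blk [tau [run2 S c]]]]]]].
  pose A u3 := augmented u3.
  left; apply: (@for_ind n vV _ _ (fun _ => A)) => // i u3 _ a3.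
  apply: (@for_ind n vW _ _ (fun _ => A)) => // k u4 _ a4.
  by rewrite /scan_if eval_ifT //=; case: a4 => f4 _; rewrite /= /upd /= f4.
have [aug|[D' [rp' [r1 r2 [O' [blk' [tau' r3]]] r4]]]] :=
  round_spec (u := setv u2 vRound j) hE2 S run2; first by left.
right; exists D', rp', O', blk', tau'; split=> //.
case: c => [c|c]; first by left.
have [E|ne] := eqVneq D' D.
  by left; have [S' ok] := r4 E; apply: (closed_certificate S) => v w; apply: ok.
by right; apply: leq_ltn_trans c _; apply: proper_card; rewrite properEneq eq_sym ne.
Qed.

End Phase.

(** A phase that yields no certificate lowers the number of exposed vertices. If this happens in all
    [n] phases nothing is exposed, and the empty witness certifies the matching. *)
Theorem max_matching_spec u u' : holds_rel u e -> u' = eval n max_matching u ->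
  exists M, [/\ matching e M, certificate e M & holds_row u' aM M].
Proof.
move=> hE ->; rewrite /max_matching eval_seq.
set u1 := eval n (SFor vI _) u.
have hM1 : holds_row u1 aM (id : T -> T).
  pose P i (u2 : ust) := forall j : T, j < i -> arr u2 aM 0 j = j.
  suff h : P n u1 by move=> j; apply: h.
  apply: for_ind => // i u2 iN q j; rewrite (eval_st1 _ _ (i := Ordinal iN)) //.
  rewrite ltnS leq_eqVlt => /orP[/eqP ji|ji] /=; first by rewrite ji eqxx.
  by rewrite ltn_eqF //=; apply: q.
have hE1 : holds_rel u1 e by move=> i j; rewrite eval_frame_arr //; apply: hE.
pose P j u2 := holds_rel u2 e /\ exists M, [/\ matching e M, holds_row u2 aM M &
  certificate e M \/ #|fixs M| + j <= n].
have [_ [M [m h [c|]]]] : P n (eval n (SFor vPhase match_phase) u1).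
- apply: for_ind.
    split=> //; exists id; split=> //; first by split=> // x; rewrite eqxx.
    by right; rewrite addn0 -[X in _ <= X]card_ord max_card.
  move=> j u2 jN [hE2 [M [m h c]]].
  split; first by move=> a b; rewrite eval_frame_arr //; apply: hE2.
  have [[M' [m' lt h']]|[h' c']] :=
    phase_spec m (u := setv u2 vPhase j) hE2 h (erefl _); last first.
    by exists M; split=> //; left.
  exists M'; split=> //; right; case: c => [c|c]; last by lia.
  (* A certificate for [M] excludes the larger matching [M']. *)
  by have := certificate_max c m'; lia.
- by exists M.
rewrite addnC -[X in _ <= X]addn0 leq_add2l leqn0 cards_eq0 => /eqP F0.
exists M; split=> //; exists set0, set0; split; rewrite ?F0 ?cards0 //.
- by apply/trivIsetP => B B'; rewrite inE.
- by move=> B; rewrite inE.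
- by move=> B; rewrite inE.
- by move=> B v w; rewrite inE.
Qed.

End MatchingSpec.

(** * Bounding the optimum *)

Section Charging.
Variables (n : nat) (G : graph12 n).
Notation T := 'I_n.

(** Weights of sets other than edges are arbitrary, hence the condition [x != y]. *)
Definition good (x y : T) : bool := (x != y) && (G [set x; y] == 2).

Lemma good_sym : symmetric good.
Proof. by move=> x y; rewrite /good eq_sym setUC. Qed.

Lemma good_irr : irreflexive good.
Proof. by move=> x; rewrite /good eqxx. Qed.

Lemma weight_good (x y : T) : x != y -> G [set x; y] = 1 + good x y.
Proof.
move=> xy; rewrite /good xy /=.
by case: (@weight12 _ G [set x; y]) => [|->|->] //; rewrite cards2 xy.
Qed.

Lemma cover_cycle4 (a b c d : T) : cover (cycle4 a b c d) = [set a; b; c; d].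
Proof.
apply/setP => x; apply/bigcupP/idP => [[E]|].
  by rewrite !inE => /orP[/orP[/orP[]|]|] /eqP ->; rewrite !inE => /orP[] ->; rewrite ?orbT.
rewrite !inE => /orP[/orP[/orP[]|]|] /eqP ->.
- by exists [set a; b]; rewrite !inE eqxx.
- by exists [set b; c]; rewrite !inE eqxx ?orbT.
- by exists [set c; d]; rewrite !inE eqxx ?orbT.
- by exists [set d; a]; rewrite !inE eqxx ?orbT.
Qed.

Lemma edges_weight_cycle4 (a b c d : T) : uniq [:: a; b; c; d] ->
  edges_weight G (cycle4 a b c d) = 4 + (good a b + good b c + good c d + good d a).
Proof.
rewrite /= !inE !negb_or => /and4P[/and3P[ab ac ad] /andP[bc bd] cd _].
have ne (x y z t : T) : x != z -> x != t -> ([set x; y] != [set z; t]).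
  by move=> xz xt; apply/negP => /eqP/setP/(_ x); rewrite !inE eqxx (negbTE xz) (negbTE xt).
have n1 : [set a; b] != [set b; c] by apply: ne.
have n2 : [set a; b] != [set c; d] by apply: ne.
have n3 : [set a; b] != [set d; a] by rewrite setUC ne // eq_sym.
have n4 : [set b; c] != [set c; d] by apply: ne.
have n5 : [set b; c] != [set d; a] by apply: ne; rewrite // eq_sym.
have n6 : [set c; d] != [set d; a] by apply: ne; rewrite // eq_sym.
have da : d != a by rewrite eq_sym.
rewrite /edges_weight /cycle4 -!setUA !big_setU1 ?big_set1 ?inE ?negb_or ?n1 ?n2 ?n3 ?n4 ?n5 //=.
rewrite (weight_good ab) (weight_good bc) (weight_good cd) (weight_good da).
by move: (good a b : nat) (good b c : nat) (good c d : nat) (good d a : nat) => p q r s; clear; lia.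
Qed.

Section Family.
(** In the application [h B] consists of the vertices of the pairs in an odd block [B] of the
    witness for [M1], and [S] of those of the pairs in its set [O]. *)
Variables (I : finType) (P : {set I}) (h : I -> {set T}) (S : {set T}).
Hypotheses
  (h_inj : forall B B' x, B \in P -> B' \in P -> x \in h B -> x \in h B' -> B = B')
  (hS : forall B x, B \in P -> x \in h B -> x \in S -> False)
  (h_closed : forall B u v, B \in P -> u \in h B -> good u v -> v \notin h B -> v \in S).

(** A vertex set of size 2 modulo 4 is split among the cycles of a packing into parts of
    size at most 4, whose demands add up to at least 2. *)
Definition demand (k : nat) : nat := if k == 2 then 2 else odd k : nat.

Lemma demand_le k : demand k <= k.
Proof. by case: k => [|[|[|k]]] //=; rewrite /demand /=; case: (odd k). Qed.

(** Total demand 0 allows only parts of size 0 or 4, and total demand 1 exactly one odd part besides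
    these; neither sum is 2 modulo 4. *)
Lemma demand_sum (J : finType) (A : {set J}) (k : J -> nat) :
  (forall j, j \in A -> k j <= 4) -> (\sum_(j in A) k j) %% 4 = 2 ->
  2 <= \sum_(j in A) demand (k j).
Proof.
move=> k4.
have : (\sum_(j in A) demand (k j) = 0 -> (\sum_(j in A) k j) %% 4 = 0) /\
       (\sum_(j in A) demand (k j) = 1 -> odd (\sum_(j in A) k j)).
  elim/big_rec2: _ => [//|j a b jA [h0 h1]].
  have := k4 j jA; move: (k j) => [|[|[|[|[|//]]]]] _; rewrite /demand /=; lia.
by case: (\sum_(j in A) demand _) => [|[|//]] [h0 h1]; lia.
Qed.

Lemma card_setI_sum (V X : {set T}) : #|V :&: X| = \sum_(x in V) (x \in X).
Proof.
rewrite -sum1_card (eq_bigl (fun x => (x \in V) && (x \in X))); last by move=> x; rewrite inE.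
by rewrite big_mkcondr /=; apply: eq_bigr => x _; case: (x \in X).
Qed.

Lemma family_count (V : {set T}) :
  \sum_(B in P) #|V :&: h B| + #|V :&: S| <= #|V|.
Proof.
rewrite (eq_bigr (fun B => \sum_(x in V) (x \in h B))); last by move=> B _; apply: card_setI_sum.
rewrite exchange_big card_setI_sum -big_split -sum1_card /=; apply: leq_sum => x xV.
have [/existsP[B /andP[BP xB]]|/existsPn no] := boolP [exists B in P, x \in h B].
  rewrite (bigD1 B) //= xB big1; last first.
    move=> B' /andP[B'P ne]; case: (boolP (x \in h B')) => // xB'.
    by rewrite (h_inj B'P BP xB' xB) eqxx in ne.
  by case: (boolP (x \in S)) => // xS; case: (hS BP xB xS).
rewrite big1 ?add0n ?leq_b1 // => B BP; move: (no B).
by rewrite BP /= => /negbTE ->.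
Qed.

Notation rho V := (\sum_(B in P) demand #|V :&: h B|).

(** One block keeps its exact demand, while every other block is bounded by its size. *)
Lemma rho_le (V : {set T}) B : B \in P ->
  rho V + #|V :&: h B| + #|V :&: S| <= #|V| + demand #|V :&: h B|.
Proof.
move=> BP; have F := family_count V; rewrite (bigD1 B BP) /= in F.
rewrite (bigD1 B BP) /=.
have L : \sum_(j in P | j != B) demand #|V :&: h j| <= \sum_(j in P | j != B) #|V :&: h j|.
  by apply: leq_sum => j _; apply: demand_le.
move: (demand _) (\sum_(j in P | _) _) (\sum_(j in P | _) _) L F => x y z L F; lia.
Qed.

Lemma rho_le_card (V : {set T}) : rho V + #|V :&: S| <= #|V|.
Proof.
apply: leq_trans (family_count V); rewrite leq_add2r; apply: leq_sum => B _.
exact: demand_le.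
Qed.

Lemma set4_count (a b c d : T) (X : {set T}) : uniq [:: a; b; c; d] ->
  #|[set a; b; c; d] :&: X| = (a \in X) + (b \in X) + (c \in X) + (d \in X).
Proof.
rewrite /= !inE !negb_or => /and4P[/and3P[ab ac ad] /andP[bc bd] cd _].
rewrite card_setI_sum -!setUA !big_setU1 ?big_set1 ?inE ?negb_or ?ab ?ac ?ad ?bc ?bd ?cd //=.
by rewrite !addnA.
Qed.

Lemma set4_card (a b c d : T) : uniq [:: a; b; c; d] -> #|[set a; b; c; d]| = 4.
Proof.
by move=> u4; have := set4_count setT u4; rewrite setIT !inE.
Qed.

Lemma step_in B u v : B \in P -> u \in h B -> good u v -> (v \in h B) || (v \in S).
Proof.
move=> BP uB uv; case: (boolP (v \in h B)) => //= vB.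
exact: h_closed BP uB uv vB.
Qed.

(** If [V] meets [S], disjointness suffices. Otherwise no good edge inside [V] leaves a block: if
    [b] is in a block, so are [a] and [c], and three or four vertices of one block demand at most 1;
    if [b] is in no block, only three vertices can demand anything. *)
Lemma rho_path (a b c d : T) (V := [set a; b; c; d]) : uniq [:: a; b; c; d] ->
  good a b -> good b c -> rho V <= 3 + #|V :&: S|.
Proof.
have aux0 r s : r + s <= 4 -> 0 < s -> r <= 3 + s by clear; lia.
have aux1 (x y z t : bool) : 0 = x + y + z + t -> x = false /\ z = false.
  by clear; case: x; case: z; lia.
have aux2 (t : bool) r s : r + (true + true + true + t) + 0 <= 4 + demand (true + true + true + t) ->
    r <= 3 + s by clear; case: t; rewrite /demand /=; lia.
have aux3 m r s t : 4 = true + m -> r + s <= m -> r <= 3 + t by clear; lia.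
move=> u4 gab gbc; have c4 := set4_card u4; have cS := set4_count S u4.
have le := rho_le_card V; rewrite c4 in le.
case: (posnP #|V :&: S|) => [s0|]; last exact: aux0 le.
have [/existsP[B /andP[BP bB]]|/existsPn no] := boolP [exists B in P, b \in h B].
  have sa := step_in BP bB (etrans (good_sym b a) gab).
  have sc := step_in BP bB gbc.
  have := rho_le V BP; rewrite c4 s0; have := set4_count (h B) u4; rewrite -/V bB => ->.
  rewrite -/V s0 in cS; have [aS cS'] := aux1 _ _ _ _ cS.
  by rewrite aS cS' !orbF in sa sc; rewrite sa sc; apply: aux2.
have -> : rho V = rho (V :\ b).
  apply: eq_bigr => B BP; congr (demand #|pred_of_set _|).
  have bB : (b \in h B) = false by move: (no B); rewrite BP => /negbTE.
  by apply/setP => x; rewrite !in_setI in_setD1; case: (eqVneq x b) => [->|]; rewrite ?bB ?andbF.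
have Lb := rho_le_card (V :\ b); have Cb := cardsD1 b V.
have bV : b \in V by rewrite !inE eqxx ?orbT.
by rewrite c4 bV in Cb; apply: aux3 Cb Lb.
Qed.

(** With two vertices in [S], counting suffices. With at most one, the rest of the cycle is
    connected by good edges, so a block meeting [V] contains all of [V] outside [S]; four vertices
    demand 0 and three demand 1. *)
Lemma rho_cycle (a b c d : T) (V := [set a; b; c; d]) : uniq [:: a; b; c; d] ->
  good a b -> good b c -> good c d -> good d a -> rho V <= #|V :&: S|.
Proof.
have aux0 r s : r + s <= 4 -> 2 <= s -> r <= s by clear; lia.
have aux1 r k s : r + k + s <= 4 + demand k -> k + s = 4 -> s < 2 -> r <= s.
  clear; case: s => [|[|//]] le E _.
    by move: E le; rewrite addn0 => ->; rewrite /demand /=; lia.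
  by move: E le; rewrite addn1 => -[->]; rewrite /demand /=; lia.
move=> u4 ab bc cd da; have c4 := set4_card u4; have cS := set4_count S u4.
have le := rho_le_card V; rewrite c4 in le.
case: (leqP 2 #|V :&: S|) => s1; first exact: aux0 le s1.
have [/existsP[B /andP[BP neB]]|/existsPn no] := boolP [exists B in P, #|V :&: h B| != 0]; last first.
  rewrite big1 // => B BP; move: (no B).
  by rewrite BP /= negbK => /eqP ->.
have cB := set4_count (h B) u4; rewrite -/V in cB cS; rewrite cB in neB.
have st u v : good u v -> ((u \in h B) ==> (v \in h B) || (v \in S)) &&
    ((v \in h B) ==> (u \in h B) || (u \in S)).
  by move=> uv; apply/andP; split; apply/implyP => uB;
    apply: (step_in BP uB) => //; rewrite good_sym.
have dj u : ~~ ((u \in h B) && (u \in S)) by apply/negP => /andP[u1 u2]; case: (hS BP u1 u2).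
have E : #|V :&: h B| + #|V :&: S| = 4.
  move: neB s1 (st _ _ ab) (st _ _ bc) (st _ _ cd) (st _ _ da) (dj a) (dj b) (dj c) (dj d).
  rewrite cB cS.
  move: (a \in h B) (b \in h B) (c \in h B) (d \in h B).
  move: (a \in S) (b \in S) (c \in S) (d \in S).
  by clear; do 8!case.
by have := rho_le V BP; rewrite c4 => /aux1; apply.
Qed.

End Family.
End Charging.

(** * Summing the cycle bounds over a packing *)

Section Packing.
Variables (n : nat) (G : graph12 n).
Notation T := 'I_n.
Notation good := (good G).

Lemma fixs_id : fixs (id : T -> T) = setT.
Proof. by apply/setP => x; rewrite !inE eqxx. Qed.

Lemma pair_matching (a b c d : T) : uniq [:: a; b; c; d] -> exists N : T -> T,
  [/\ matching good N, forall x, x \notin [set a; b; c; d] -> N x = x &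
      #|~: fixs N| = 2 * (good a b + good c d)].
Proof.
rewrite /= !inE !negb_or => /and4P[/and3P[ab ac ad] /andP[bc bd] cd _].
have mid : matching good (id : T -> T) by split=> // x; rewrite eqxx.
have one (x y : T) (N : T -> T) : matching good N -> x != y -> N x = x -> N y = y ->
    exists N' : T -> T, [/\ matching good N', forall z, z != x -> z != y -> N' z = N z &
      #|~: fixs N'| = #|~: fixs N| + 2 * good x y].
  move=> mN xy Nx Ny; case: (boolP (good x y)) => gxy; last by exists N; rewrite muln0 addn0.
  exists (rot N x y); split.
  - by apply: rot_matching => //; [exact: good_sym|exact: good_irr].
  - by move=> z zx zy; rewrite /rot (negbTE zx) (negbTE zy) Ny (negbTE zy).
  rewrite (rot_fixs (@good_irr n G)) //.
  rewrite Ny eqxx !setCD (_ : ~: fixs N :|: [set x] :|: [set y] = x |: (y |: ~: fixs N)); last first.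
    by apply/setP => z; rewrite !inE; case: (z == x); case: (z == y); case: (N z == z).
  by rewrite !cardsU1 !inE Nx Ny !eqxx (negbTE xy) /= addnA addnC.
have [N1 [m1 f1 c1]] := one a b id mid ab erefl erefl.
have [||N2 [m2 f2 c2]] := one c d N1 m1 cd.
- by rewrite f1 // eq_sym.
- by rewrite f1 // eq_sym.
exists N2; split=> //.
  move=> x; rewrite !inE !negb_or => /andP[/andP[/andP[xa xb] xc] xd].
  by rewrite f2 // f1.
by rewrite c2 c1 fixs_id setCT cards0 add0n -mulnDr.
Qed.

Section Family.
Variables (I : finType) (P : {set I}) (h : I -> {set T}) (S : {set T}).
Hypotheses
  (h_inj : forall B B' x, B \in P -> B' \in P -> x \in h B -> x \in h B' -> B = B')
  (hS : forall B x, B \in P -> x \in h B -> x \in S -> False)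
  (h_closed : forall B u v, B \in P -> u \in h B -> good u v -> v \notin h B -> v \in S).

Notation rho V := (\sum_(B in P) demand #|V :&: h B|).

(** [moved] is to be the number of vertices covered by a matching of good edges inside the cycle.
    Over a packing, 40 per cycle amounts to [10 * n], the matching contributes at most
    [4 * (n - F0)], and the demands against [S] account for [4 * f]. *)
Definition cycle_bound (C : {set {set T}}) (moved : nat) : Prop :=
  7 * edges_weight G C + 2 * rho (cover C) <= 40 + 2 * #|cover C :&: S| + 4 * moved.

(** The matching consists of the good ones among the opposite edges [p] and [s]. There is no slack
    for four good edges with [r = k], where [56 = 40 + 16], nor for two consecutive ones with
    [r = 3 + k], where [42 + 6 = 40 + 8]. *)
Lemma cycle_bound_bool (p q s t : bool) r k : r + k <= 4 ->
  (p -> q -> s -> t -> r <= k) ->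
  (p -> q -> r <= 3 + k) -> (q -> s -> r <= 3 + k) ->
  (s -> t -> r <= 3 + k) -> (t -> p -> r <= 3 + k) -> q + t <= p + s ->
  7 * (4 + (p + q + s + t)) + 2 * r <= 40 + 2 * k + 4 * (2 * (p + s)).
Proof.
clear; case: p; case: q; case: s; case: t => //= rk h0 h1 h2 h3 h4 h5;
  try have {}h0 := h0 isT isT isT isT; try have {}h1 := h1 isT isT;
  try have {}h2 := h2 isT isT; try have {}h3 := h3 isT isT;
  try have {}h4 := h4 isT isT; lia.
Qed.

(** The edges form two opposite pairs, and the pair with more good edges supplies the matching;
    rotating the cycle exchanges the two cases. *)
Lemma cycle_matching C : is_cycle4 C -> exists N : T -> T,
  [/\ matching good N, forall x, x \notin cover C -> N x = x & cycle_bound C #|~: fixs N|].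
Proof.
case/existsP=> a /existsP[b /existsP[c /existsP[d /andP[u4 /eqP ->]]]].
have rotate (x y z t : T) : [set x; y; z; t] = [set y; z; t; x].
  by apply/setP => s; rewrite !inE; do 4!case: (s == _).
have u4' : uniq [:: b; c; d; a] by have := rot_uniq 1 [:: a; b; c; d]; rewrite u4.
have u4'' : uniq [:: c; d; a; b] by have := rot_uniq 2 [:: a; b; c; d]; rewrite u4.
have u4''' : uniq [:: d; a; b; c] by have := rot_uniq 3 [:: a; b; c; d]; rewrite u4.
rewrite /cycle_bound cover_cycle4 edges_weight_cycle4 //; set V := [set a; b; c; d].
have V1 : V = [set b; c; d; a] by apply: rotate.
have V2 : V = [set c; d; a; b] by rewrite V1; apply: rotate.
have V3 : V = [set d; a; b; c] by rewrite V2; apply: rotate.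
have r0 := rho_le_card h_inj hS V; rewrite (set4_card u4) in r0.
have r1 := rho_cycle h_inj hS h_closed u4; rewrite -/V in r1.
have p1 := rho_path h_inj hS h_closed u4; rewrite -/V in p1.
have p2 := rho_path h_inj hS h_closed u4'; rewrite -V1 in p2.
have p3 := rho_path h_inj hS h_closed u4''; rewrite -V2 in p3.
have p4 := rho_path h_inj hS h_closed u4'''; rewrite -V3 in p4.
set r := rho V in r0 r1 p1 p2 p3 p4 *; set s := #|V :&: S| in r0 r1 p1 p2 p3 p4 *.
case: (leqP (good b c + good d a) (good a b + good c d)) => le.
  have [N [mN fN cN]] := pair_matching u4; exists N; split=> //; rewrite cN.
  exact: cycle_bound_bool r0 r1 p1 p2 p3 p4 le.
have [N [mN fN cN]] := pair_matching u4'; exists N; split=> //; first by rewrite V1.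
rewrite cN.
have -> : 4 + (good a b + good b c + good c d + good d a) =
    4 + (good b c + good c d + good d a + good a b).
  by move: (good a b) (good b c) (good c d) (good d a); clear; do 4!case.
apply: (cycle_bound_bool r0 _ p2 p3 p4 p1) => [g1 g2 g3 g4|]; first exact: r1.
by rewrite [good c d + _]addnC; apply: ltnW.
Qed.

(** Matchings inside disjoint cycles combine to one matching of the whole graph, which makes the
    packing comparable with [M0]. *)
Lemma packing_matching (Q : {set {set {set T}}}) :
  (forall C, C \in Q -> is_cycle4 C) ->
  (forall C D, C \in Q -> D \in Q -> C != D -> [disjoint cover C & cover D]) ->
  exists N : T -> T, [/\ matching good N &
    7 * packing_weight G Q + 2 * (\sum_(C in Q) rho (cover C)) <=
    40 * #|Q| + 2 * (\sum_(C in Q) #|cover C :&: S|) + 4 * #|~: fixs N|].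
Proof.
have aux w w' r r' q s s' m m' : 7 * w + 2 * r <= 40 + 2 * s + 4 * m ->
    7 * w' + 2 * r' <= 40 * q + 2 * s' + 4 * m' ->
    7 * (w + w') + 2 * (r + r') <= 40 * (true + q) + 2 * (s + s') + 4 * (m' + m).
  by clear; lia.
move=> cyc dis.
suff: exists N : T -> T, [/\ matching good N,
    forall x, (forall C, C \in Q -> x \notin cover C) -> N x = x &
    7 * packing_weight G Q + 2 * (\sum_(C in Q) rho (cover C)) <=
    40 * #|Q| + 2 * (\sum_(C in Q) #|cover C :&: S|) + 4 * #|~: fixs N|].
  by case=> N [? _ ?]; exists N.
elim: {Q}_.+1 {-2}Q (ltnSn #|Q|) cyc dis => // k IH Q Qk cyc dis.
have [->|[C CQ]] := set_0Vmem Q.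
  exists id; split=> //; first by split=> // x; rewrite eqxx.
  by rewrite /packing_weight !big_set0.
have [|||N [mN fN cN]] := IH (Q :\ C).
- by move: Qk; rewrite (cardsD1 C) CQ add1n ltnS.
- by move=> D; rewrite inE => /andP[_]; apply: cyc.
- by move=> D E; rewrite !inE => /andP[_ DQ] /andP[_ EQ]; apply: dis.
have [N1 [m1 f1 c1]] := cycle_matching (cyc C CQ).
have [NK Ng] := mN; have [N1K N1g] := m1.
have out x D : x \in cover C -> D \in Q :\ C -> x \notin cover D.
  rewrite !inE => xC /andP[DC DQ]; apply/negP => xD.
  by have := dis _ _ DQ CQ DC => /pred0P/(_ x); rewrite /= xD xC.
have NC x : x \in cover C -> N x = x by move=> xC; apply: fN => D; apply: out.
have N1C x : x \in cover C -> N1 x \in cover C.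
  move=> xC; case: (boolP (N1 x \in cover C)) => // nC.
  by have := f1 _ nC; rewrite N1K => E; rewrite -E xC in nC.
pose N' x := if x \in cover C then N1 x else N x.
exists N'; split.
- split=> x; rewrite /N'; case: (boolP (x \in cover C)) => xC; first by rewrite N1C // N1K.
  + have -> : (N x \in cover C) = false.
      by apply: contraNF xC => nC; rewrite -(NK x) NC.
    by rewrite NK.
  + exact: N1g.
  + exact: Ng.
- move=> x nx; rewrite /N' (negbTE (nx C CQ)); apply: fN => D; rewrite inE => /andP[_].
  exact: nx.
have -> : #|~: fixs N'| = #|~: fixs N| + #|~: fixs N1|.
  rewrite -[RHS]cardsUI (_ : _ :&: _ = set0) ?cards0 ?addn0.
    congr #|pred_of_set _|; apply/setP => x; rewrite !inE /N'.
    case: (boolP (x \in cover C)) => xC; first by rewrite NC // eqxx.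
    by rewrite [N1 x]f1 // eqxx orbF.
  apply/setP => x; rewrite !inE; case: (boolP (x \in cover C)) => xC.
    by rewrite NC // eqxx.
  by rewrite [N1 x]f1 // eqxx andbF.
rewrite /packing_weight 2!(big_setD1 C CQ) /= (big_setD1 C CQ) /= (cardsD1 C Q) CQ.
exact: aux c1 cN.
Qed.

End Family.
End Packing.

(** * The contracted graph and the bound for all packings *)

Section Contraction.
Variables (n : nat) (G : graph12 n).
Notation T := 'I_n.
Notation good := (good G).
Variable m : T -> T.
Hypotheses (mK : involutive m) (m_neq : forall x, m x != x).

Definition rep (x : T) : bool := x < m x.
Definition root (x : T) : T := if rep x then x else m x.
(** Each pair is represented by its smaller member, so that the matching program applies to the same
    vertex set. The larger members are isolated, hence always exposed, and have to be discounted. *)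
Definition contracted (x y : T) : bool :=
  [&& rep x, rep y, x != y &
      [|| good x y, good x (m y), good (m x) y | good (m x) (m y)]].

Notation reps := [set x | rep x].
Notation hat X := [set x | root x \in X].

Lemma contracted_sym : symmetric contracted.
Proof.
move=> x y; rewrite /contracted [y == x]eq_sym !(good_sym _ y) !(good_sym _ (m y)).
by case: (rep x); case: (rep y); case: (x == y) => //=;
   case: (good x y); case: (good x (m y)); case: (good (m x) y).
Qed.

Lemma contracted_irr : irreflexive contracted.
Proof. by move=> x; rewrite /contracted eqxx !andbF. Qed.

Lemma rep_mate x : rep (m x) = ~~ rep x.
Proof.
rewrite /rep mK -leqNgt ltn_neqAle; have := m_neq x.
by rewrite -val_eqE /= => ->.
Qed.

Lemma rep_root x : rep (root x).
Proof. by rewrite /root; case: ifP => // rx; rewrite rep_mate rx. Qed.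

Lemma root_rep x : rep x -> root x = x.
Proof. by rewrite /root => ->. Qed.

Lemma root_mate x : root (m x) = root x.
Proof. by rewrite /root rep_mate; case: (rep x) => //=; rewrite mK. Qed.

Lemma rootP x : x = root x \/ x = m (root x).
Proof. by rewrite /root; case: (rep x); [left|right; rewrite mK]. Qed.

Lemma card_hat (X : {set T}) : #|hat X| = 2 * #|X :&: reps|.
Proof.
have -> : hat X = (X :&: reps) :|: m @: (X :&: reps).
  apply/setP => x; rewrite !inE; apply/idP/orP.
    rewrite /root; case: ifP => rx xX; [left|right]; first by rewrite xX.
    by apply/imsetP; exists (m x); rewrite ?mK // !inE xX rep_mate rx.
  case=> [/andP[xX rx]|/imsetP[y]]; first by rewrite root_rep.
  by rewrite !inE => /andP[yX ry] ->; rewrite root_mate root_rep.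
rewrite cardsU card_imset; last exact: inv_inj.
rewrite (_ : _ :&: m @: _ = set0) ?cards0 ?subn0 ?mul2n ?addnn //.
apply/setP => x; rewrite !inE; apply/negP => /andP[/andP[_ rx] /imsetP[y]].
by rewrite !inE => /andP[_ ry] E; rewrite E rep_mate ry in rx.
Qed.

Lemma card_reps : 2 * #|reps| = n.
Proof.
rewrite -[RHS]card_ord -cardsT (_ : [set: T] = hat setT); last by apply/setP => x; rewrite !inE.
by rewrite card_hat setTI.
Qed.

Section OptimumBound.
Variables (M0 M1 : T -> T).
Hypotheses (cert0 : certificate good M0)
  (mat1 : matching contracted M1) (cert1 : certificate contracted M1).

Lemma nonrep_fix x : ~~ rep x -> M1 x = x.
Proof.
move=> rx; apply/eqP; apply: contraNT rx => h.
by have [_ /(_ x h)] := mat1; rewrite /contracted => /andP[].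
Qed.

Lemma packing_cover_count (Q : {set {set {set T}}}) (X : {set T}) : packing4 Q ->
  \sum_(C in Q) #|cover C :&: X| = #|X|.
Proof.
case/and4P => _ _ /forall_inP dis /eqP cov.
rewrite (eq_bigr (fun C => \sum_(x in X) (x \in cover C))); last first.
  by move=> C _; rewrite setIC card_setI_sum.
rewrite exchange_big -sum1_card /=; apply: eq_bigr => x xX.
have : x \in \bigcup_(C in Q) cover C by rewrite cov inE.
case/bigcupP => C CQ xC; rewrite (bigD1 C) //= xC big1 // => D /andP[DQ DC].
have /forall_inP/(_ C CQ)/implyP/(_ DC)/pred0P/(_ x) := dis D DQ.
by rewrite /= xC andbT => ->.
Qed.

Lemma is_cycle4_card (C : {set {set T}}) : is_cycle4 C -> #|cover C| = 4.
Proof.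
case/existsP=> a /existsP[b /existsP[c /existsP[d /andP[u4 /eqP ->]]]].
by rewrite cover_cycle4 set4_card.
Qed.

(** The family consists of the witness blocks [P'] made of representatives. Such a block stands for
    an odd number of pairs, so for 2 modulo 4 vertices, and its total demand is at least 2. The set
    [hat O] has at most [2 * #|O|] vertices, the good edges in the cycles are limited by [cert0],
    and the witness gives [#|O| + f <= #|P'|]. *)
Lemma packing_bound (Q : {set {set {set T}}}) : 4 %| n -> packing4 Q ->
  7 * packing_weight G Q + 4 * #|fixs M0| + 4 * #|fixs M1 :&: reps| <= 14 * n.
Proof.
have aux w r q s mv f0 f p p' o x n' : 7 * w + 2 * r <= 40 * q + 2 * s + 4 * mv ->
    q * 4 = n' -> mv + f0 <= n' -> s <= 2 * o -> o + (f + x) <= p -> p <= p' + x ->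
    2 * p' <= r -> 7 * w + 4 * f0 + 4 * f <= 14 * n' by clear; lia.
move=> n4 pQ; have [O [P [tP oP dP nP cP]]] := cert1.
pose P' := [set B in P | B \subset reps].
have P'P B : B \in P' -> B \in P /\ B \subset reps by rewrite inE => /andP.
have h_inj B B' x : B \in P' -> B' \in P' -> x \in hat B -> x \in hat B' -> B = B'.
  move=> /P'P[BP _] /P'P[BP' _]; rewrite !inE => xB xB'.
  apply/eqP/negPn/negP => BB'; have := trivIsetP tP _ _ BP BP' BB'.
  by move/pred0P/(_ (root x)); rewrite /= xB xB'.
have hS B x : B \in P' -> x \in hat B -> x \in hat O -> False.
  move=> /P'P[BP _]; rewrite !inE => xB xO.
  by have /pred0P/(_ (root x)) := dP _ BP; rewrite /= xB xO.
have h_closed B u v : B \in P' -> u \in hat B -> good u v -> v \notin hat B -> v \in hat O.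
  move=> /P'P[BP _]; rewrite !inE => uB guv vB; apply: (nP B (root u)) => //.
  rewrite /contracted !rep_root /=; apply/andP; split.
    by apply: contraNneq vB => <-.
  by case: (rootP u) guv => ->; case: (rootP v) => -> guv; rewrite ?root_mate
    !(root_rep (rep_root _)) guv ?orbT.
have [cyc dis] : (forall C, C \in Q -> is_cycle4 C) /\
    (forall C D, C \in Q -> D \in Q -> C != D -> [disjoint cover C & cover D]).
  case/and4P: pQ => _ /forall_inP cyc /forall_inP dis _; split=> // C D CQ DQ.
  by have /forall_inP/(_ D DQ)/implyP := dis C CQ.
have [N [mN bN]] := packing_matching h_inj hS h_closed cyc dis.
apply: (aux _ _ _ _ _ _ _ _ #|P'| #|O| #|~: reps| _ bN).
- by case/and4P: pQ => /eqP -> _ _ _; apply: divnK.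
- rewrite -[X in _ <= X]card_ord -(cardsC (fixs N)) addnC leq_add2r.
  exact: certificate_max cert0 mN.
- rewrite packing_cover_count // card_hat leq_mul2l /=.
  by apply: subset_leq_card; apply: subsetIl.
- apply: leq_trans cP; rewrite leq_add2l -(cardsID reps (fixs M1)) leq_add2l.
  apply: subset_leq_card; apply/subsetP => x; rewrite !inE => rx.
  by rewrite rx nonrep_fix ?eqxx.
(* Distinct blocks outside [P'] contain distinct vertices that are not representatives. All such
   vertices are exposed by [M1], so they cancel in the witness inequality. *)
- rewrite -(cardsID P' P); apply: leq_add.
    by apply: subset_leq_card; apply: subsetIr.
  pose g (B : {set T}) := [pick x in B | ~~ rep x].
  have gP B : B \in P :\: P' -> exists x, [/\ g B = Some x, x \in B & ~~ rep x].
    rewrite !inE => /andP[+ BP]; rewrite BP /= => /subsetPn[x xB]; rewrite inE => rx.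
    rewrite /g; case: pickP => [y /andP[yB ry]|/(_ x)]; first by exists y.
    by rewrite xB rx.
  have ginj : {in P :\: P' &, injective g}.
    move=> B B' BP BP' E; have [x [Ex xB _]] := gP _ BP; have [y [Ey yB _]] := gP _ BP'.
    move: E; rewrite Ex Ey => -[E]; rewrite -E in yB.
    apply/eqP/negPn/negP => BB'; move: BP BP'; rewrite !inE => /andP[_ BP] /andP[_ BP'].
    have := trivIsetP tP _ _ BP BP' BB'.
    by move/pred0P/(_ x); rewrite /= xB yB.
  rewrite -(card_in_imset ginj) -(card_imset (~: reps) (@Some_inj _)).
  apply: subset_leq_card; apply/subsetP => o /imsetP[B /gP[x [-> _ rx]] ->].
  by apply: imset_f; rewrite !inE.
rewrite exchange_big /= mulnC -sum_nat_const; apply: leq_sum => B /P'P[BP BR].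
apply: demand_sum.
  move=> C CQ; rewrite -(is_cycle4_card (cyc C CQ)); apply: subset_leq_card.
  exact: subsetIl.
rewrite packing_cover_count // card_hat (setIidPl BR).
by have := oP _ BP; move: #|B| => k ok; rewrite -[k]odd_double_half ok -!muln2; clear; lia.
Qed.

End OptimumBound.
End Contraction.

(** * The packing and the program computing it *)

Section Output.
Variables (n : nat) (G : graph12 n).
Notation T := 'I_n.
Notation good := (good G).
Variables (m M' : T -> T).

Definition orient (i j : T) : T * T :=
  if good i j then (i, j) else if good i (m j) then (i, m j)
  else if good (m i) j then (m i, j) else if good (m i) (m j) then (m i, m j)
  else (i, j).

(** Selects one vertex of each cycle, so that no cycle is output twice. *)
Definition leader (i : T) : bool := (i < m i) && (i < M' i).

Definition quad (i : T) : seq T :=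
  let xy := orient i (M' i) in [:: m xy.1; xy.1; xy.2; m xy.2].

Definition output : seq T :=
  flatten [seq if leader i then quad i else [::] | i <- enum T].

Hypotheses (mK : involutive m) (m_neq : forall x, m x != x)
  (MK : involutive M') (M_neq : forall x, rep m x -> M' x != x)
  (M_rep : forall x, rep m x -> rep m (M' x)).

Notation reps := [set x | rep m x].
Notation contracted := (contracted G m).
Notation I := [set i | leader i].
Notation root := (root m).

Definition quad_cycle (i : T) : {set {set T}} :=
  let xy := orient i (M' i) in cycle4 (m xy.1) xy.1 xy.2 (m xy.2).

(** The leader of the cycle through [x]; its fibres are the vertex sets of the cycles. *)
Definition base (x : T) : T := if root x < M' (root x) then root x else M' (root x).

Lemma base_leader x : leader (base x).
Proof.
rewrite /leader /base; have rx := rep_root mK m_neq x; have Mx := M_rep rx.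
case: ifP => h; first by rewrite h andbT.
rewrite -/(rep m _) Mx MK ltnNge leq_eqVlt h orbF.
by have := M_neq rx; rewrite -val_eqE /= eq_sym => ->.
Qed.

Lemma orientP i j : rep m i -> rep m j -> i != j ->
  let xy := orient i j in
  [/\ root xy.1 = i, root xy.2 = j & contracted i j -> good xy.1 xy.2].
Proof.
move=> ri rj ij xy; have [mi mj] : root (m i) = i /\ root (m j) = j.
  by rewrite !root_mate // !root_rep.
rewrite /xy /orient /contracted ri rj ij /=.
by do 4!(case: ifP => //= ?; first by split=> //; rewrite root_rep); split; rewrite ?root_rep.
Qed.

Lemma leaderP i : leader i -> [/\ rep m i, rep m (M' i), i != M' i & root i = i].
Proof.
case/andP => ri iM; split=> //; first exact: M_rep.
  by rewrite -val_eqE /= ltn_eqF.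
exact: root_rep.
Qed.

Lemma quad_set i : leader i -> [set x in quad i] = [set x | base x == i].
Proof.
move=> li; have [ri rM iM _] := leaderP li.
have [r1 r2 _] := orientP ri rM iM.
apply/setP => x; rewrite !inE; apply/idP/eqP.
  have [b1 b2] : (forall y, root y = i -> base y = i) /\ (forall y, root y = M' i -> base y = i).
    split=> y E; rewrite /base E; case/andP: li => _; first by move=> ->.
    by rewrite MK [M' i < i]ltnNge => /ltnW ->.
  by case/or4P => /eqP ->; [apply: b1|apply: b1|apply: b2|apply: b2]; rewrite ?root_mate.
have mem2 x0 y : root x0 = root y -> x0 = y \/ x0 = m y.
  case: (rootP mK x0) => ->; case: (rootP mK y) => ->;
  rewrite ?root_mate // !(root_rep (rep_root mK m_neq _)) => ->; rewrite ?mK; by [left|right].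
rewrite /base; case: ifP => _ E.
  have /mem2[->|->] : root x = root (orient i (M' i)).1 by rewrite r1.
    by rewrite eqxx orbT.
  by rewrite eqxx.
have /mem2[->|->] : root x = root (orient i (M' i)).2 by rewrite r2 -E MK.
  by rewrite eqxx !orbT.
by rewrite eqxx !orbT.
Qed.

Lemma quad_uniq i : leader i -> uniq (quad i).
Proof.
move=> li; have [ri rM iM _] := leaderP li.
have [r1 r2 _] := orientP ri rM iM; rewrite /quad.
set x := (orient _ _).1 in r1 *; set y := (orient _ _).2 in r2 *.
have ne u v : root u = i -> root v = M' i -> (u == v) = false.
  by move=> ru rv; apply/negP => /eqP E; case/eqP: iM; rewrite -[LHS]ru E.
rewrite /= !inE (negbTE (m_neq x)) [y == m y]eq_sym (negbTE (m_neq y)).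
by rewrite !ne // ?root_mate.
Qed.

Lemma cover_quad i : leader i -> cover (quad_cycle i) = [set x | base x == i].
Proof.
move=> li; rewrite -quad_set // /quad_cycle cover_cycle4 /quad.
by apply/setP => x; rewrite !inE !orbA.
Qed.

Lemma cycles_of_output : cycles_of output = quad_cycle @: I.
Proof.
rewrite /output; have -> : I = [set i in enum T | leader i].
  by apply/setP => i; rewrite !inE mem_enum.
elim: (enum T) => [|i s IH] /=.
  by apply/setP => C; rewrite inE; apply/esym/imsetP => -[i]; rewrite inE.
have E : [set j in i :: s | leader j] =
    (if leader i then [set i] else set0) :|: [set j in s | leader j].
  apply/setP => j; rewrite !inE; case: (eqVneq j i) => [->|ji] /=.
    by case: ifP => li; rewrite !inE ?eqxx ?andbF.
  by case: ifP => li; rewrite !inE ?(negbTE ji).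
rewrite E imsetU; case: ifP => li; last by rewrite imset0 set0U.
by rewrite imset_set1 /= IH.
Qed.

Lemma quad_cycle_inj : {in I &, injective quad_cycle}.
Proof.
move=> i j; rewrite !inE => li lj E.
have := cover_quad lj; rewrite -E cover_quad // => /setP/(_ i).
have [ri _ _ r_i] := leaderP li.
have bi : base i = i by rewrite /base r_i; case/andP: li => _ ->.
by rewrite !inE bi eqxx => /esym/eqP.
Qed.

Lemma sum_leaders (F : T -> nat) : \sum_x F x = \sum_(i in I) \sum_(x <- quad i) F x.
Proof.
rewrite (partition_big base (mem I)) /=; last by move=> x _; rewrite inE base_leader.
apply: eq_bigr => i; rewrite inE => li.
rewrite -(big_map id xpredT F) map_id big_uniq ?quad_uniq //=.
apply: eq_bigl => x; have := quad_set li; move/setP/(_ x); rewrite !inE => ->.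
by [].
Qed.

Lemma sum_quad (F : T -> nat) i : \sum_(x <- quad i) F x =
  F (m (orient i (M' i)).1) + F (orient i (M' i)).1 +
  F (orient i (M' i)).2 + F (m (orient i (M' i)).2).
Proof. by rewrite /quad !big_cons big_nil addn0 !addnA. Qed.

Lemma card_leaders : 4 * #|I| = n.
Proof.
rewrite -[RHS]card_ord -[RHS]sum1_card [RHS](eq_bigl xpredT) // (sum_leaders (fun=> 1)).
by rewrite mulnC -sum_nat_const; apply: eq_bigr => i _; rewrite sum_quad.
Qed.

Lemma size_output : size output = n.
Proof.
apply: etrans card_leaders; rewrite /output size_flatten /shape -map_comp.
rewrite sumnE big_map big_enum /= (eq_bigr (fun i => if leader i then 4 else 0)); last first.
  by move=> i _; rewrite /=; case: ifP.
rewrite -big_mkcond /= sum_nat_const mulnC; congr (4 * _).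
by apply: eq_card => i; rewrite !inE.
Qed.

Lemma packing_output : packing4 (cycles_of output).
Proof.
rewrite cycles_of_output /packing4; apply/and4P; split.
- by rewrite (card_in_imset quad_cycle_inj) -[X in _ == X %/ 4]card_leaders mulKn.
- apply/forall_inP => C /imsetP[i]; rewrite inE => li ->.
  apply/existsP; exists (m (orient i (M' i)).1); apply/existsP; exists (orient i (M' i)).1.
  apply/existsP; exists (orient i (M' i)).2; apply/existsP; exists (m (orient i (M' i)).2).
  by rewrite eqxx andbT; apply: quad_uniq.
- apply/forall_inP => C /imsetP[i]; rewrite inE => li ->.
  apply/forall_inP => D /imsetP[j]; rewrite inE => lj ->.
  apply/implyP => ij; rewrite !cover_quad //; apply/pred0P => x /=; rewrite !inE.
  by apply/negP => /andP[/eqP bi /eqP bj]; rewrite -bi -bj eqxx in ij.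
apply/eqP/setP => x; rewrite inE; apply/bigcupP; exists (quad_cycle (base x)).
  by apply: imset_f; rewrite inE base_leader.
by rewrite cover_quad ?base_leader // inE.
Qed.

(** The outer edges are the two pairs of [m], the middle edge is good whenever the pairs are
    adjacent in the contraction, and the closing edge is only known to weigh at least 1. *)
Lemma weight_quad i : leader i ->
  4 + good i (m i) + good (M' i) (m (M' i)) + contracted i (M' i) <=
  edges_weight G (quad_cycle i).
Proof.
have aux (p q s t p' q' s' : bool) : p = p' -> s = q' -> (s' -> q) ->
    4 + p' + q' + s' <= 4 + (p + q + s + t).
  move=> -> -> h; have {h} : (s' : nat) <= q by case: s' h => [->|].
  by move: (s' : nat) (q : nat); clear; lia.
move=> li; have [ri rM iM _] := leaderP li.
have [r1 r2 g] := orientP ri rM iM.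
rewrite edges_weight_cycle4; last exact: quad_uniq.
have mate x y : root x = y -> good x (m x) = good y (m y).
  by move=> <-; case: (rootP mK x) => {1 2}->; rewrite ?mK // good_sym.
by apply: aux g; [rewrite good_sym|]; apply: mate.
Qed.

Variables (M0 M1 : T -> T).
Hypotheses (mat0 : matching good M0) (ext0 : forall x, M0 x != x -> m x = M0 x)
  (mat1 : matching contracted M1) (ext1 : forall x, M1 x != x -> M' x = M1 x).

(** Multiplied by 4, the cycle weights become sums over vertices, in which each pair is seen twice
    and each middle edge four times. At least [n - F0] vertices lie in good pairs, and at least
    [n - 2 * f] in pairs that are joined by a good edge. *)
Lemma output_weight :
  7 * n <= 4 * packing_weight G (cycles_of output) + 2 * #|fixs M0| + 2 * #|fixs M1 :&: reps|.
Proof.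
have aux w a b f0 f n' r mv : 4 * w >= 4 * n' + 2 * a + b -> mv + f0 = n' -> mv <= a ->
    2 * r = n' -> 2 * r <= b + 2 * f -> 7 * n' <= 4 * w + 2 * f0 + 2 * f by clear; lia.
have key : 4 * packing_weight G (cycles_of output) >=
   4 * n + 2 * (\sum_x (good x (m x))) + \sum_x (contracted (root x) (M' (root x))).
  rewrite -[X in 4 * X + _]card_leaders /packing_weight cycles_of_output.
  rewrite (big_imset _ quad_cycle_inj) /= !sum_leaders big_distrr.
  rewrite (_ : 4 * (4 * #|I|) = \sum_(i in I) 16); last by rewrite sum_nat_const mulnA mulnC.
  rewrite big_distrr -!big_split /=; apply: leq_sum => i; rewrite inE => li.
  have [ri rM iM r_i] := leaderP li; have [r1 r2 _] := orientP ri rM iM.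
  have mate x y : root x = y -> good x (m x) = good y (m y).
    by move=> <-; case: (rootP mK x) => {1 2}->; rewrite ?mK // good_sym.
  have mate' x y : root x = y -> good (m x) (m (m x)) = good y (m y).
    by move=> rx; apply: mate; rewrite root_mate.
  rewrite !sum_quad (mate _ _ r1) (mate' _ _ r1) (mate _ _ r2) (mate' _ _ r2).
  rewrite !root_mate // r1 r2 MK [contracted (M' i) i]contracted_sym.
  have := weight_quad li; move: (edges_weight G _) (good i _) (good (M' i) _) (contracted i _).
  by clear; move=> w p q s; lia.
apply: (aux _ _ _ _ _ _ #|reps| #|~: fixs M0| key).
- by rewrite addnC cardsC card_ord.
- rewrite -sum1_card big_mkcond /=; apply: leq_sum => x _.
  rewrite !inE; case: (boolP (M0 x == x)) => //= h.
  by rewrite ext0 //; have [_ /(_ x h) ->] := mat0.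
- exact: card_reps.
have -> : \sum_x (contracted (root x) (M' (root x)) : nat) =
    #|[set x | root x \in [set y | contracted y (M' y)]]|.
  rewrite -sum1_card [RHS]big_mkcond /=; apply: eq_bigr => x _.
  by rewrite !inE; case: (contracted _ _).
rewrite card_hat // -mulnDr leq_mul2l /= -(cardsID (fixs M1) reps) addnC leq_add //.
  apply: subset_leq_card; apply/subsetP => x; rewrite !inE => /andP[h rx].
  by rewrite rx andbT ext1 //; have [_ /(_ x h)] := mat1.
by rewrite setIC.
Qed.

End Output.

(** * Programs for the contraction, the completion and the output *)

Definition vP := 12.
Definition vHave := 13.
Definition vA := 14.
Definition vB := 15.

Definition ENot (a : exp) : exp := ESub (ECst 1) a.
Definition EAnd (a b : exp) : exp := ENot (EAdd (ENot a) (ENot b)).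
(** The double negation turns every nonzero value into 1. *)
Definition EOr (a b : exp) : exp := ENot (ENot (EAdd a b)).
Definition ELt (a b : exp) : exp := ENot (ENot (ESub b a)).
Definition EGood (a b : exp) : exp := EEq (ELd aG a b) (ECst 2).
Definition EMate (a : exp) : exp := ELd1 aMate a.

Definition fill_rel (c : exp) : stm := SFor vV (SFor vW (SSt aE (EVar vV) (EVar vW) c)).

Definition EContracted (a b : exp) : exp :=
  EAnd (ELt a (EMate a)) (EAnd (ELt b (EMate b)) (EAnd (ENot (EEq a b))
    (EOr (EGood a b) (EOr (EGood a (EMate b))
      (EOr (EGood (EMate a) b) (EGood (EMate a) (EMate b))))))).

(** While [vHave] is 1, [vP] holds a fixed point that still waits for a partner. *)
Definition pair_up (act : exp) : stm :=
  (vHave <- ECst 0 ;;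
   SFor vI (SIf (EAnd act (EEq (ELd1 aM (EVar vI)) (EVar vI)))
     (SIf (EVar vHave)
       (SSt1 aM (EVar vI) (EVar vP) ;; SSt1 aM (EVar vP) (EVar vI) ;; vHave <- ECst 0)
       (vP <- EVar vI ;; vHave <- ECst 1)) SSkip))%S.

Definition emit_quad : stm :=
  (vA <- EVar vI ;; vB <- ELd1 aM (EVar vI) ;;
   SIf (EGood (EVar vA) (EVar vB)) SSkip
   (SIf (EGood (EVar vA) (EMate (EVar vB))) (vB <- EMate (EVar vB))
   (SIf (EGood (EMate (EVar vA)) (EVar vB)) (vA <- EMate (EVar vA))
   (SIf (EGood (EMate (EVar vA)) (EMate (EVar vB)))
     (vA <- EMate (EVar vA) ;; vB <- EMate (EVar vB)) SSkip))) ;;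
   SEmit (EMate (EVar vA)) ;; SEmit (EVar vA) ;; SEmit (EVar vB) ;; SEmit (EMate (EVar vB)))%S.

Definition emit_output : stm :=
  SFor vI (SIf (EAnd (ELt (EVar vI) (EMate (EVar vI))) (ELt (EVar vI) (ELd1 aM (EVar vI))))
    emit_quad SSkip).

Definition cycle_packing : stm :=
  (fill_rel (EGood (EVar vV) (EVar vW)) ;;
   max_matching ;; pair_up (ECst 1) ;;
   copy_row aMate (ECst 0) aM (ECst 0) ;;
   fill_rel (EContracted (EVar vV) (EVar vW)) ;;
   max_matching ;; pair_up (ELt (EVar vI) (EMate (EVar vI))) ;;
   emit_output)%S.

Section Program.
Variables (n : nat) (G : graph12 n).
Notation T := 'I_n.
Notation good := (good G).
Implicit Types (u : ust).

Definition holds_graph u : Prop :=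
  forall i j : T, arr u aG i j = if i == j then 0 else G [set i; j].

Lemma ev_eqb a b u : ev n (EEq a b) u = (ev n a u == ev n b u).
Proof.
by case: (eqVneq (ev n a u) (ev n b u)) => [E|/ev_neq //]; rewrite /= E !subnn.
Qed.

Lemma ev_not a u (p : bool) : ev n a u = p -> ev n (ENot a) u = ~~ p.
Proof. by move=> /= ->; case: p. Qed.

Lemma ev_and a b u (p q : bool) : ev n a u = p -> ev n b u = q ->
  ev n (EAnd a b) u = p && q.
Proof. by move=> /= -> ->; case: p; case: q. Qed.

Lemma ev_or a b u (p q : bool) : ev n a u = p -> ev n b u = q ->
  ev n (EOr a b) u = p || q.
Proof. by move=> /= -> ->; case: p; case: q. Qed.

Lemma ev_lt a b u : ev n (ELt a b) u = (ev n a u < ev n b u).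
Proof. by rewrite /=; case: ltnP; lia. Qed.

Lemma ev_good a b u (i j : T) : holds_graph u -> ev n a u = i -> ev n b u = j ->
  ev n (EGood a b) u = good i j.
Proof.
move=> hG Ea Eb; rewrite ev_eqb (ev_ld _ Ea Eb) hG /good.
by case: (i == j).
Qed.

Lemma ev_mate a u (m : T -> T) (i : T) : holds_row u aMate m -> ev n a u = i ->
  ev n (EMate a) u = m i.
Proof. by move=> hm Ea; rewrite (ev_ld1 _ Ea) hm. Qed.

Lemma ev_contracted a b u (m : T -> T) (i j : T) : holds_graph u -> holds_row u aMate m ->
  ev n a u = i -> ev n b u = j -> ev n (EContracted a b) u = contracted G m i j.
Proof.
move=> hG hm Ea Eb; have ma := ev_mate hm Ea; have mb := ev_mate hm Eb.
apply: ev_and; first by rewrite ev_lt Ea ma.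
apply: ev_and; first by rewrite ev_lt Eb mb.
apply: ev_and; first by apply: ev_not; rewrite ev_eqb Ea Eb.
by do 3!(apply: ev_or; first exact: ev_good); apply: ev_good.
Qed.

Lemma fill_rel_spec c u (e : rel T) :
  (forall u' (v w : T), (forall k, k != aE -> arr u' k = arr u k) ->
     env u' vV = v -> env u' vW = w -> ev n c u' = e v w) ->
  holds_rel (eval n (fill_rel c) u) e.
Proof.
move=> hc; set body := SSt aE (EVar vV) (EVar vW) c.
pose same u' := forall k, k != aE -> arr u' k = arr u k.
pose P i u1 := same u1 /\ forall v w : T, v < i -> arr u1 aE v w = e v w.
suff [_ h] : P n (eval n (fill_rel c) u) by move=> v w; apply: h.
apply: for_ind => // i u1 iN [s1 h1].
pose P' j u2 := [/\ same u2, env u2 vV = i &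
  forall v w : T, (v < i) || ((v == i :> nat) && (w < j)) -> arr u2 aE v w = e v w].
have [s2 _ h2] : P' n (eval n (SFor vW body) (setv u1 vV i)).
  apply: for_ind.
    split=> // v w; rewrite ltn0 andbF orbF; exact: h1.
  move=> j u2 jN [s2 i2 h2]; set u3 := setv u2 vW j.
  have s3 : same u3 by [].
  rewrite /body /= /upd /= i2 iN jN /=; split=> //.
    by move=> k kE; rewrite /= (negbTE kE) /=; apply: s2.
  move=> v w /=.
  have cv := @hc u3 (Ordinal iN) (Ordinal jN) s3 i2 (erefl _).
  case: (eqVneq (v : nat) i) => [vi|vi] /=; last first.
    by rewrite orbF => vi'; rewrite h2 // vi'.
  rewrite -vi ltnn /= ltnS leq_eqVlt; case: (eqVneq (w : nat) j) => [wj _|wj /= wj'].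
    have -> : v = Ordinal iN by apply: val_inj.
    by have -> : w = Ordinal jN by apply: val_inj.
  by rewrite h2 // vi eqxx wj' orbT.
split=> // v w; rewrite ltnS leq_eqVlt => vi; apply: h2.
by rewrite orbC ltn_ord andbT.
Qed.

(** Exposed active vertices are paired in order of appearance, adjacent or not, so at most the last
    one remains alone. *)
Lemma pair_up_spec act u (a : pred T) (M : T -> T) : holds_row u aM M -> involutive M ->
  (forall u' (i : T), (forall k, k != aM -> arr u' k = arr u k) -> env u' vI = i ->
     ev n act u' = a i) ->
  exists M', [/\ holds_row (eval n (pair_up act) u) aM M', involutive M',
    forall i, M i != i -> M' i = M i, forall i, M' i != i -> M i = i -> a i /\ a (M' i) &
    #|[set i | a i && (M' i == i)]| <= 1].
Proof.
move=> hM MK hact; rewrite /pair_up eval_seq.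
set body := SIf _ _ _; set u1 := eval n (vHave <- ECst 0)%S u.
pose P i (u2 : ust) := (forall k, k != aM -> arr u2 k = arr u k) /\
  exists M', [/\ holds_row u2 aM M', involutive M', forall i, M i != i -> M' i = M i,
    forall i, M' i != i -> M i = i -> a i /\ a (M' i) &
    if env u2 vHave == 0 then forall j : T, j < i -> a j -> M' j != j
    else exists p : T, [/\ env u2 vP = p, p < i, a p, M' p = p &
      forall j : T, j < i -> a j -> M' j = j -> j = p]].
suff [_ [M' [h1 h2 h3 h4 h5]]] : P n (eval n (SFor vI body) u1).
  exists M'; split=> //; move: h5; case: ifP => _ h5.
    rewrite (_ : [set i | _] = set0) ?cards0 //; apply/setP => i; rewrite !inE.
    by apply/negP => /andP[ai]; apply/negP/h5.
  case: h5 => p [_ _ _ _ h5]; rewrite -(cards1 p); apply: subset_leq_card.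
  by apply/subsetP => i; rewrite !inE => /andP[ai /eqP Mi]; apply/eqP/h5.
apply: for_ind.
  split=> //; exists M; split=> //; first by move=> i Mi E; rewrite E eqxx in Mi.
move=> i u2 iN [s2 [M' [h1 h2 h3 h4 h5]]]; set u3 := setv u2 vI i.
pose i' := Ordinal iN.
have evM : ev n (ELd1 aM (EVar vI)) u3 = M' i' by rewrite (ev_ld1 _ (i := i')) // h1.
have evc : ev n (EAnd act (EEq (ELd1 aM (EVar vI)) (EVar vI))) u3 = a i' && (M' i' == i').
  apply: ev_and; first by apply: hact.
  by rewrite ev_eqb evM.
have ltS (j : T) : j < i.+1 -> j < i \/ j = i'.
  rewrite ltnS leq_eqVlt => /orP[/eqP E|]; [by right; apply: val_inj|by left].
have [/andP[ai /eqP Mi]|nai] := boolP (a i' && (M' i' == i')); last first.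
  rewrite /body eval_ifF ?evc ?(negbTE nai) //; split=> //; exists M'; split=> //.
  rewrite /u3 /=; rewrite /upd /=; move: h5; case: ifP => _.
    move=> h5 j /ltS[ji|->] aj; first exact: h5.
    by move: nai; rewrite aj.
  case=> p [p1 p2 p3 p4 p5]; exists p; split=> //; first exact: ltnW.
  move=> j /ltS[ji|->] aj Mj; first exact: p5.
  by move: nai; rewrite aj Mj eqxx.
rewrite /body eval_ifT ?evc ?ai ?Mi ?eqxx //.
have eH : ev n (EVar vHave) u3 = env u2 vHave by [].
have [E|ne] := eqVneq (env u2 vHave) 0; last first.
  move: h5; rewrite (negbTE ne) => -[p [p1 p2 p3 p4 p5]].
  have pi : p != i' by rewrite -val_eqE /= ltn_eqF.
  have u3P : ev n (EVar vP) u3 = p := p1.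
  rewrite eval_ifT ?eH // !eval_seq eval_asg (eval_st1 aM (b := EVar vI) _ (i := i')) //.
  rewrite (eval_st1 aM (b := EVar vP) _ (i := p)) // u3P.
  split.
    by move=> k kM; rewrite /= (negbTE kM) /=; apply: s2.
  exists (fun j => if j == i' then p else if j == p then i' else M' j); split.
  - move=> j; rewrite /= /upd /= -[(j : nat) == i]/(j == i') -[(j : nat) == p]/(j == p).
    case: (eqVneq j p) => [->|jp]; first by rewrite (negbTE pi).
    by case: (eqVneq j i') => // _; apply: h1.
  - move=> j; case: (eqVneq j i') => [->|ji]; first by rewrite (negbTE pi) eqxx.
    case: (eqVneq j p) => [->|jp]; first by rewrite eqxx.
    have -> : (M' j == i') = false by apply: contraNF ji => /eqP E; rewrite -(h2 j) E Mi.
    by have -> : (M' j == p) = false by apply: contraNF jp => /eqP E; rewrite -(h2 j) E p4.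
  - move=> j Mj; have M'j := h3 _ Mj.
    have ne' q : M' q = q -> (j == q) = false.
      by move=> Mq; apply/negP => /eqP E; rewrite -M'j E Mq eqxx in Mj.
    by rewrite !ne'.
  - move=> j; case: (eqVneq j i') => [->|ji]; first by move=> _ _; rewrite ai p3.
    by case: (eqVneq j p) => [->|jp]; [move=> _ _; rewrite p3 ai|apply: h4].
  rewrite /= => j /ltS[ji|->] aj; last by rewrite eqxx.
  have ji' : (j == i') = false by rewrite -val_eqE /= ltn_eqF.
  rewrite ji'; case: (eqVneq j p) => [->|jp]; first by rewrite eq_sym.
  by apply: contraNneq jp => /(p5 _ ji aj) ->.
rewrite eval_ifF ?eH // eval_seq !eval_asg; split=> //.
exists M'; split=> //=; exists i'; split=> //.
move: h5; rewrite E eqxx => h5 j /ltS[ji|//] aj Mj.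
by have := h5 j ji aj; rewrite Mj eqxx.
Qed.

Lemma emit_quad_spec u (m M' : T -> T) (i : T) : holds_graph u -> holds_row u aMate m ->
  holds_row u aM M' -> env u vI = i ->
  uout (eval n emit_quad u) = uout u ++ [seq val x | x <- quad G m M' i].
Proof.
move=> hG hm hM hI; rewrite /emit_quad !eval_seq !eval_asg.
rewrite (ev_ld1 aM (i := i)) // hM.
set u1 := setv (setv u vA _) vB _.
have u1A : ev n (EVar vA) u1 = i by rewrite /= /upd /= hI.
have u1B : ev n (EVar vB) u1 = M' i by [].
set s := SIf _ _ _; set u2 := eval n s u1.
have [A2 B2] : env u2 vA = (orient G m i (M' i)).1 /\ env u2 vB = (orient G m i (M' i)).2.
  have mA : ev n (EMate (EVar vA)) u1 = m i by apply: ev_mate u1A.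
  have mB : ev n (EMate (EVar vB)) u1 = m (M' i) by apply: ev_mate u1B.
  have hG1 : holds_graph u1 by [].
  rewrite /u2 /s /orient eval_if (ev_good hG1 u1A u1B) bool_neq0.
  case: ifP => _ //.
  rewrite eval_if (ev_good hG1 u1A mB) bool_neq0; case: ifP => _.
    by rewrite eval_asg mB.
  rewrite eval_if (ev_good hG1 mA u1B) bool_neq0; case: ifP => _.
    by rewrite eval_asg mA.
  rewrite eval_if (ev_good hG1 mA mB) bool_neq0; case: ifP => _ //.
have m2 : holds_row u2 aMate m by move=> j; rewrite /u2 eval_frame_arr //; apply: hm.
have o2 : uout u2 = uout u by rewrite /u2 eval_frame_out.
have mA2 : ev n (EMate (EVar vA)) u2 = m (orient G m i (M' i)).1 by exact: (ev_mate (a := EVar vA) m2 A2).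
have mB2 : ev n (EMate (EVar vB)) u2 = m (orient G m i (M' i)).2 by exact: (ev_mate (a := EVar vB) m2 B2).
have -> : uout (eval n (SEmit (EMate (EVar vB))) (eval n (SEmit (EVar vB))
    (eval n (SEmit (EVar vA)) (eval n (SEmit (EMate (EVar vA))) u2)))) =
  uout u2 ++ [:: ev n (EMate (EVar vA)) u2; env u2 vA; env u2 vB; ev n (EMate (EVar vB)) u2].
  by rewrite -!cat_rcons cats0.
by rewrite mA2 mB2 A2 B2 o2.
Qed.

Lemma emit_output_spec u (m M' : T -> T) : holds_graph u -> holds_row u aMate m ->
  holds_row u aM M' ->
  uout (eval n emit_output u) = uout u ++ [seq val x | x <- output G m M'].
Proof.
move=> hG hm hM; rewrite /emit_output /output; set body := SIf _ _ _.
pose L i := flatten [seq if leader m M' j then quad G m M' j else [::] | j <- take i (enum T)].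
pose P i u1 := (forall k, arr u1 k = arr u k) /\ uout u1 = uout u ++ [seq val x | x <- L i].
have [_ ] : P n (eval n (SFor vI body) u); last first.
  by rewrite /L take_oversize // size_enum_ord.
apply: for_ind; first by rewrite /P /L take0 cats0.
move=> i u1 iN [a1 o1]; set u2 := setv u1 vI i; pose i' := Ordinal iN.
have hG2 : holds_graph u2 by rewrite /holds_graph /u2 /= a1.
have hm2 : holds_row u2 aMate m by rewrite /holds_row /u2 /= a1.
have hM2 : holds_row u2 aM M' by rewrite /holds_row /u2 /= a1.
have i2 : ev n (EVar vI) u2 = i' by [].
split; first by move=> k; rewrite eval_frame_arr //= a1.
have -> : L i.+1 = L i ++ (if leader m M' i' then quad G m M' i' else [::]).
  rewrite /L (take_nth i') ?size_enum_ord // map_rcons flatten_rcons.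
  by have -> : nth i' (enum T) i = i' by apply: val_inj; rewrite /= nth_enum_ord.
have evc : ev n (EAnd (ELt (EVar vI) (EMate (EVar vI))) (ELt (EVar vI) (ELd1 aM (EVar vI)))) u2
    = leader m M' i'.
  apply: ev_and; first by rewrite ev_lt i2 (ev_mate hm2 i2).
  by rewrite ev_lt i2 (ev_ld1 _ i2) hM2.
rewrite /body eval_if evc bool_neq0 map_cat catA -o1.
case: ifP => _; last by rewrite cats0.
exact: emit_quad_spec.
Qed.

End Program.

(** * Correctness of the program and the ratio *)

Section Correctness.
Variables (n : nat) (G : graph12 n).
Notation T := 'I_n.

(** The active set is stable under the new involution and has even size, so it contains an even
    number of fixed points; by [pair_up_spec] there is at most one, hence none. *)
Lemma pair_up_total act u (a : pred T) (M : T -> T) : holds_row u aM M -> involutive M ->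
  (forall u' (i : T), (forall k, k != aM -> arr u' k = arr u k) -> env u' vI = i ->
     ev n act u' = a i) ->
  (forall i, a i -> a (M i)) -> ~~ odd #|[set i | a i]| ->
  exists M', [/\ holds_row (eval n (pair_up act) u) aM M', involutive M',
    forall i, M i != i -> M' i = M i, forall i, a i -> M' i != i & forall i, a i -> a (M' i)].
Proof.
move=> hM MK hact aM_ even_a; have [M' [h1 h2 h3 h4 h5]] := pair_up_spec hM MK hact.
have a' i : a i -> a (M' i).
  move=> ai; have [Mi|/h3->] := eqVneq (M i) i; last exact: aM_.
  by have [->//|ne] := eqVneq (M' i) i; have [] := h4 _ ne Mi.
exists M'; split=> // i ai; apply/negP => Mi.
have /(odd_card_fixs h2) : forall x, x \in [set i | a i] -> M' x \in [set i | a i].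
  by move=> x; rewrite !inE => /a'.
rewrite (negbTE even_a) (_ : _ :&: _ = [set i | a i && (M' i == i)]); last first.
  by apply/setP => x; rewrite !inE.
have : 0 < #|[set i | a i && (M' i == i)]| by apply/card_gt0P; exists i; rewrite inE ai.
by case: #|_| h5 => [//|[]].
Qed.

Lemma cycle_packing_spec u : 4 %| n -> holds_graph G u -> uout u = [::] ->
  exists s : seq T, [/\ uout (eval n cycle_packing u) = [seq val x | x <- s], size s = n,
    packing4 (cycles_of s) & 7 * opt4CP G <= 8 * packing_weight G (cycles_of s)].
Proof.
move=> n4 hG0 out0; rewrite /cycle_packing 7!eval_seq.
set u1 := eval n (fill_rel (EGood _ _)) u.
have hE1 : holds_rel u1 (good G).
  apply: fill_rel_spec => u' v w same hv hw; apply: ev_good => // i j.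
  by rewrite same //; apply: hG0.
set u2 := eval n max_matching u1.
have [M0 [mat0 cert0 hM0]] := max_matching_spec (good_sym G) (good_irr G) hE1 (erefl u2).
have [M0K _] := mat0.
set u3 := eval n (pair_up (ECst 1)) u2.
have [m [hm3 mK ext0 m_neq _]] : exists M', [/\ holds_row u3 aM M', involutive M',
    forall i, M0 i != i -> M' i = M0 i, forall i : T, xpredT i -> M' i != i &
    forall i : T, xpredT i -> xpredT (M' i)].
  apply: pair_up_total => //; rewrite (_ : [set i | _] = [set: T]).
    by rewrite cardsT card_ord -dvdn2 (dvdn_trans _ n4).
  by apply/setP => i; rewrite !inE.
have {}m_neq x : m x != x := m_neq x isT.
set u4 := eval n (copy_row _ _ _ _) u3.
have hm4 : holds_row u4 aMate m.
  move=> i; have n0 := ord_pos i; rewrite /u4.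
  by have [-> // _ _ _] := @copy_row_spec n aMate (ECst 0) aM (ECst 0) u3 0 0 isT n0 n0
    (fun _ _ => erefl) (fun _ _ => erefl).
have hG4 : holds_graph G u4 by move=> i j; rewrite !eval_frame_arr.
set u5 := eval n (fill_rel (EContracted _ _)) u4.
have hE5 : holds_rel u5 (contracted G m).
  apply: fill_rel_spec => u' v w same hv hw; apply: ev_contracted => //.
    by move=> i j; rewrite same //; apply: hG4.
  by move=> i; rewrite same //; apply: hm4.
set u6 := eval n max_matching u5.
have [M1 [mat1 cert1 hM1]] :=
  max_matching_spec (contracted_sym G m) (contracted_irr G m) hE5 (erefl u6).
have [M1K _] := mat1.
have hm6 : holds_row u6 aMate m by move=> i; rewrite /u6 eval_frame_arr // /u5 eval_frame_arr //; apply: hm4.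
have hG6 : holds_graph G u6 by move=> i j; rewrite !eval_frame_arr //; apply: hG4.
set u7 := eval n (pair_up _) u6.
have [M' [hM7 M'K ext1 M'_neq M'_rep]] : exists M', [/\ holds_row u7 aM M', involutive M',
    forall i, M1 i != i -> M' i = M1 i, forall i, rep m i -> M' i != i &
    forall i, rep m i -> rep m (M' i)].
  apply: pair_up_total => //.
  - move=> u' i same hi; have hm' : holds_row u' aMate m by move=> j; rewrite same.
    by rewrite ev_lt (ev_mate (a := EVar vI) hm' hi) /= hi.
  - move=> i ri; apply/negPn/negP => nr; have := nonrep_fix mat1 nr.
    by rewrite M1K => E; rewrite -E ri in nr.
  (* There are [n / 2] representatives, an even number since 4 divides [n]. *)
  - have aux r N k : 2 * r = N -> N = k * 4 -> ~~ odd r by clear; lia.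
    by case/dvdnP: n4 => k; apply: aux (card_reps mK m_neq).
have hG7 : holds_graph G u7 by move=> i j; rewrite eval_frame_arr //; apply: hG6.
have hm7 : holds_row u7 aMate m by move=> i; rewrite eval_frame_arr //; apply: hm6.
exists (output G m M'); split.
- rewrite (emit_output_spec hG7 hm7 hM7).
  by rewrite /u7 /u6 /u5 /u4 /u3 /u2 /u1 !eval_frame_out // out0.
- exact: size_output.
- exact: packing_output.
have low := output_weight mK m_neq M'K M'_neq M'_rep mat0 ext0 mat1 ext1.
have high : 7 * opt4CP G + 4 * #|fixs M0| + 4 * #|fixs M1 :&: [set x | rep m x]| <= 14 * n.
  have [|Q packQ optQ] := @eq_bigmax_cond _ (@packing4 n) (packing_weight G).
    by apply/card_gt0P; exists (cycles_of (output G m M')); apply: packing_output.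
  by rewrite [opt4CP G]optQ; apply: packing_bound packQ.
(* Twice [low] cancels both defects in [high]: [7 * o <= 14 * n - 4 * a - 4 * b <= 8 * w]. *)
move: low high; move: (packing_weight _ _) (opt4CP _) #|fixs M0| #|fixs M1 :&: _| => w o a b.
by clear; lia.
Qed.

Lemma nth_allpairs_ord (f : T -> T -> nat) (s : seq T) k (j : T) : k < size s ->
  nth 0 [seq f i j | i <- s, j <- enum T] (k * n + j) = f (nth j s k) j.
Proof.
have size_row i : size [seq f i j | j <- enum T] = n by rewrite size_map size_enum_ord.
elim: s k => [//|i s IH] [|k] ks; rewrite /allpairs_dep /= nth_cat size_row.
  by rewrite mul0n add0n ltn_ord (nth_map j) ?size_enum_ord // nth_ord_enum.
rewrite ltnNge mulSn -addnA leq_addr /= addKn; exact: IH.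
Qed.

Lemma ust0_encode : holds_graph G (ust0 (encode G)).
Proof.
move=> i j; rewrite /= /addr mul0n add0n addn1 /=.
by rewrite nth_allpairs_ord ?size_enum_ord // nth_ord_enum.
Qed.

(** Each of the [n * n] matrix entries counts for at least one bit. *)
Lemma bitsize_encode : n <= bitsize (encode G).
Proof.
rewrite /bitsize big_cons; set S := \sum_(_ <- _) _.
suff : n * n <= S by case: (n) => // k; rewrite mulnS; lia.
apply: (@leq_trans (size [seq (if i == j then 0 else G [set i; j]) | i <- enum T, j <- enum T])).
  by rewrite size_allpairs size_enum_ord.
by rewrite /S -sum1_size; apply: leq_sum.
Qed.

End Correctness.

Theorem mainTheorem9 :
  exists c : cmd,
    polynomial_time c instance_4CP /\
    approximation_algorithm_4CP (7%:R / 8%:R)%R c.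
Proof.
exists (compile cycle_packing); split.
  by apply: compile_polynomial_time => _ [n [G [_ ->]]]; apply: bitsize_encode.
move=> n G n4; have [t _ run] := compile_runs cycle_packing (encode G).
have [s [out_s /eqP size_s pack_s ratio]] :=
  cycle_packing_spec n4 (ust0_encode G) (erefl _).
exists t, (Tuple size_s); split; [by rewrite -out_s|exact: pack_s|].
rewrite GRing.mulrAC Num.Theory.ler_pdivrMr ?Num.Theory.ltr0n //.
rewrite -!GRing.natrM Num.Theory.ler_nat [X in _ <= X]mulnC.
exact: ratio.
Qed.
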